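(* Let $0<q<1$ and, for $n\in\mathbb{N}$, let $\mathscr{E}_n=\mathcal{O}(S^7_q)\,\Box^{\mathcal{O}(SU_q(2))}\,V_n$ be the $\mathcal{O}(S^4_q)$-bimodule associated to the irreducible corepresentation $V_n$ of $\mathcal{O}(SU_q(2))$ of dimension $n+1$. For every $n\geq1$, $$\mathrm{ch}_1([\mathscr{E}_n])=-\frac16\,n(n+1)(n+2).$$
   Context: For a matrix $a$, $a_i^j$ is the entry in row $i$, column $j$. $\mathcal{O}(S^7_q)$ is the unital $*$-algebra over $\mathbb{C}$ generated by $x_i,x_i^*$ ($i=1,\dots,4$) with relations $x_1x_2=qx_2x_1$, $x_1x_3=qx_3x_1$, $x_1x_4=q^2x_4x_1$, $x_2x_3=q^2x_3x_2+q^2(q-q^{-1})x_4x_1$, $x_2x_4=qx_4x_2$, $x_3x_4=qx_4x_3$; $x_1^*x_1=x_1x_1^*$, $x_1^*x_2=qx_2x_1^*$, $x_1^*x_3=qx_3x_1^*$, $x_1^*x_4=q^2x_4x_1^*$, $x_2^*x_2=x_2x_2^*+(1-q^2)x_1x_1^*$, $x_2^*x_3=q^2x_3x_2^*$, $x_2^*x_4=qx_4x_2^*+q^2(q-q^{-1})x_3x_1^*$, $x_3^*x_3=x_3x_3^*+(1-q^4)x_2x_2^*+(1-q^2)x_1x_1^*$, $x_3^*x_4=qx_4x_3^*-q^4(q-q^{-1})x_2x_1^*$; $x_1x_1^*+x_2x_2^*+x_3x_3^*+x_4x_4^*=1$, $q^8x_1^*x_1+q^6x_2^*x_2+q^2x_3^*x_3+x_4^*x_4=1$;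 and the adjoints of all these relations. $\mathcal{O}(SU_q(2))$ is the Hopf $*$-algebra generated by $\alpha,\gamma$ and their adjoints with relations expressing that $T_{(1)}=\begin{pmatrix}\alpha&-q\gamma^*\\ \gamma&\alpha^*\end{pmatrix}$ (rows and columns counted from $0$) is a unitary matrix, and coproduct $\Delta\big((T_{(1)})_i^j\big)=\sum_k(T_{(1)})_i^k\otimes(T_{(1)})_k^j$. It coacts on $\mathcal{O}(S^7_q)$ by the $*$-algebra map $\delta_R$ with $\delta_R(u_i^k)=\sum_{j=0,1}u_i^j\otimes(T_{(1)})_j^k$, where $$u=\begin{pmatrix} qx_1 & qx_2 \\ -q^2x_2^* & q^3x_1^* \\ -x_3 & x_4 \\ x_4^* & qx_3^* \end{pmatrix}$$ (rows $1,\dots,4$, columns $0,1$). $\mathcal{O}(S^4_q)=\{b\in\mathcal{O}(S^7_q):\delta_R(b)=b\otimes1\}$; the inclusion $\mathcal{O}(S^4_q)\subset\mathcal{O}(S^7_q)$ is a faithfully flat Hopf–Galois extension. For every $n\in\mathbb{N}$ there is, up to isomorphism, exactly one irreducible left comodule $V_n$ of $\mathcal{O}(SU_q(2))$ of dimension $n+1$. The cotensor product $\mathcal{O}(S^7_q)\Box^{H}V_n$ (with $H=\mathcal{O}(SU_q(2))$) is $\{w\in\mathcal{O}(S^7_q)\otimes V_n:(\delta_R\otimes\mathrm{id})w=(\mathrm{id}\otimes\delta_L)w\}$, where $\delta_L$ is the coaction on $V_n$; it is an $\mathcal{O}(S^4_q)$-bimodule by multiplication on the first leg, finitely generated and projective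 as a right module. The character $\varepsilon:\mathcal{O}(S^7_q)\to\mathbb{C}$ is given by $\varepsilon(x_i)=0$ for $i\neq4$, $\varepsilon(x_4)=1$. The bounded $*$-representation $\pi$ of $\mathcal{O}(S^7_q)$ on $\mathcal{H}=\ell^2(\mathbb{N}^2)$ (with $0\in\mathbb{N}$ and canonical orthonormal basis $|k_1,k_2\rangle$) is given by $\pi(x_1)=0$, $\pi(x_2)|k_1,k_2\rangle=q^{k_1+2k_2}|k_1,k_2\rangle$, $\pi(x_3)|k_1,k_2\rangle=q^{k_1}\sqrt{1-q^{4(k_2+1)}}\,|k_1,k_2+1\rangle$, $\pi(x_4)|k_1,k_2\rangle=\sqrt{1-q^{2(k_1+1)}}\,|k_1+1,k_2\rangle$. For all $b\in\mathcal{O}(S^4_q)$, $\pi(b)-\varepsilon(b)$ is of trace class. For $\mathscr{F}\cong P\,\mathcal{O}(S^4_q)^N$ as a right module, with $P\in M_N(\mathcal{O}(S^4_q))$ idempotent, $\mathrm{ch}_1([\mathscr{F}])=\mathrm{Tr}_{\mathcal{H}}\big(\pi(\mathrm{Tr}\,P)-\varepsilon(\mathrm{Tr}\,P)\big)$, where $\mathrm{Tr}\,P=\sum_kP_k^k$. *)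

(* Defs.v *)
From HB Require Import structures.
From mathcomp Require Import all_boot all_order all_algebra.
From mathcomp Require Import finmap.
From mathcomp Require Import complex ring.
From mathcomp Require Import boolp classical_sets functions cardinality fsbigop.
From mathcomp Require Import reals ereal esum.

Set Implicit Arguments.
Unset Strict Implicit.
Unset Printing Implicit Defensive.

Import Order.TTheory GRing.Theory Num.Theory.

Local Open Scope classical_set_scope.
Local Open Scope ring_scope.
Local Open Scope quotient_scope.

(* The library's [algType] requires 1 != 0. Here the zero algebra is allowed,
   so that every presentation by generators and relations is an instance. The
   library has no join of [pzRingType] and [lmodType], hence the product is
   part of the mixin and the ring structure is derived below. *)
HB.mixin Record isStarAlgebra (C : numClosedFieldType) A
    of GRing.Lmodule C A := {
  sone : A;
  smul : A -> A -> A;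
  star : A -> A;
  smulA : associative smul;
  smul1l : left_id sone smul;
  smul1r : right_id sone smul;
  smulDl : left_distributive smul +%R;
  smulDr : right_distributive smul +%R;
  scale_mull : forall (c : C) (a b : A), c *: smul a b = smul (c *: a) b;
  scale_mulr : forall (c : C) (a b : A), c *: smul a b = smul a (c *: b);
  starK : involutive star;
  starD : {morph star : a b / a + b};
  starM : forall a b, star (smul a b) = smul (star b) (star a);
  starZ : forall (c : C) a, star (c *: a) = c^* *: star a
}.

#[short(type="starAlgType")]
HB.structure Definition StarAlgebra (C : numClosedFieldType) :=
  {A of GRing.Lmodule C A & isStarAlgebra C A}.

HB.instance Definition _ (C : numClosedFieldType) (A : starAlgType C) :=
  GRing.Zmodule_isPzRing.Build A
    smulA (@smul1l C A) (@smul1r C A) smulDl smulDr.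

Notation "a ^*s" := (star a) (at level 1, format "a ^*s") : ring_scope.

Record is_star_hom (C : numClosedFieldType) (A B : starAlgType C)
    (f : A -> B) : Prop := IsStarHom {
  star_hom_linear : linear f;
  star_hom1 : f 1 = 1;
  star_homM : {morph f : a b / a * b};
  star_homS : forall a, f a^*s = (f a)^*s
}.

Section ComplexStarAlgebra.
Variable R : rcfType.

Fact complex_scale_mull (c a b : R[i]) : c *: (a * b) = (c *: a) * b.
Proof. exact: mulrA. Qed.

Fact complex_scale_mulr (c a b : R[i]) : c *: (a * b) = a * (c *: b).
Proof. exact: mulrCA. Qed.

Fact complex_starK : involutive (fun z : R[i] => z^*).
Proof. exact: conjCK. Qed.

Fact complex_starD : {morph (fun z : R[i] => z^*) : a b / a + b}.
Proof. exact: rmorphD. Qed.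

Fact complex_starM (a b : R[i]) : (a * b)^* = b^* * a^*.
Proof. by rewrite rmorphM mulrC. Qed.

Fact complex_starZ (c a : R[i]) : (c *: a)^* = c^* *: a^*.
Proof. exact: rmorphM. Qed.

HB.instance Definition _ := isStarAlgebra.Build R[i] R[i]
  (@mulrA R[i]) (@mul1r R[i]) (@mulr1 R[i]) (@mulrDl R[i]) (@mulrDr R[i])
  complex_scale_mull complex_scale_mulr complex_starK complex_starD
  complex_starM complex_starZ.

End ComplexStarAlgebra.

(* Unital *-algebras presented by generators and relations: formal
   *-polynomials in the generators, modulo the smallest *-algebra congruence
   containing the relations (hence also their adjoints). *)
Section Presentation.
Variables (C : numClosedFieldType) (G : Type).

Inductive sterm : Type :=
| SGen of G
| SCst of C
| SAdd of sterm & sterm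
| SMul of sterm & sterm
| SStar of sterm.

HB.instance Definition _ := gen_eqMixin sterm.
HB.instance Definition _ := gen_choiceMixin sterm.

Variable relat : sterm -> sterm -> Prop.

Inductive scongr : sterm -> sterm -> Prop :=
| scongr_rel s t of relat s t : scongr s t
| scongr_refl s : scongr s s
| scongr_sym s t of scongr s t : scongr t s
| scongr_trans s t u of scongr s t & scongr t u : scongr s u
| scongr_add s s' t t' of scongr s s' & scongr t t' :
    scongr (SAdd s t) (SAdd s' t')
| scongr_mul s s' t t' of scongr s s' & scongr t t' :
    scongr (SMul s t) (SMul s' t')
| scongr_star s s' of scongr s s' : scongr (SStar s) (SStar s')
| scongr_addA s t u : scongr (SAdd s (SAdd t u)) (SAdd (SAdd s t) u)
| scongr_addC s t : scongr (SAdd s t) (SAdd t s)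
| scongr_add0 s : scongr (SAdd (SCst 0) s) s
| scongr_addN s : scongr (SAdd (SMul (SCst (-1)) s) s) (SCst 0)
| scongr_mulA s t u : scongr (SMul s (SMul t u)) (SMul (SMul s t) u)
| scongr_mul1l s : scongr (SMul (SCst 1) s) s
| scongr_mul1r s : scongr (SMul s (SCst 1)) s
| scongr_mulDl s t u : scongr (SMul (SAdd s t) u) (SAdd (SMul s u) (SMul t u))
| scongr_mulDr s t u : scongr (SMul s (SAdd t u)) (SAdd (SMul s t) (SMul s u))
| scongr_cstD a b : scongr (SCst (a + b)) (SAdd (SCst a) (SCst b))
| scongr_cstM a b : scongr (SCst (a * b)) (SMul (SCst a) (SCst b))
| scongr_cstC a s : scongr (SMul (SCst a) s) (SMul s (SCst a))
| scongr_cstS a : scongr (SStar (SCst a)) (SCst a^*)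
| scongr_starK s : scongr (SStar (SStar s)) s
| scongr_starD s t : scongr (SStar (SAdd s t)) (SAdd (SStar s) (SStar t))
| scongr_starM s t : scongr (SStar (SMul s t)) (SMul (SStar t) (SStar s)).


Definition scongrb (s t : sterm) : bool := `[< scongr s t >].

Fact scongrb_refl : reflexive scongrb.
Proof. by move=> s; apply/asboolP; exact: scongr_refl. Qed.

Fact scongrb_sym : symmetric scongrb.
Proof. by move=> s t; apply/asboolP/asboolP; exact: scongr_sym. Qed.

Fact scongrb_trans : transitive scongrb.
Proof.
by move=> t s u /asboolP st /asboolP tu; apply/asboolP; exact: scongr_trans tu.
Qed.

Canonical scongr_equiv :=
  EquivRel scongrb scongrb_refl scongrb_sym scongrb_trans.

Definition presented : Type := {eq_quot scongr_equiv}.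

HB.instance Definition _ := Choice.on presented.
HB.instance Definition _ := EqQuotient.on presented.

Lemma pi_presentedP (s t : sterm) :
  scongr s t <-> \pi_presented s = \pi_presented t.
Proof.
split=> [st|/eqquotP /asboolP //].
by apply/eqquotP; apply/asboolP.
Qed.

Lemma repr_presented (s : sterm) : scongr (repr (\pi_presented s)) s.
Proof. by apply/pi_presentedP; rewrite reprK. Qed.

Definition presented_cst (c : C) : presented := \pi_presented (SCst c).
Definition presented_gen (g : G) : presented := \pi_presented (SGen g).
Definition presented_add := lift_op2 presented SAdd.
Definition presented_mul := lift_op2 presented SMul.
Definition presented_star := lift_op1 presented SStar.
Definition presented_opp (x : presented) : presented :=
  presented_mul (presented_cst (-1)) x.
Definition presented_scale (c : C) (x : presented) : presented :=
  presented_mul (presented_cst c) x.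

Lemma presented_add_pi s t :
  presented_add (\pi_presented s) (\pi_presented t) = \pi_presented (SAdd s t).
Proof.
unlock presented_add; apply/pi_presentedP.
by apply: scongr_add; exact: repr_presented.
Qed.

Lemma presented_mul_pi s t :
  presented_mul (\pi_presented s) (\pi_presented t) = \pi_presented (SMul s t).
Proof.
unlock presented_mul; apply/pi_presentedP.
by apply: scongr_mul; exact: repr_presented.
Qed.

Lemma presented_star_pi s :
  presented_star (\pi_presented s) = \pi_presented (SStar s).
Proof.
unlock presented_star; apply/pi_presentedP.
by apply: scongr_star; exact: repr_presented.
Qed.

Let presentedE := (presented_add_pi, presented_mul_pi, presented_star_pi).

Fact presented_addA : associative presented_add.
Proof.
elim/quotW=> s; elim/quotW=> t; elim/quotW=> u; rewrite !presentedE.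
by apply/pi_presentedP; exact: scongr_addA.
Qed.

Fact presented_addC : commutative presented_add.
Proof.
elim/quotW=> s; elim/quotW=> t; rewrite !presentedE.
by apply/pi_presentedP; exact: scongr_addC.
Qed.

Fact presented_add0 : left_id (presented_cst 0) presented_add.
Proof.
by elim/quotW=> s; rewrite !presentedE; apply/pi_presentedP; exact: scongr_add0.
Qed.

Fact presented_addN :
  left_inverse (presented_cst 0) presented_opp presented_add.
Proof.
elim/quotW=> s; rewrite /presented_opp !presentedE.
by apply/pi_presentedP; exact: scongr_addN.
Qed.

HB.instance Definition _ := GRing.isZmodule.Build presented
  presented_addA presented_addC presented_add0 presented_addN.

Fact presented_mulA : associative presented_mul.
Proof.
elim/quotW=> s; elim/quotW=> t; elim/quotW=> u; rewrite !presentedE.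
by apply/pi_presentedP; exact: scongr_mulA.
Qed.

Fact presented_mul1l : left_id (presented_cst 1) presented_mul.
Proof.
by elim/quotW=> s; rewrite !presentedE; apply/pi_presentedP; exact: scongr_mul1l.
Qed.

Fact presented_mul1r : right_id (presented_cst 1) presented_mul.
Proof.
by elim/quotW=> s; rewrite !presentedE; apply/pi_presentedP; exact: scongr_mul1r.
Qed.

Fact presented_mulDl : left_distributive presented_mul presented_add.
Proof.
elim/quotW=> s; elim/quotW=> t; elim/quotW=> u; rewrite !presentedE.
by apply/pi_presentedP; exact: scongr_mulDl.
Qed.

Fact presented_mulDr : right_distributive presented_mul presented_add.
Proof.
elim/quotW=> s; elim/quotW=> t; elim/quotW=> u; rewrite !presentedE.
by apply/pi_presentedP; exact: scongr_mulDr.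
Qed.

Fact presented_cstM (a b : C) :
  presented_cst (a * b) = presented_mul (presented_cst a) (presented_cst b).
Proof.
by rewrite presented_mul_pi; apply/pi_presentedP; exact: scongr_cstM.
Qed.

Fact presented_cstD (a b : C) :
  presented_cst (a + b) = presented_cst a + presented_cst b.
Proof.
by rewrite [RHS]presented_add_pi; apply/pi_presentedP; exact: scongr_cstD.
Qed.

Fact presented_cstC (c : C) (x : presented) :
  presented_mul (presented_cst c) x = presented_mul x (presented_cst c).
Proof.
elim/quotW: x => s.
rewrite !presented_mul_pi.
by apply/pi_presentedP; exact: scongr_cstC.
Qed.

Fact presented_scaleA a b x :
  presented_scale a (presented_scale b x) = presented_scale (a * b) x.
Proof.
by rewrite /presented_scale presented_cstM presented_mulA.
Qed.

Fact presented_scale1 : left_id 1 presented_scale.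
Proof. exact: presented_mul1l. Qed.

Fact presented_scaleDr : right_distributive presented_scale +%R.
Proof. by move=> c x y; exact: presented_mulDr. Qed.

Fact presented_scaleDl x : {morph presented_scale^~ x : a b / a + b}.
Proof.
by move=> a b; rewrite /presented_scale presented_cstD; exact: presented_mulDl.
Qed.

HB.instance Definition _ := GRing.Zmodule_isLmodule.Build C presented
  presented_scaleA presented_scale1 presented_scaleDr presented_scaleDl.

Fact presented_scale_mull (c : C) (a b : presented) :
  c *: presented_mul a b = presented_mul (c *: a) b.
Proof. exact: presented_mulA. Qed.

Fact presented_scale_mulr (c : C) (a b : presented) :
  c *: presented_mul a b = presented_mul a (c *: b).
Proof.
rewrite /GRing.scale/= /presented_scale !presented_mulA.
by rewrite (presented_cstC c a).
Qed.

Fact presented_starK : involutive presented_star.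
Proof.
by elim/quotW=> s; rewrite !presentedE; apply/pi_presentedP; exact: scongr_starK.
Qed.

Fact presented_starD : {morph presented_star : a b / a + b}.
Proof.
elim/quotW=> s; elim/quotW=> t.
rewrite [_ + _]presented_add_pi [RHS]/GRing.add/= !presentedE.
by apply/pi_presentedP; exact: scongr_starD.
Qed.

Fact presented_starM (a b : presented) :
  presented_star (presented_mul a b) =
  presented_mul (presented_star b) (presented_star a).
Proof.
elim/quotW: a => s; elim/quotW: b => t.
rewrite !presentedE.
by apply/pi_presentedP; exact: scongr_starM.
Qed.

Fact presented_starZ (c : C) (a : presented) :
  presented_star (c *: a) = c^* *: presented_star a.
Proof.
rewrite /GRing.scale/= /presented_scale presented_starM presented_cstC.
congr presented_mul.
by rewrite /presented_cst presentedE; apply/pi_presentedP; exact: scongr_cstS.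
Qed.

HB.instance Definition _ := isStarAlgebra.Build C presented
  presented_mulA presented_mul1l presented_mul1r
  presented_mulDl presented_mulDr
  presented_scale_mull presented_scale_mulr presented_starK presented_starD
  presented_starM presented_starZ.

End Presentation.

Arguments SGen {C G} _.
Arguments SCst {C G} _.

Section Tensor.
Variables (K : fieldType) (U V : lmodType K).

Inductive tens_equiv : seq (U * V) -> seq (U * V) -> Prop :=
| tens_refl s : tens_equiv s s
| tens_sym s t of tens_equiv s t : tens_equiv t s
| tens_trans s t r of tens_equiv s t & tens_equiv t r : tens_equiv s r
| tens_cat s s' t t' of tens_equiv s s' & tens_equiv t t' :
    tens_equiv (s ++ t) (s' ++ t')
| tens_catC s t : tens_equiv (s ++ t) (t ++ s)
| tens_addl u u' v : tens_equiv [:: (u + u', v)] [:: (u, v); (u', v)]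
| tens_addr u v v' : tens_equiv [:: (u, v + v')] [:: (u, v); (u, v')]
| tens_scale a u v : tens_equiv [:: (a *: u, v)] [:: (u, a *: v)]
| tens_zero v : tens_equiv [:: (0, v)] [::].

Definition tens_equivb (s t : seq (U * V)) : bool := `[< tens_equiv s t >].

Fact tens_equivb_refl : reflexive tens_equivb.
Proof. by move=> s; apply/asboolP; exact: tens_refl. Qed.

Fact tens_equivb_sym : symmetric tens_equivb.
Proof. by move=> s t; apply/asboolP/asboolP; exact: tens_sym. Qed.

Fact tens_equivb_trans : transitive tens_equivb.
Proof.
by move=> t s u /asboolP st /asboolP tu; apply/asboolP; exact: tens_trans tu.
Qed.

Canonical tens_equiv_rel :=
  EquivRel tens_equivb tens_equivb_refl tens_equivb_sym tens_equivb_trans.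

(* U (x) V: formal sums of pure tensors modulo bilinearity *)
Definition tensor : Type := {eq_quot tens_equiv_rel}.

HB.instance Definition _ := Choice.on tensor.
HB.instance Definition _ := EqQuotient.on tensor.

Lemma pi_tensorP (s t : seq (U * V)) :
  tens_equiv s t <-> \pi_tensor s = \pi_tensor t.
Proof.
split=> [st|/eqquotP /asboolP //].
by apply/eqquotP; apply/asboolP.
Qed.

Lemma repr_tensor (s : seq (U * V)) : tens_equiv (repr (\pi_tensor s)) s.
Proof. by apply/pi_tensorP; rewrite reprK. Qed.

Definition tens (u : U) (v : V) : tensor := \pi_tensor [:: (u, v)].
Definition tensor_add := lift_op2 tensor cat.
Definition scale_seq (a : K) (s : seq (U * V)) :=
  [seq (a *: p.1, p.2) | p <- s].
Definition tensor_scale (a : K) := lift_op1 tensor (scale_seq a).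
Definition tensor_opp (x : tensor) : tensor := tensor_scale (-1) x.

Lemma tensor_add_pi s t :
  tensor_add (\pi_tensor s) (\pi_tensor t) = \pi_tensor (s ++ t).
Proof.
unlock tensor_add; apply/pi_tensorP.
by apply: tens_cat; exact: repr_tensor.
Qed.

Lemma tens_equiv_scale a s t : tens_equiv s t ->
  tens_equiv (scale_seq a s) (scale_seq a t).
Proof.
rewrite /scale_seq; elim=> {s t} [s|s t _|s t r _ st _|s s' t t' _ ss _|s t|u u' v|u v v'|b u v|v].
- exact: tens_refl.
- exact: tens_sym.
- exact: tens_trans.
- by rewrite !map_cat; exact: tens_cat.
- by rewrite !map_cat; exact: tens_catC.
- by rewrite /= scalerDr; exact: tens_addl.
- exact: tens_addr.
- by rewrite /= scalerA mulrC -scalerA; exact: tens_scale.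
- by rewrite /= scaler0; exact: tens_zero.
Qed.

Lemma tensor_scale_pi a s :
  tensor_scale a (\pi_tensor s) = \pi_tensor (scale_seq a s).
Proof.
unlock tensor_scale; apply/pi_tensorP.
by apply: tens_equiv_scale; exact: repr_tensor.
Qed.

Fact tensor_addA : associative tensor_add.
Proof.
by elim/quotW=> s; elim/quotW=> t; elim/quotW=> u; rewrite !tensor_add_pi catA.
Qed.

Fact tensor_addC : commutative tensor_add.
Proof.
elim/quotW=> s; elim/quotW=> t; rewrite !tensor_add_pi.
by apply/pi_tensorP; exact: tens_catC.
Qed.

Fact tensor_add0 : left_id (\pi_tensor [::]) tensor_add.
Proof. by elim/quotW=> s; rewrite tensor_add_pi. Qed.

Fact tensor_scaleDl x :
  {morph tensor_scale^~ x : a b / a + b >-> tensor_add a b}.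
Proof.
elim/quotW: x => s a b; rewrite !tensor_scale_pi tensor_add_pi.
apply/pi_tensorP; elim: s => [|[u v] s IHs] /=; first exact: tens_refl.
change (tens_equiv ([:: ((a + b) *: u, v)] ++ scale_seq (a + b) s)
  (([:: (a *: u, v)] ++ scale_seq a s) ++ ([:: (b *: u, v)] ++ scale_seq b s))).
rewrite scalerDl.
apply: tens_trans (tens_cat (tens_addl _ _ _) IHs) _.
rewrite -[[:: _; _]]/([:: _] ++ [:: _]) -!catA.
apply: tens_cat; first exact: tens_refl.
rewrite !catA; apply: tens_cat; last exact: tens_refl.
exact: tens_catC.
Qed.

Lemma tensor_scale0 x : tensor_scale 0 x = \pi_tensor [::].
Proof.
elim/quotW: x => s; rewrite tensor_scale_pi; apply/pi_tensorP.
elim: s => [|[u v] s IHs] /=; first exact: tens_refl.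
by rewrite scale0r -cat1s; exact: (tens_cat (tens_zero v) IHs).
Qed.

Fact tensor_scale1 : left_id 1 tensor_scale.
Proof.
elim/quotW=> s; rewrite tensor_scale_pi; congr \pi_tensor.
by rewrite -[RHS]map_id; apply: eq_map => -[u v] /=; rewrite scale1r.
Qed.

Fact tensor_addN : left_inverse (\pi_tensor [::]) tensor_opp tensor_add.
Proof.
move=> x; rewrite /tensor_opp -{2}[x]tensor_scale1 -tensor_scaleDl.
by rewrite addNr tensor_scale0.
Qed.

HB.instance Definition _ := GRing.isZmodule.Build tensor
  tensor_addA tensor_addC tensor_add0 tensor_addN.

Fact tensor_scaleA a b x :
  tensor_scale a (tensor_scale b x) = tensor_scale (a * b) x.
Proof.
elim/quotW: x => s; rewrite !tensor_scale_pi /scale_seq -map_comp; congr \pi_tensor.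
by apply: eq_map => -[u v] /=; rewrite scalerA.
Qed.

Fact tensor_scaleDr : right_distributive tensor_scale +%R.
Proof.
move=> a; elim/quotW=> s; elim/quotW=> t.
rewrite [_ + _]tensor_add_pi [RHS]/GRing.add/= !tensor_scale_pi.
by rewrite tensor_add_pi /scale_seq map_cat.
Qed.

HB.instance Definition _ := GRing.Zmodule_isLmodule.Build K tensor
  tensor_scaleA tensor_scale1 tensor_scaleDr tensor_scaleDl.

Definition balanced (W : zmodType) (b : U -> V -> W) : Prop :=
  [/\ forall v, {morph b^~ v : u u' / u + u'},
      forall u, {morph b u : v v' / v + v'} &
      forall a u v, b (a *: u) v = b u (a *: v)].

(* the additive map induced on U (x) V by b, when b is balanced *)
Definition tlift (W : zmodType) (b : U -> V -> W) (x : tensor) : W :=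
  \sum_(p <- repr x) b p.1 p.2.

Section TensorLift.
Variables (W : zmodType) (b : U -> V -> W).
Hypothesis bP : balanced b.

Lemma tlift_pi s : tlift b (\pi_tensor s) = \sum_(p <- s) b p.1 p.2.
Proof.
case: bP => bl br bs; rewrite /tlift.
move: (repr _) (repr_tensor s) => r0; elim=> {r0 s}
  [s|s t _|s t r _ st _|s s' t t' _ ss _|s t|u u' v|u v v'|a u v|v] //.
- by rewrite st.
- by rewrite !big_cat /= ss => ->.
- by rewrite !big_cat /= addrC.
- by rewrite big_cons !big_cons !big_nil /= !addr0 bl.
- by rewrite big_cons !big_cons !big_nil /= !addr0 br.
- by rewrite !big_cons !big_nil /= bs.
- rewrite big_cons !big_nil /= addr0.
  by apply: (@addrI _ (b 0 v)); rewrite -bl !addr0.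
Qed.

Lemma tlift_tens u v : tlift b (tens u v) = b u v.
Proof. by rewrite tlift_pi big_cons big_nil addr0. Qed.

Lemma tliftD : {morph tlift b : x y / x + y}.
Proof.
elim/quotW=> s; elim/quotW=> t.
by rewrite [_ + _]tensor_add_pi !tlift_pi big_cat.
Qed.

End TensorLift.

Lemma tensDl v : {morph tens^~ v : u u' / u + u'}.
Proof.
move=> u u'; rewrite [RHS]tensor_add_pi.
by apply/pi_tensorP; exact: tens_addl.
Qed.

Lemma tensDr u : {morph tens u : v v' / v + v'}.
Proof.
move=> v v'; rewrite [RHS]tensor_add_pi.
by apply/pi_tensorP; exact: tens_addr.
Qed.

Lemma tensZl a u v : tens (a *: u) v = a *: tens u v.
Proof. by rewrite [RHS]tensor_scale_pi. Qed.

Lemma tensZr a u v : tens u (a *: v) = a *: tens u v.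
Proof.
rewrite -tensZl; apply/pi_tensorP; apply: tens_sym; exact: tens_scale.
Qed.

Lemma tensor_ind (P : tensor -> Prop) :
  P 0 -> (forall u v, P (tens u v)) -> (forall x y, P x -> P y -> P (x + y)) ->
  forall x, P x.
Proof.
move=> P0 Pt PD; elim/quotW; elim=> [|[u v] s IHs] //.
by rewrite -cat1s -tensor_add_pi; exact: PD (Pt u v) IHs.
Qed.

End Tensor.

Arguments tens {K U V} u v.
Arguments tlift {K U V W} b x.

Definition tmap (K : fieldType) (U V U' V' : lmodType K)
    (f : U -> U') (g : V -> V') : tensor U V -> tensor U' V' :=
  tlift (fun u v => tens (f u) (g v)).

Definition tassoc (K : fieldType) (U V W : lmodType K) :
    tensor U (tensor V W) -> tensor (tensor U V) W :=
  tlift (fun u => tlift (fun v w => tens (tens u v) w)).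

Section TensorStarAlgebra.
Variables (C : numClosedFieldType) (A B : starAlgType C).
Local Notation AB := (tensor A B).

Definition tensor_mul (x y : AB) : AB :=
  tlift (fun (a : A) (b : B) =>
    tlift (fun (a' : A) (b' : B) => tens (a * a') (b * b')) y) x.
Definition tensor_star : AB -> AB :=
  tlift (fun (a : A) (b : B) => tens a^*s b^*s).
Definition tensor_one : AB := tens (1 : A) (1 : B).

Fact balanced_mulr (a : A) (b : B) :
  balanced (fun (a' : A) (b' : B) => tens (a * a') (b * b')).
Proof.
split=> [b' a1 a2|a' b1 b2|c a' b'].
- by rewrite mulrDr tensDl.
- by rewrite mulrDr tensDr.
- by rewrite -[a * _]scale_mulr -[b * (c *: _)]scale_mulr tensZl tensZr.
Qed.

Fact balanced_mull (y : AB) :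
  balanced (fun (a : A) (b : B) =>
    tlift (fun (a' : A) (b' : B) => tens (a * a') (b * b')) y).
Proof.
split=> [b a1 a2|a b1 b2|c a b]; rewrite /tlift -?big_split /=;
  apply: eq_bigr => p _.
- by rewrite mulrDl tensDl.
- by rewrite mulrDl tensDr.
- by rewrite -[_ *: a * _]scale_mull -[_ *: b * _]scale_mull tensZl tensZr.
Qed.

Fact balanced_star : balanced (fun (a : A) (b : B) => tens a^*s b^*s).
Proof.
split=> [b a1 a2|a b1 b2|c a b].
- by rewrite starD tensDl.
- by rewrite starD tensDr.
- by rewrite !starZ tensZl tensZr.
Qed.

Lemma tensor_mul_tens (a : A) (b : B) (a' : A) (b' : B) :
  tensor_mul (tens a b) (tens a' b') = tens (a * a') (b * b').
Proof.
rewrite /tensor_mul (tlift_tens (balanced_mull _)).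
exact: (tlift_tens (balanced_mulr a b)).
Qed.

Lemma tensor_star_tens (a : A) (b : B) : tensor_star (tens a b) = tens a^*s b^*s.
Proof. exact: (tlift_tens balanced_star). Qed.

Fact tensor_mulDl : left_distributive tensor_mul +%R.
Proof. by move=> x y z; exact: (tliftD (balanced_mull z)). Qed.

Fact tensor_mulDr : right_distributive tensor_mul +%R.
Proof.
move=> x y z; rewrite /tensor_mul [in LHS]/tlift [in X in _ = X + _]/tlift.
rewrite [in X in _ = _ + X]/tlift -big_split; apply: eq_bigr => p _ /=.
exact: (tliftD (balanced_mulr p.1 p.2)).
Qed.

Fact tensor_starD : {morph tensor_star : x y / x + y}.
Proof. exact: (tliftD balanced_star). Qed.

Fact tensor_mul0l x : tensor_mul 0 x = 0.
Proof. by apply: (@addrI _ (tensor_mul 0 x)); rewrite -tensor_mulDl !addr0. Qed.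

Fact tensor_mul0r x : tensor_mul x 0 = 0.
Proof. by apply: (@addrI _ (tensor_mul x 0)); rewrite -tensor_mulDr !addr0. Qed.

Fact tensor_star0 : tensor_star 0 = 0.
Proof. by apply: (@addrI _ (tensor_star 0)); rewrite -tensor_starD !addr0. Qed.

Fact tensor_mulA : associative tensor_mul.
Proof.
elim/tensor_ind=> [y z|a b|x x' IHx IHx' y z].
- by rewrite !tensor_mul0l.
- elim/tensor_ind=> [z|a' b'|y y' IHy IHy' z].
  + by rewrite tensor_mul0r !tensor_mul0l tensor_mul0r.
  + elim/tensor_ind=> [|a'' b''|z z' IHz IHz'].
    * by rewrite !tensor_mul0r.
    * by rewrite !tensor_mul_tens !mulrA.
    * by rewrite !tensor_mulDr IHz IHz'.
  + by rewrite tensor_mulDl !tensor_mulDr tensor_mulDl IHy IHy'.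
- by rewrite !tensor_mulDl IHx IHx'.
Qed.

Fact tensor_mul1l : left_id tensor_one tensor_mul.
Proof.
elim/tensor_ind=> [|a b|x y IHx IHy]; first exact: tensor_mul0r.
- by rewrite tensor_mul_tens !mul1r.
- by rewrite tensor_mulDr IHx IHy.
Qed.

Fact tensor_mul1r : right_id tensor_one tensor_mul.
Proof.
elim/tensor_ind=> [|a b|x y IHx IHy]; first exact: tensor_mul0l.
- by rewrite tensor_mul_tens !mulr1.
- by rewrite tensor_mulDl IHx IHy.
Qed.

Fact tensor_scale_mull (c : C) (x y : AB) :
  c *: tensor_mul x y = tensor_mul (c *: x) y.
Proof.
elim/tensor_ind: x => [|a b|x x' IHx IHx'].
- by rewrite scaler0 !tensor_mul0l scaler0.
- elim/tensor_ind: y => [|a' b'|y y' IHy IHy'].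
  + by rewrite !tensor_mul0r scaler0.
  + by rewrite -tensZl !tensor_mul_tens -[_ *: a * _]scale_mull tensZl.
  + by rewrite !tensor_mulDr scalerDr IHy IHy'.
- by rewrite scalerDr !tensor_mulDl scalerDr IHx IHx'.
Qed.

Fact tensor_scale_mulr (c : C) (x y : AB) :
  c *: tensor_mul x y = tensor_mul x (c *: y).
Proof.
elim/tensor_ind: x => [|a b|x x' IHx IHx'].
- by rewrite !tensor_mul0l scaler0.
- elim/tensor_ind: y => [|a' b'|y y' IHy IHy'].
  + by rewrite scaler0 !tensor_mul0r scaler0.
  + by rewrite -tensZl !tensor_mul_tens -[a * (_ *: _)]scale_mulr tensZl.
  + by rewrite scalerDr !tensor_mulDr scalerDr IHy IHy'.
- by rewrite !tensor_mulDl scalerDr IHx IHx'.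
Qed.

Fact tensor_starK : involutive tensor_star.
Proof.
elim/tensor_ind=> [|a b|x y IHx IHy]; first by rewrite !tensor_star0.
- by rewrite !tensor_star_tens !starK.
- by rewrite !tensor_starD IHx IHy.
Qed.

Fact tensor_starM x y :
  tensor_star (tensor_mul x y) = tensor_mul (tensor_star y) (tensor_star x).
Proof.
elim/tensor_ind: x => [|a b|x x' IHx IHx'].
- by rewrite tensor_mul0l tensor_star0 tensor_mul0r.
- elim/tensor_ind: y => [|a' b'|y y' IHy IHy'].
  + by rewrite tensor_mul0r tensor_star0 tensor_mul0l.
  + rewrite tensor_mul_tens !tensor_star_tens tensor_mul_tens.
    by rewrite [(a * _)^*s]starM [(b * _)^*s]starM.
  + by rewrite tensor_mulDr !tensor_starD tensor_mulDl IHy IHy'.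
- by rewrite tensor_mulDl !tensor_starD tensor_mulDr IHx IHx'.
Qed.

Fact tensor_starZ (c : C) (x : AB) :
  tensor_star (c *: x) = c^* *: tensor_star x.
Proof.
elim/tensor_ind: x => [|a b|x y IHx IHy].
- by rewrite scaler0 tensor_star0 scaler0.
- by rewrite -tensZl !tensor_star_tens starZ tensZl.
- by rewrite scalerDr !tensor_starD scalerDr IHx IHy.
Qed.

HB.instance Definition _ := isStarAlgebra.Build C AB
  tensor_mulA tensor_mul1l tensor_mul1r tensor_mulDl tensor_mulDr
  tensor_scale_mull tensor_scale_mulr tensor_starK tensor_starD
  tensor_starM tensor_starZ.

End TensorStarAlgebra.

Section Ell2.
Variables (R : realType) (I : choiceType).
Local Notation C := R[i].

Definition sqmod (z : C) : R := complex.Re z ^+ 2 + complex.Im z ^+ 2.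

Definition sqnorm (v : I -> C) : \bar R := \esum_(k in setT) (sqmod (v k))%:E.

Definition square_summable : {pred I -> C} :=
  [pred v : I -> C | `[< (sqnorm v < +oo)%E >]].

Lemma sqmod_ge0 z : 0 <= sqmod z.
Proof. by rewrite addr_ge0 ?sqr_ge0. Qed.

Lemma sqmodD z w : sqmod (z + w) <= sqmod z + sqmod z + (sqmod w + sqmod w).
Proof.
case: z w => [a b] [c d]; rewrite /sqmod /= -subr_ge0.
have -> : a ^+ 2 + b ^+ 2 + (a ^+ 2 + b ^+ 2) +
    (c ^+ 2 + d ^+ 2 + (c ^+ 2 + d ^+ 2)) - ((a + c) ^+ 2 + (b + d) ^+ 2) =
  (a - c) ^+ 2 + (b - d) ^+ 2 by ring.
by rewrite addr_ge0 ?sqr_ge0.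
Qed.

Lemma sqmodM z w : sqmod (z * w) = sqmod z * sqmod w.
Proof. by case: z w => [a b] [c d]; rewrite /sqmod /=; ring. Qed.

Fact square_summable_submod : submod_closed square_summable.
Proof.
have sq_ge0 (v : I -> C) k : setT k -> (0 <= (sqmod (v k))%:E)%E.
  by rewrite lee_fin sqmod_ge0.
split=> [|c v w /asboolP vfin /asboolP wfin]; apply/asboolP.
  rewrite /sqnorm esum1 ?ltry // => k _.
  by rewrite /sqmod /= expr0n /= addr0.
pose cv : I -> C := fun k => c * v k.
have cvfin : (sqnorm cv < +oo)%E.
  have le : (sqnorm cv <= (sqmod c)%:E * sqnorm v)%E.
    apply: ge_ereal_sup => _ [A [finA AT] <-].
    under eq_fsbigr do rewrite /cv sqmodM EFinM.
    rewrite -ge0_mule_fsumr; last by move=> k; rewrite lee_fin sqmod_ge0.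
    apply: lee_wpmul2l; first by rewrite lee_fin sqmod_ge0.
    by apply: ereal_sup_ubound; exists A.
  apply: (le_lt_trans le); rewrite lte_mul_pinfty ?lee_fin ?sqmod_ge0 //.
have le : (sqnorm (c *: v + w)%R <=
    (sqnorm cv + sqnorm cv) + (sqnorm w + sqnorm w))%E.
  rewrite /sqnorm -!esumD;
    try by move=> k _; rewrite ?adde_ge0 ?lee_fin ?sqmod_ge0.
  by apply: le_esum => k _; rewrite -!EFinD lee_fin; exact: sqmodD.
by apply: (le_lt_trans le); rewrite !lte_add_pinfty.
Qed.

HB.instance Definition _ :=
  GRing.isSubmodClosed.Build C (I -> C) square_summable square_summable_submod.

Record ell2 : Type := Ell2 {
  ell2_fun :> I -> C;
  _ : ell2_fun \in square_summable
}.

HB.instance Definition _ := [isSub for ell2_fun].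
HB.instance Definition _ := gen_eqMixin ell2.
HB.instance Definition _ := [Choice of ell2 by <:].
HB.instance Definition _ := [SubChoice_isSubLmodule of ell2 by <:].

Fact ket_subproof (k : I) :
  (fun j => (j == k)%:R : C) \in square_summable.
Proof.
apply/asboolP; rewrite /sqnorm (esumID [set k]) //; last first.
  by move=> j _; rewrite lee_fin sqmod_ge0.
rewrite setTI setTI esum_set1 ?lee_fin ?sqmod_ge0 // esum1 ?adde0 ?ltry //.
move=> j /eqP/negPf /= ->; by rewrite /sqmod /= expr0n /= addr0.
Qed.


Definition ket (k : I) : ell2 := Ell2 (ket_subproof k).

End Ell2.

(* unconditional convergence along the finite subsets of I; [csum] takes the
   junk value 0 when the family is not summable *)
Definition has_csum (R : realType) (I : choiceType) (F : I -> R[i])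
    (s : R[i]) : Prop :=
  forall e : R, 0 < e -> exists A : {fset I}, forall B : {fset I},
    fsubset A B -> `|\sum_(k <- B) F k - s| < e%:C%C.

Definition csum (R : realType) (I : choiceType) (F : I -> R[i]) : R[i] :=
  xget 0 [set s | has_csum F s].

Section Operators.
Variables (R : realType) (I : choiceType).
Local Notation H := (ell2 R I).

Definition inner (v w : H) : R[i] := csum (fun k => (v k)^* * w k).

Definition bounded_operator (T : H -> H) : Prop :=
  linear T /\
  exists M : R, forall v, (sqnorm (T v) <= M%:E * sqnorm v)%E.

Definition hilbert_schmidt (T : H -> H) : Prop :=
  bounded_operator T /\
  (\esum_(k in [set: I]) sqnorm (T (ket R k)) < +oo)%E.

(* a trace class operator is a product of two Hilbert-Schmidt operators *)
Definition trace_class (T : H -> H) : Prop :=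
  exists S1 S2 : H -> H,
    [/\ hilbert_schmidt S1, hilbert_schmidt S2 & T =1 S1 \o S2].

Definition trace (T : H -> H) : R[i] :=
  csum (fun k => inner (ket R k) (T (ket R k))).

Record bounded_star_rep (A : starAlgType R[i]) (pi : A -> H -> H) : Prop :=
  BoundedStarRep {
    rep_bounded : forall a, bounded_operator (pi a);
    rep_linear : forall (c : R[i]) a b v,
      pi (c *: a + b) v = c *: pi a v + pi b v;
    rep1 : forall v, pi 1 v = v;
    repM : forall a b v, pi (a * b) v = pi a (pi b v);
    rep_adjoint : forall a v w, inner (pi a^*s v) w = inner v (pi a w)
  }.

End Operators.

Section Comodules.
Variables (C : numClosedFieldType) (H : starAlgType C).
Variables (Delta : H -> tensor H H) (counit : H -> C).

Record left_comodule (V : lmodType C) (delta : V -> tensor H V) : Prop :=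
  LeftComodule {
    comod_linear : linear delta;
    comod_coassoc : forall v,
      tmap Delta id (delta v) = tassoc (tmap id delta (delta v));
    comod_counit : forall v, tlift (fun (h : H) x => counit h *: x) (delta v) = v
  }.

(* delta W is contained in the image of H (x) W in H (x) V *)
Definition subcomodule (V : vectType C) (delta : V -> tensor H V)
    (W : {vspace V}) : Prop :=
  forall w, w \in W -> exists s : seq (H * V),
    all (fun p => p.2 \in W) s /\ delta w = \sum_(p <- s) tens p.1 p.2.

Definition irreducible_left_comodule (V : vectType C)
    (delta : V -> tensor H V) : Prop :=
  [/\ left_comodule delta, (fullv : {vspace V}) != 0%VS &
    forall W : {vspace V}, subcomodule delta W -> W = 0%VS \/ W = fullv].

Variables (A : starAlgType C) (deltaR : A -> tensor A H).

Definition coinvariants : set A := [set b | deltaR b = tens b (1 : H)].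

Definition cotensor (V : lmodType C) (deltaL : V -> tensor H V) :
    set (tensor A V) :=
  [set w | tmap deltaR id w = tassoc (tmap id deltaL w)].

End Comodules.

Definition tensor_mulr (C : numClosedFieldType) (A : starAlgType C)
    (V : lmodType C) (w : tensor A V) (b : A) : tensor A V :=
  tmap (fun a : A => a * b) id w.

(* Right modules over a subalgebra B of A are given as a subset F of an
   additive group M, with an action map defined on M. *)
Section RightModules.
Variables (C : numClosedFieldType) (A : starAlgType C) (B : set A).

Definition right_module_iso (M M' : zmodType) (act : M -> A -> M) (F : set M)
    (act' : M' -> A -> M') (F' : set M') : Prop :=
  exists f : M -> M',
    [/\ set_bij F F' f,
        forall m m', F m -> F m' -> f (m + m') = f m + f m' &
        forall m b, F m -> B b -> f (act m b) = act' (f m) b].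

Definition col_mulr (N : nat) (v : 'cV[A]_N) (b : A) : 'cV[A]_N :=
  map_mx (fun a : A => a * b) v.

Definition idempotent_over (N : nat) (P : 'M[A]_N) : Prop :=
  (forall i j, B (P i j)) /\ P *m P = P.

Definition range_over (N : nat) (P : 'M[A]_N) : set 'cV[A]_N :=
  [set P *m v | v in [set v : 'cV[A]_N | forall i, B (v i 0)]].

Definition presents (N : nat) (P : 'M[A]_N) (M : zmodType)
    (act : M -> A -> M) (F : set M) : Prop :=
  idempotent_over P /\
  right_module_iso act F (@col_mulr N) (range_over P).

End RightModules.

(* "ch_1([F]) = c" for a finitely generated projective right B-module F: some
   idempotent over B presents F, and every such idempotent yields the value c *)
Definition ch1_is (R : realType) (I : choiceType) (A : starAlgType R[i])
    (B : set A) (pi : A -> ell2 R I -> ell2 R I) (eps : A -> R[i])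
    (M : zmodType) (act : M -> A -> M) (F : set M) (c : R[i]) : Prop :=
  (exists (N : nat) (P : 'M[A]_N), presents B P act F) /\
  forall (N : nat) (P : 'M[A]_N), presents B P act F ->
    let T := fun v => pi (\tr P) v - eps (\tr P) *: v in
    trace_class T /\ trace T = c.

Declare Scope sterm_scope.
Delimit Scope sterm_scope with ST.
Local Notation "s + t" := (SAdd s t) : sterm_scope.
Local Notation "s * t" := (SMul s t) : sterm_scope.
Local Notation "c *: s" := (SMul (SCst c%R) s) : sterm_scope.
Local Notation "s ^*" := (SStar s) : sterm_scope.

(* The adjoints of these relations follow, [presented] being taken in the
   sense of *-algebras. *)
Inductive S7_gen := X1 | X2 | X3 | X4.

Section QuantumS7.
Variables (R : realType) (q0 : R).
Local Notation q := (q0%:C%C).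
Local Notation x1 := (SGen X1).
Local Notation x2 := (SGen X2).
Local Notation x3 := (SGen X3).
Local Notation x4 := (SGen X4).

Definition S7_relations : seq (sterm R[i] S7_gen * sterm R[i] S7_gen) := [::
  (x1 * x2, q *: (x2 * x1));
  (x1 * x3, q *: (x3 * x1));
  (x1 * x4, q ^+ 2 *: (x4 * x1));
  (x2 * x3, q ^+ 2 *: (x3 * x2) + (q ^+ 2 * (q - q^-1)) *: (x4 * x1));
  (x2 * x4, q *: (x4 * x2));
  (x3 * x4, q *: (x4 * x3));
  (x1^* * x1, x1 * x1^*);
  (x1^* * x2, q *: (x2 * x1^*));
  (x1^* * x3, q *: (x3 * x1^*));
  (x1^* * x4, q ^+ 2 *: (x4 * x1^*));
  (x2^* * x2, x2 * x2^* + (1 - q ^+ 2) *: (x1 * x1^*));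
  (x2^* * x3, q ^+ 2 *: (x3 * x2^*));
  (x2^* * x4, q *: (x4 * x2^*) + (q ^+ 2 * (q - q^-1)) *: (x3 * x1^*));
  (x3^* * x3, x3 * x3^* + (1 - q ^+ 4) *: (x2 * x2^*)
              + (1 - q ^+ 2) *: (x1 * x1^*));
  (x3^* * x4, q *: (x4 * x3^*) + (- (q ^+ 4 * (q - q^-1))) *: (x2 * x1^*));
  (x1 * x1^* + x2 * x2^* + x3 * x3^* + x4 * x4^*, SCst 1);
  (q ^+ 8 *: (x1^* * x1) + q ^+ 6 *: (x2^* * x2) + q ^+ 2 *: (x3^* * x3)
   + x4^* * x4, SCst 1)]%ST.

Definition O_S7 : starAlgType R[i] :=
  presented (fun s t => List.In (s, t) S7_relations).

Definition S7_x (g : S7_gen) : O_S7 := presented_gen _ g.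

Definition S7_u : 'M[O_S7]_(4, 2) :=
  \matrix_(i, k) nth 0 (nth [::] [::
    [:: q *: S7_x X1;               q *: S7_x X2];
    [:: - (q ^+ 2 *: (S7_x X2)^*s); q ^+ 3 *: (S7_x X1)^*s];
    [:: - S7_x X3;                  S7_x X4];
    [:: (S7_x X4)^*s;               q *: (S7_x X3)^*s]] i) k.

End QuantumS7.

Inductive SUq2_gen := Alpha | Gamma.

Section QuantumSU2.
Variables (R : realType) (q0 : R).
Local Notation q := (q0%:C%C).

Definition SUq2_T_term (i j : 'I_2) : sterm R[i] SUq2_gen :=
  match val i, val j with
  | 0, 0 => SGen Alpha
  | 0, _ => (- q) *: (SGen Gamma)^*
  | _, 0 => SGen Gamma
  | _, _ => (SGen Alpha)^*
  end%ST.

Local Notation T := SUq2_T_term.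

(* T T^* = 1 and T^* T = 1, entry by entry *)
Inductive SUq2_rel : sterm R[i] SUq2_gen -> sterm R[i] SUq2_gen -> Prop :=
| SUq2_TTstar (i k : 'I_2) : SUq2_rel
    (T i ord0 * (T k ord0)^* + T i ord_max * (T k ord_max)^*)%ST
    (SCst (i == k)%:R)
| SUq2_TstarT (i k : 'I_2) : SUq2_rel
    ((T ord0 i)^* * T ord0 k + (T ord_max i)^* * T ord_max k)%ST
    (SCst (i == k)%:R).

Definition O_SUq2 : starAlgType R[i] := presented SUq2_rel.

Definition SUq2_T : 'M[O_SUq2]_2 :=
  \matrix_(i, j) (\pi_(presented SUq2_rel) (T i j) : O_SUq2).

Definition is_SUq2_coproduct (Delta : O_SUq2 -> tensor O_SUq2 O_SUq2) : Prop :=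
  is_star_hom Delta /\
  forall i j, Delta (SUq2_T i j) = \sum_k tens (SUq2_T i k) (SUq2_T k j).

Definition is_SUq2_counit (counit : O_SUq2 -> R[i]) : Prop :=
  is_star_hom counit /\ forall i j, counit (SUq2_T i j) = (i == j)%:R.

End QuantumSU2.

Section QuantumS7Structure.
Variables (R : realType) (q : R).
Local Notation A := (O_S7 q).
Local Notation H := (O_SUq2 q).

Definition is_S7_coaction (deltaR : A -> tensor A H) : Prop :=
  is_star_hom deltaR /\
  forall (i : 'I_4) (k : 'I_2),
    deltaR (S7_u q i k) = \sum_j tens (S7_u q i j) (SUq2_T q j k).

Definition is_S7_character (eps : A -> R[i]) : Prop :=
  is_star_hom eps /\
  [/\ eps (S7_x q X1) = 0, eps (S7_x q X2) = 0, eps (S7_x q X3) = 0 &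
      eps (S7_x q X4) = 1].

Definition is_S7_rep (pi : A -> ell2 R (nat * nat)%type -> ell2 R (nat * nat)%type) :
    Prop :=
  bounded_star_rep pi /\
  forall k1 k2 : nat,
    [/\ pi (S7_x q X1) (ket R (k1, k2)) = 0,
        pi (S7_x q X2) (ket R (k1, k2)) =
          (q ^+ (k1 + 2 * k2))%:C%C *: ket R (k1, k2),
        pi (S7_x q X3) (ket R (k1, k2)) =
          (q ^+ k1 * Num.sqrt (1 - q ^+ (4 * k2.+1)))%:C%C
            *: ket R (k1, k2.+1) &
        pi (S7_x q X4) (ket R (k1, k2)) =
          (Num.sqrt (1 - q ^+ (2 * k1.+1)))%:C%C *: ket R (k1.+1, k2)].

End QuantumS7Structure.

(* Main.v *)
Require Import Defs.
From mathcomp Require Import all_boot all_order all_algebra.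
From mathcomp Require Import finmap complex ring lra.
From mathcomp Require Import boolp classical_sets functions cardinality fsbigop.
From mathcomp Require Import reals ereal esum.

(* Write J for the set of a with pi a in pi(A) pi(x2). As pi(x2) is the diagonal
   operator q^(k1 + 2 k2), with which the generators commute up to scalars, J is an
   ideal, its elements are trace class and tr (a b) = tr (b a) for a in J. The map
   (eps (x) id) deltaR : O(S^7_q) -> O(SU_q(2)) kills x1 and x2, and a - c is in J as
   soon as a is mapped to the scalar c. Hence b - eps b is in J for every coinvariant
   b, and ch b := tr (b - eps b) is a trace on the coinvariants.

   For a corepresentation matrix t, a family e is equivariant if
   deltaR e_k = sum_l e_l (x) t_l^k; these families form the module to be presented.
   A frame consists of equivariant w_j and of v_j that pair equivariant families into
   coinvariants, with sum_j w_j^k v_j^m = delta_km. Then sum_k v_i^k w_j^k is an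
   idempotent presenting the module, and ch of its trace depends on the module only.
   Multiplying a frame of dimension d by the matrix u gives a frame for the tensor
   product with V_1, of Chern number 2 c(d) - d: the trace element of u is
   2 - (1 - q^2)(1 - q^4) z with z = x1 x1^* + x2 x2^*, of Chern number -1. As
   V_1 (x) V_n = V_(n+1) (+) V_(n-1), this gives c(d+1) = 2 c(d) - d - c(d-1), hence
   c(d) = - (d-1) d (d+1) / 6.

   An irreducible comodule of dimension n + 1 is identified with the explicit
   corepresentation by means of functionals on O(SU_q(2)) that act as raising and
   lowering operators. *)

Set Implicit Arguments.
Unset Strict Implicit.
Unset Printing Implicit Defensive.

Import Order.TTheory GRing.Theory Num.Theory.

Local Open Scope classical_set_scope.
Local Open Scope fset_scope.
Local Open Scope ring_scope.
Local Open Scope quotient_scope.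

(** [ch1_is] speaks of every presenting idempotent, so independence of the presentation is proved
    along with existence. [O_SUq2] is given by a syntactic congruence; the kernel of the fibre map
    is therefore reached without a basis, by lifting formal terms to [O_S7] and checking the rules
    of the congruence one at a time modulo J. The value 2 c(d) - d arises as follows. The trace of
    the product frame is the sum of the v theta w, where theta is the trace element of u. As theta -
    2 lies in J, v can be moved to the right, where it meets sum_j w_j^k v_j^k = 1; each of the d
    indices k then contributes tr (theta - 2) = -1. Inclusions and projections are kept as separate
    matrices instead of unitary ones: Clebsch-Gordan coefficients then contain no square roots, and
    all identities are rational in q. A given irreducible comodule is compared with the explicit one
    by a highest weight argument, once the coefficients of the explicit corepresentations are known
    to span. *)

Section LinearCombination.
Variables (C : nzRingType) (V : lmodType C).

(** Syntax for linear combinations of atoms: after the noncommutative rewriting, an identity is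
    settled on its scalar coefficients, where [ring] and [field] apply. *)
Inductive lexp :=
| LVar of nat | LAdd of lexp & lexp | LOpp of lexp | LScale of C & lexp | LZero.

Fixpoint linterp (env : seq V) (e : lexp) : V :=
  match e with
  | LVar i => nth 0 env i
  | LAdd a b => linterp env a + linterp env b
  | LOpp a => - linterp env a
  | LScale c a => c *: linterp env a
  | LZero => 0
  end.

(** [Nat.eqb] computes under [cbn], by which [linear_eq] exposes the coefficients. *)
Fixpoint lcoef (e : lexp) (i : nat) : C :=
  match e with
  | LVar j => if Nat.eqb i j then 1 else 0
  | LAdd a b => lcoef a i + lcoef b i
  | LOpp a => - lcoef a i
  | LScale c a => c * lcoef a i
  | LZero => 0
  end.

Lemma linterpE env e :
  linterp env e = \sum_(i < size env) lcoef e i *: env`_i.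
Proof.
elim: e => /= [j|a -> b ->|a ->|c a ->|].
- have [ltj|lej] := ltnP j (size env); last first.
    rewrite nth_default // big1 // => i _.
    case: (PeanoNat.Nat.eqb_spec i j) => [ij|_]; last by rewrite scale0r.
    by move: (ltn_ord i); rewrite ij ltnNge lej.
  rewrite (bigD1 (Ordinal ltj)) //= PeanoNat.Nat.eqb_refl scale1r.
  rewrite big1 ?addr0 // => i /eqP neq.
  case: (PeanoNat.Nat.eqb_spec i j) => [ij|_]; last by rewrite scale0r.
  by case: neq; apply: val_inj.
- by rewrite -big_split; apply: eq_bigr => i _; rewrite scalerDl.
- by rewrite -sumrN; apply: eq_bigr => i _; rewrite scaleNr.
- by rewrite scaler_sumr; apply: eq_bigr => i _; rewrite scalerA.
- by rewrite big1 // => i _; rewrite scale0r.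
Qed.

Fixpoint same_coefs (e e' : lexp) (n : nat) : Prop :=
  match n with
  | 0 => True
  | n.+1 => lcoef e n = lcoef e' n /\ same_coefs e e' n
  end.

Lemma linterp_eq env e e' :
  same_coefs e e' (size env) -> linterp env e = linterp env e'.
Proof.
move=> ee'; rewrite !linterpE; apply: eq_bigr => i _; congr (_ *: _).
elim: (size env) ee' i => [_ []//|n IHn /= [en ee'] i].
have := ltn_ord i; rewrite ltnS leq_eqVlt => /predU1P[->//|lti].
exact: IHn ee' (Ordinal lti).
Qed.

End LinearCombination.

(* Atoms are compared up to conversion, as the same product may occur with
   several inferred ring structures. *)
Ltac lin_mem x env :=
  match env with
  | nil => constr:(false)
  | ?y :: ?env' =>
    match constr:(tt) with
    | _ => let _ := match constr:(tt) with _ => unify x y end in constr:(true)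
    | _ => lin_mem x env'
    end
  end.
Ltac lin_index x env :=
  match env with
  | ?y :: ?env' =>
    match constr:(tt) with
    | _ => let _ := match constr:(tt) with _ => unify x y end in constr:(O)
    | _ => let i := lin_index x env' in constr:(S i)
    end
  end.
Ltac lin_env t env :=
  match t with
  | @GRing.add _ ?a ?b => let env' := lin_env a env in lin_env b env'
  | @GRing.opp _ ?a => lin_env a env
  | @GRing.scale _ _ _ ?a => lin_env a env
  | @GRing.zero _ => env
  | _ => let b := lin_mem t env in
         match b with true => env | false => constr:(t :: env) end
  end.
Ltac lin_reify C t env :=
  match t with
  | @GRing.add _ ?a ?b =>
    let a' := lin_reify C a env in let b' := lin_reify C b env in
    constr:(@LAdd C a' b')
  | @GRing.opp _ ?a => let a' := lin_reify C a env in constr:(@LOpp C a')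
  | @GRing.scale _ _ ?c ?a =>
    let a' := lin_reify C a env in constr:(@LScale C c a')
  | @GRing.zero _ => constr:(@LZero C)
  | _ => let i := lin_index t env in constr:(@LVar C i)
  end.
(* Reduces an equality of C-linear combinations to equalities between the
   coefficients of each atom. *)
Ltac linear_eq C V :=
  match goal with
  | |- ?x = ?y :> _ =>
    let env := lin_env x (@nil V) in
    let env := lin_env y env in
    let ex := lin_reify C x env in
    let ey := lin_reify C y env in
    refine (@linterp_eq C V env ex ey _);
    cbn [same_coefs size lcoef Nat.eqb]; do !split; try exact: I
  end.

(** * Calculus in *-algebras, presentations and tensor products *)

Section StarAlgebraTheory.
Variables (C : numClosedFieldType) (A : starAlgType C).
Implicit Types (a b : A) (c : C).

Lemma scale_mulrl c a b : (c *: a) * b = c *: (a * b).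
Proof. exact: (esym (scale_mull c a b)). Qed.

Lemma scale_mulrr c a b : a * (c *: b) = c *: (a * b).
Proof. exact: (esym (scale_mulr c a b)). Qed.

Lemma star_mul a b : (a * b)^*s = b^*s * a^*s.
Proof. exact: starM. Qed.

Lemma star_zero : (0 : A)^*s = 0.
Proof. by apply: (@addrI _ (0 : A)^*s); rewrite -starD !addr0. Qed.

Lemma star_opp a : (- a)^*s = - a^*s.
Proof. by apply: (@addrI _ a^*s); rewrite -starD !subrr star_zero. Qed.

Lemma star_one : (1 : A)^*s = 1.
Proof. by rewrite -[LHS]mulr1 -[X in _ * X]starK -star_mul mulr1 starK. Qed.

Lemma star_sum I (r : seq I) (P : pred I) (F : I -> A) :
  (\sum_(i <- r | P i) F i)^*s = \sum_(i <- r | P i) (F i)^*s.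
Proof. by apply: (big_morph _ (@starD C A)); exact: star_zero. Qed.

Definition starE :=
  (@starD C A, @starZ C A, star_opp, star_mul, @starK C A, star_one, star_zero).
Definition mulE := (@mulrDl A, @mulrDr A, @mulNr A, @mulrN A,
  scale_mulrl, scale_mulrr, @scalerDr C A, @scalerN C A, @scalerA C A,
  @mulrA A, @mul1r A, @mulr1 A).

End StarAlgebraTheory.

Section PresentedTheory.
Variables (C : numClosedFieldType) (G : Type).
Variable relat : sterm C G -> sterm C G -> Prop.
Local Notation P := (presented relat : starAlgType C).
Local Notation "\p s" := (\pi_(presented relat) s : P) (at level 8).

Lemma pi_add s t : \p (SAdd s t) = \p s + \p t.
Proof. by rewrite [RHS]presented_add_pi. Qed.

Lemma pi_mul s t : \p (SMul s t) = \p s * \p t.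
Proof. by rewrite [RHS]presented_mul_pi. Qed.

Lemma pi_star s : \p (SStar s) = (\p s)^*s.
Proof. by rewrite [RHS]presented_star_pi. Qed.

Lemma pi_cst c : \p (SCst c) = c *: (1 : P).
Proof.
transitivity (\p (SMul (SCst c) (SCst 1))).
  by apply/pi_presentedP; apply: scongr_sym; exact: scongr_mul1r.
by rewrite pi_mul.
Qed.

Definition piE := (pi_add, pi_mul, pi_star, pi_cst).

Lemma presented_rel s t : relat s t -> \p s = \p t.
Proof. by move=> st; apply/pi_presentedP; exact: scongr_rel. Qed.

Lemma presented_ind (Q : P -> Prop) :
  (forall g, Q (presented_gen relat g)) -> Q 1 ->
  (forall x y, Q x -> Q y -> Q (x + y)) ->
  (forall c x, Q x -> Q (c *: x)) ->
  (forall x y, Q x -> Q y -> Q (x * y)) ->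
  (forall x, Q x -> Q x^*s) -> forall x, Q x.
Proof.
move=> Qg Q1 QD QZ QM QS; elim/quotW; elim=> [g|c|s IHs t IHt|s IHs t IHt|s IHs].
- exact: Qg.
- by have := QZ c 1 Q1; rewrite -pi_cst.
- by rewrite pi_add; exact: QD.
- by rewrite pi_mul; exact: QM.
- by rewrite pi_star; exact: QS.
Qed.

End PresentedTheory.

Section StarHom.
Variables (C : numClosedFieldType) (A B : starAlgType C) (f : A -> B).
Hypothesis fP : is_star_hom f.

Lemma star_homD a b : f (a + b) = f a + f b.
Proof. by rewrite -[a]scale1r (star_hom_linear fP) !scale1r. Qed.

Lemma star_hom0 : f 0 = 0.
Proof. by apply: (@addrI _ (f 0)); rewrite -star_homD !addr0. Qed.

Lemma star_homZ c a : f (c *: a) = c *: f a.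
Proof. by rewrite -[c *: a]addr0 (star_hom_linear fP) star_hom0 addr0. Qed.

Lemma star_homN a : f (- a) = - f a.
Proof. by rewrite -scaleN1r star_homZ scaleN1r. Qed.

Lemma star_homB a b : f (a - b) = f a - f b.
Proof. by rewrite star_homD star_homN. Qed.

Lemma star_hom_sum I (r : seq I) (P : pred I) (F : I -> A) :
  f (\sum_(i <- r | P i) F i) = \sum_(i <- r | P i) f (F i).
Proof. by apply: (big_morph _ star_homD); exact: star_hom0. Qed.

Definition star_homE :=
  (star_homB, star_homD, star_homN, star_homZ, star_homM fP, star_homS fP,
   star_hom1 fP, star_hom0).

End StarHom.

Section TensorTheory.
Variable K : fieldType.
Implicit Types (U V W : lmodType K).

Lemma tens0l U V (v : V) : tens (0 : U) v = 0.
Proof. by rewrite -(scale0r 0) tensZl scale0r. Qed.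

Lemma tens0r U V (u : U) : tens u (0 : V) = 0.
Proof. by rewrite -(scale0r 0) tensZr scale0r. Qed.

Lemma tens_suml U V I (r : seq I) (P : pred I) (F : I -> U) (v : V) :
  tens (\sum_(i <- r | P i) F i) v = \sum_(i <- r | P i) tens (F i) v.
Proof. exact: (big_morph (tens^~ v) (tensDl v) (tens0l U v)). Qed.

Lemma tens_sumr U V I (r : seq I) (P : pred I) (u : U) (F : I -> V) :
  tens u (\sum_(i <- r | P i) F i) = \sum_(i <- r | P i) tens u (F i).
Proof. exact: (big_morph (tens u) (tensDr u) (tens0r V u)). Qed.

Section Lift.
Variables (U V : lmodType K) (W : lmodType K) (b : U -> V -> W).
Hypothesis bP : balanced b.

Lemma tlift0 : tlift b 0 = 0.
Proof. by apply: (@addrI _ (tlift b 0)); rewrite -(tliftD bP) !addr0. Qed.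

Lemma tlift_sum I (r : seq I) (P : pred I) (F : I -> tensor U V) :
  tlift b (\sum_(i <- r | P i) F i) = \sum_(i <- r | P i) tlift b (F i).
Proof. exact: (big_morph _ (tliftD bP) tlift0). Qed.

Lemma tliftZ : (forall c u v, b (c *: u) v = c *: b u v) ->
  forall c x, tlift b (c *: x) = c *: tlift b x.
Proof.
move=> bZ c; elim/tensor_ind => [|u v|x y IHx IHy].
- by rewrite scaler0 tlift0 scaler0.
- by rewrite -tensZl !(tlift_tens bP) bZ.
- by rewrite scalerDr !(tliftD bP) IHx IHy scalerDr.
Qed.

End Lift.

Lemma balanced_scale U V (f : U -> K) :
  (forall u u', f (u + u') = f u + f u') -> (forall c u, f (c *: u) = c * f u) ->
  balanced (fun u (v : V) => f u *: v).
Proof.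
move=> fD fZ; split=> [v u u'|u v v'|c u v].
- by rewrite fD scalerDl.
- by rewrite scalerDr.
- by rewrite fZ scalerA mulrC.
Qed.

End TensorTheory.

Section TensorStarAlgebraTheory.
Variables (C : numClosedFieldType) (A B : starAlgType C).
Local Notation AB := (tensor A B : starAlgType C).

Lemma tens_mul (a a' : A) (b b' : B) :
  (tens a b : AB) * (tens a' b' : AB) = tens (a * a') (b * b').
Proof. exact: tensor_mul_tens. Qed.

Lemma tens_star (a : A) (b : B) : (tens a b : AB)^*s = tens a^*s b^*s.
Proof. exact: tensor_star_tens. Qed.

End TensorStarAlgebraTheory.

(** * Unconditional sums and l^2 *)

Section ComplexSums.
Variables (R : realType).
Local Notation C := R[i].

(** A positive element of [R[i]] is real, so the radius may be taken in [R[i]] and the estimates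
    stay in one field. *)
Lemma has_csumP (I : choiceType) (F : I -> C) s :
  has_csum F s <-> forall e : C, 0 < e -> exists A : {fset I}, forall B : {fset I},
    A `<=` B -> `|\sum_(k <- B) F k - s| < e.
Proof.
split=> [Fs e e0|Fs e e0]; last by apply: Fs; rewrite ltcR.
have [r r0 ->] : exists2 r : R, 0 < r & e = r%:C%C.
  by case: e e0 => a b; rewrite ltcE /= => /andP[/eqP -> a0]; exists a.
exact: Fs.
Qed.

Lemma has_csum_unique (I : choiceType) (F : I -> C) s t :
  has_csum F s -> has_csum F t -> s = t.
Proof.
move=> /has_csumP Fs /has_csumP Ft; apply/eqP/negPn/negP => st.
have e0 : 0 < `|s - t| / 2%:R by rewrite divr_gt0 ?normr_gt0 ?subr_eq0 ?ltr0n.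
have [A /(_ (A `|` _) (fsubsetUl _ _)) As] := Fs _ e0.
have [B /(_ (A `|` B) (fsubsetUr _ _)) Bt] := Ft _ e0.
have := ltrD (As B) Bt; rewrite -mulrDl -mulr2n -[X in X / _]mulr_natr mulfK ?pnatr_eq0 //.
set S := \sum_(k <- _) _; suff : `|s - t| <= `|S - s| + `|S - t|.
  by move=> le /(le_lt_trans le); rewrite ltxx.
rewrite (distrC S s) (le_trans _ (ler_normD _ _)) //.
by rewrite addrA subrK.
Qed.

Lemma csumE (I : choiceType) (F : I -> C) s : has_csum F s -> csum F = s.
Proof.
by move=> Fs; apply: xget_unique => // t Ft; exact: has_csum_unique Ft Fs.
Qed.

Lemma eq_has_csum (I : choiceType) (F G : I -> C) s :
  F =1 G -> has_csum F s -> has_csum G s.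
Proof. by move=> /funext ->. Qed.

Lemma has_csumD (I : choiceType) (F G : I -> C) s t :
  has_csum F s -> has_csum G t -> has_csum (fun k => F k + G k) (s + t).
Proof.
move=> /has_csumP Fs /has_csumP Gt; apply/has_csumP => e e0.
have e20 : 0 < e / 2%:R by rewrite divr_gt0 ?ltr0n.
have [A As] := Fs _ e20; have [B Bt] := Gt _ e20.
exists (A `|` B) => D sub; rewrite big_split /= opprD addrACA.
apply: (le_lt_trans (ler_normD _ _)).
have -> : e = e / 2%:R + e / 2%:R.
  by rewrite -mulrDl -mulr2n -[X in X / _]mulr_natr mulfK ?pnatr_eq0.
by rewrite ltrD ?As ?Bt ?(fsubset_trans _ sub) ?fsubsetUl ?fsubsetUr.
Qed.

Lemma has_csumZ (I : choiceType) (F : I -> C) c s :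
  has_csum F s -> has_csum (fun k => c * F k) (c * s).
Proof.
move=> /has_csumP Fs; apply/has_csumP => e e0.
(* Adding 1 keeps the denominator positive when [c = 0]. *)
have c1 : 0 < `|c| + 1 by rewrite ltr_wpDl.
have [A As] := Fs (e / (`|c| + 1)) (divr_gt0 e0 c1).
exists A => B /As lt; rewrite -mulr_sumr -mulrBr normrM.
apply: (@le_lt_trans _ _ ((`|c| + 1) * `|\sum_(k <- B) F k - s|)).
  by rewrite ler_wpM2r // lerDl.
by rewrite mulrC -ltr_pdivlMr.
Qed.

Lemma has_csum_supp1 (I : choiceType) (F : I -> C) j :
  (forall k, k != j -> F k = 0) -> has_csum F (F j).
Proof.
move=> F0; apply/has_csumP => e e0; exists [fset j] => B; rewrite fsub1set => jB.
rewrite (big_fsetD1 j) //= big_seq big1 ?addr0 ?subrr ?normr0 // => k.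
by rewrite in_fsetD1 => /andP[kj _]; exact: F0.
Qed.

(** The test [s (g l) != l] singles out the points outside the image of the injection [s]. This is
    how a sum is transported along a shift, which is injective but not surjective. *)
Lemma has_csum_reindex (I J : choiceType) (s : I -> J) (g : J -> I) (F : J -> C) t :
  cancel s g -> (forall l, s (g l) != l -> F l = 0) ->
  has_csum (F \o s) t -> has_csum F t.
Proof.
move=> sK F0 /has_csumP Fs; apply/has_csumP => e /Fs[A As].
exists [fset s k | k in A] => B AB.
pose B' := [fset g l | l in [fset l in B | s (g l) == l]].
have AB' : A `<=` B'.
  apply/fsubsetP => k kA; apply/imfsetP; exists (s k); last by rewrite sK.
  rewrite !inE /= sK eqxx andbT; apply: (fsubsetP AB).
  by apply/imfsetP; exists k.
have -> : \sum_(l <- B) F l = \sum_(k <- B') (F \o s) k.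
  rewrite big_imfset /=; last first.
    move=> l l'; rewrite !inE /= => /andP[_ /eqP E] /andP[_ /eqP E'] gg.
    by rewrite -E -E' gg.
  rewrite (bigID (fun l => s (g l) == l)) /= [X in _ + X]big1 ?addr0; last first.
    by move=> l /F0.
  rewrite big_fset_condE /=; apply: eq_fbigr => l.
  by rewrite !inE /= => /andP[_ /eqP ->].
exact: As.
Qed.

Lemma has_csum_nonneg (I : choiceType) (f : I -> R) (M : R) :
  (forall k, 0 <= f k) -> (forall B : {fset I}, \sum_(k <- B) f k <= M) ->
  exists s : R, has_csum (fun k => (f k)%:C%C) s%:C%C.
Proof.
move=> f0 fM.
pose S : set R := [set x | exists B : {fset I}, x = \sum_(k <- B) f k]%classic.
have Ssup : has_sup S.
  split; first by exists 0, fset0; rewrite big_seq_fset0.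
  by exists M => x [B ->].
exists (sup S) => e e0.
have [x [A ->] ltx] := sup_adherent e0 Ssup.
exists A => B AB; rewrite -rmorph_sum -rmorphB /= normc_def /= expr0n /= addr0.
rewrite sqrtr_sqr ltcR distrC ger0_norm; last first.
  by rewrite subr_ge0; apply: ub_le_sup; [exact: Ssup.2|exists B].
rewrite ltrBlDr -ltrBlDl (lt_le_trans ltx) //.
rewrite (big_fsetID _ (mem A) B) /= (_ : [fset x in B | mem A x] = A); last first.
  apply/fsetP => k; rewrite !inE /=.
  by apply/andP/idP => [[]//|kA]; split=> //; exact: (fsubsetP AB).
by rewrite lerDl sumr_ge0.
Qed.

(** [f] is the difference of the nonnegative families [f + d] and [d]. *)
Lemma has_csum_real (I : choiceType) (f d : I -> R) (M : R) :
  (forall k, `|f k| <= d k) -> (forall B : {fset I}, \sum_(k <- B) d k <= M) ->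
  exists s : R, has_csum (fun k => (f k)%:C%C) s%:C%C.
Proof.
move=> fd dM.
have d0 k : 0 <= d k by exact: le_trans (fd k).
have [s sP] := has_csum_nonneg d0 dM.
have [||t tP] := @has_csum_nonneg I (fun k => f k + d k) (M + M).
- by move=> k; have := fd k; rewrite ler_norml => /andP[]; lra.
- move=> B; rewrite big_split /= lerD ?dM // (le_trans _ (dM B)) // ler_sum //.
  by move=> k _; exact: le_trans (ler_norm _) (fd k).
exists (t - s); have := has_csumD tP (has_csumZ (-1) sP).
rewrite mulN1r -rmorphB /=; apply: eq_has_csum => k.
by rewrite mulN1r -rmorphB /= addrK.
Qed.

Lemma has_csum_dominated (I : choiceType) (F : I -> C) (d : I -> R) (M : R) :
  (forall k, `|complex.Re (F k)| <= d k) -> (forall k, `|complex.Im (F k)| <= d k) ->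
  (forall B : {fset I}, \sum_(k <- B) d k <= M) -> exists s, has_csum F s.
Proof.
move=> Fr Fi dM.
have [s sP] := has_csum_real Fr dM; have [t tP] := has_csum_real Fi dM.
exists (s%:C%C + 'i%C * t%:C%C); apply: eq_has_csum (has_csumD sP (has_csumZ 'i%C tP)).
by move=> k; rewrite [RHS]complexE.
Qed.

End ComplexSums.

Lemma conj_real (R : realType) (x : R) : (x%:C%C)^* = x%:C%C :> R[i].
Proof. exact: conjc_real. Qed.

Section Ell2Theory.
Variables (R : realType) (I : choiceType).
Local Notation H := (ell2 R I).
Implicit Types (v w : H) (k : I).

Lemma ell2P v w : (forall k, v k = w k) -> v = w.
Proof. by move=> vw; apply: val_inj; apply: funext. Qed.

Lemma ell2D v w k : (v + w) k = v k + w k.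
Proof. by []. Qed.

Lemma ell2Z c v k : (c *: v) k = c * v k.
Proof. by []. Qed.

Lemma ketE k j : ket R k j = (j == k)%:R.
Proof. by []. Qed.

Lemma inner_scale_ketl c k v : inner (c *: ket R k) v = c^* * v k.
Proof.
apply: csumE; have := @has_csum_supp1 R I (fun j => ((c *: ket R k) j)^* * v j) k.
rewrite [X in X^* * _]ell2Z ketE eqxx mulr1; apply => j /negPf jk.
by rewrite [X in X^* * _]ell2Z ketE jk mulr0 conjC0 mul0r.
Qed.

Lemma inner_ketl k v : inner (ket R k) v = v k.
Proof. by rewrite -[ket R k]scale1r inner_scale_ketl conjC1 mul1r. Qed.

Lemma inner_ketr k v : inner v (ket R k) = (v k)^*.
Proof.
apply: csumE; have := @has_csum_supp1 R I (fun j => (v j)^* * ket R k j) k.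
rewrite ketE eqxx mulr1; apply => j /negPf jk.
by rewrite ketE jk mulr0.
Qed.

Lemma le_sqnorm (f g : I -> R[i]) :
  (forall k, sqmod (f k) <= sqmod (g k)) -> (sqnorm f <= sqnorm g)%E.
Proof. by move=> fg; apply: le_esum => k _; rewrite lee_fin. Qed.

Lemma sqmod_le_sqnorm v k : ((sqmod (v k))%:E <= sqnorm v)%E.
Proof.
apply: esum_ge; exists [set k]%classic; first by split.
by rewrite fsbig_set1.
Qed.

Lemma sqnorm_ge0 (f : I -> R[i]) : (0 <= sqnorm f)%E.
Proof. by apply: esum_ge0 => k _; rewrite lee_fin sqmod_ge0. Qed.

Lemma sqnormZ_ket c k : sqnorm (c *: ket R k) = (sqmod c)%:E.
Proof.
rewrite /sqnorm (esumID [set k]%classic) //; last first.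
  by move=> j _; rewrite lee_fin sqmod_ge0.
rewrite !setTI esum_set1 ?lee_fin ?sqmod_ge0 // esum1 ?adde0.
  by rewrite [X in sqmod X]ell2Z ketE eqxx mulr1.
move=> j /eqP/negPf jk; rewrite [X in sqmod X]ell2Z ketE jk mulr0.
by rewrite /sqmod /= expr0n /= addr0.
Qed.

Lemma sqnorm_ket k : sqnorm (ket R k) = 1%E.
Proof.
rewrite -[ket R k]scale1r sqnormZ_ket /sqmod /= expr1n expr0n /= addr0 //.
Qed.

Lemma esum_bounded (f : I -> R) (M : R) :
  (forall B : {fset I}, \sum_(k <- B) f k <= M) ->
  (\esum_(k in [set: I]) (f k)%:E <= M%:E)%E.
Proof.
move=> fM; apply: ge_ereal_sup => _ [A [finA _] <-].
by rewrite fsbig_finite //= sumEFin lee_fin.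
Qed.

Section Diagonal.
Variables (r : I -> R) (r01 : forall k, 0 <= r k <= 1).

Lemma sqmod_real (x : R) : sqmod x%:C%C = x ^+ 2.
Proof. by rewrite /sqmod /= expr0n /= addr0. Qed.

Lemma sqmod_diag v k : sqmod ((r k)%:C%C * v k) <= sqmod (v k).
Proof.
rewrite sqmodM sqmod_real ler_piMl ?sqmod_ge0 //.
by have /andP[r0 r1] := r01 k; rewrite expr_le1.
Qed.

Fact diag_subproof v :
  (fun k => (r k)%:C%C * v k) \in (@square_summable R I).
Proof.
apply/asboolP; apply: (@le_lt_trans _ _ (sqnorm v)).
  by apply: le_sqnorm => k; exact: sqmod_diag.
exact/asboolP/(valP v).
Qed.

Definition diag v : H := Ell2 (diag_subproof v).

Lemma diagE v k : diag v k = (r k)%:C%C * v k.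
Proof. by []. Qed.

Lemma diag_ket k : diag (ket R k) = (r k)%:C%C *: ket R k.
Proof.
apply: ell2P => j; rewrite diagE ell2Z ketE.
by case: eqP => [->|]; rewrite ?mulr0.
Qed.

Lemma diag_bounded : bounded_operator diag.
Proof.
split=> [c v w|].
  by apply: ell2P => k; rewrite !(diagE, ell2D, ell2Z) mulrDr mulrCA.
exists 1 => v; rewrite mul1e; apply: le_sqnorm => k; exact: sqmod_diag.
Qed.

Lemma hilbert_schmidt_diag (T : H -> H) (M : R) : bounded_operator T ->
  (forall B : {fset I}, \sum_(k <- B) r k ^+ 2 <= M) ->
  hilbert_schmidt (T \o diag).
Proof.
move=> [Tlin [K TK]] rM; have [dlin _] := diag_bounded.
(* The definition of a bounded operator allows a negative [K], while the estimates below multiply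
   inequalities by it. *)
have TM v : (sqnorm (T v) <= (Num.max K 0)%:E * sqnorm v)%E.
  apply: (le_trans (TK v)); apply: lee_wpmul2r; first exact: sqnorm_ge0.
  by rewrite lee_fin le_max lexx.
have M0 : 0 <= Num.max K 0 by rewrite le_max lexx orbT.
split.
  split=> [c v w|]; first by rewrite /= dlin Tlin.
  exists (Num.max K 0) => v; apply: (le_trans (TM _)); apply: lee_wpmul2l.
    by rewrite lee_fin.
  by apply: le_sqnorm => k; exact: sqmod_diag.
apply: (@le_lt_trans _ _ (Num.max K 0 * M)%:E); last exact: ltry.
apply: (@le_trans _ _ (\esum_(k in [set: I]) (Num.max K 0 * r k ^+ 2)%:E)%E).
  apply: le_esum => k _; rewrite /= diag_ket (le_trans (TM _)) //.
  by rewrite sqnormZ_ket sqmod_real EFinM.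
apply: esum_bounded => B; rewrite -mulr_sumr.
exact: ler_wpM2l.
Qed.

End Diagonal.

End Ell2Theory.

(** * The trace ideal *)

Section Representation.
Variables (R : realType) (I : choiceType) (A : starAlgType R[i]).
Variables (pi : A -> ell2 R I -> ell2 R I) (piP : bounded_star_rep pi).
Local Notation e := (ket R).

Lemma rep_D a b v : pi (a + b) v = pi a v + pi b v.
Proof. by rewrite -[a]scale1r (rep_linear piP) !scale1r. Qed.

Lemma rep_0 v : pi 0 v = 0.
Proof. by apply: (@addrI _ (pi 0 v)); rewrite -rep_D !addr0. Qed.

Lemma rep_Z c a v : pi (c *: a) v = c *: pi a v.
Proof. by rewrite -[c *: a]addr0 (rep_linear piP) rep_0 addr0. Qed.

Lemma rep_Dv a v w : pi a (v + w) = pi a v + pi a w.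
Proof.
by have [lin _] := rep_bounded piP a; rewrite -[v]scale1r lin !scale1r.
Qed.

Lemma rep_0v a : pi a 0 = 0.
Proof. by apply: (@addrI _ (pi a 0)); rewrite -rep_Dv !addr0. Qed.

Lemma rep_Zv a c v : pi a (c *: v) = c *: pi a v.
Proof.
by have [lin _] := rep_bounded piP a; rewrite -[c *: v]addr0 lin rep_0v addr0.
Qed.

Lemma rep_coord a v k : pi a v k = inner (pi a^*s (e k)) v.
Proof. by rewrite (rep_adjoint piP) inner_ketl. Qed.

Lemma rep_star_ket a k j : pi a^*s (e k) j = (pi a (e j) k)^*.
Proof.
have := rep_adjoint piP a (e k) (e j); rewrite inner_ketl inner_ketr => <-.
by rewrite conjCK.
Qed.

(** A vector is not a finite combination of kets, but the coordinates of [pi a v] are inner products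
    of [v] with the [pi a^*s (ket R k)], whose entries are conjugates of entries of [pi a] on
    kets. *)
Lemma rep_ext a b : (forall k, pi a (e k) = pi b (e k)) -> pi a = pi b.
Proof.
move=> ab; apply: funext => v; apply: ell2P => k; rewrite !rep_coord.
by congr inner; apply: ell2P => j; rewrite !rep_star_ket ab.
Qed.

Lemma rep_eqM a a' b b' : pi a = pi a' -> pi b = pi b' -> pi (a * b) = pi (a' * b').
Proof. by move=> aa bb; apply: funext => v; rewrite !(repM piP) aa bb. Qed.

Lemma rep_eqD a a' b b' : pi a = pi a' -> pi b = pi b' -> pi (a + b) = pi (a' + b').
Proof. by move=> aa bb; apply: funext => v; rewrite !rep_D aa bb. Qed.

Lemma rep_eqZ c a a' : pi a = pi a' -> pi (c *: a) = pi (c *: a').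
Proof. by move=> aa; apply: funext => v; rewrite !rep_Z aa. Qed.

Lemma rep_eq_star a a' : pi a = pi a' -> pi a^*s = pi a'^*s.
Proof. by move=> aa; apply: rep_ext => k; apply: ell2P => j; rewrite !rep_star_ket aa. Qed.

Lemma rep_diag_bounded a : exists M, forall k, sqmod (pi a (e k) k) <= M.
Proof.
have [_ [M aM]] := rep_bounded piP a; exists M => k.
rewrite -lee_fin (le_trans (sqmod_le_sqnorm _ _)) // (le_trans (aM _)) //.
by rewrite sqnorm_ket mule1.
Qed.

Definition dtrace (a : A) : R[i] := csum (fun k => pi a (e k) k).

(** All four generators act in this way, [x1] with zero weights and [x2] with [s] the identity. The
    image of [s] consists of the [l] with [s (g l) = l]. *)
Definition weighted_shift (x : A) (f : I -> R) (s g : I -> I) : Prop :=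
  cancel s g /\ forall k, pi x (e k) = (f k)%:C%C *: e (s k).

Section WeightedShift.
Variables (x : A) (f : I -> R) (s g : I -> I).
Hypothesis xP : weighted_shift x f s g.

Lemma weighted_shift_star l :
  pi x^*s (e l) = (if s (g l) == l then (f (g l))%:C%C else 0) *: e (g l).
Proof.
have [sK xe] := xP.
apply: ell2P => j; rewrite rep_star_ket xe ell2Z [RHS]ell2Z !ketE rmorphM /= conjC_nat.
case: (eqVneq l (s j)) => [->|lj].
  by rewrite !sK !eqxx !mulr1 conj_real.
case: (eqVneq (s (g l)) l) => [sgl|]; last by rewrite mulr0 mul0r.
case: (eqVneq j (g l)) => [jl|]; last by rewrite !mulr0.
by rewrite jl sgl eqxx in lj.
Qed.

Lemma rep_shift_coord a l : pi (x * a) (e l) l =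
  (if s (g l) == l then (f (g l))%:C%C else 0) * pi a (e l) (g l).
Proof.
rewrite (repM piP) rep_coord weighted_shift_star inner_scale_ketl.
by case: ifP; rewrite ?conj_real ?conjC0.
Qed.

(** The diagonal entry of [a x] at [k] is that of [x a] at [s k], and [x a] has no other nonzero
    diagonal entries. *)
Lemma shift_reindexl a t :
  has_csum (fun k => pi (a * x) (e k) k) t -> has_csum (fun k => pi (x * a) (e k) k) t.
Proof.
have [sK xe] := xP => sum; apply: (has_csum_reindex sK) => [l /negPf sgl|].
  by rewrite rep_shift_coord sgl mul0r.
apply: eq_has_csum sum => k /=.
by rewrite rep_shift_coord sK eqxx (repM piP) xe rep_Zv.
Qed.

Lemma shift_reindexr a t :
  has_csum (fun k => pi (x^*s * a) (e k) k) t ->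
  has_csum (fun k => pi (a * x^*s) (e k) k) t.
Proof.
have [sK xe] := xP => sum; apply: (has_csum_reindex sK) => [l /negPf sgl|].
  by rewrite (repM piP) weighted_shift_star sgl scale0r rep_0v.
apply: eq_has_csum sum => k /=.
rewrite !(repM piP) weighted_shift_star sK eqxx rep_Zv [RHS]ell2Z.
by rewrite rep_coord starK xe inner_scale_ketl conj_real.
Qed.

End WeightedShift.

Variables (x2 : A) (d : I -> R).
Hypothesis x2E : forall k, pi x2 (e k) = (d k)%:C%C *: e k.
Hypothesis d01 : forall k, 0 <= d k <= 1.
Variable dmax : R.
Hypothesis d_summable : forall B : {fset I}, \sum_(k <- B) d k <= dmax.

Lemma x2_star : pi x2^*s = pi x2.
Proof.
apply: rep_ext => k; apply: ell2P => j.
rewrite rep_star_ket !x2E [in LHS]ell2Z [RHS]ell2Z !ketE rmorphM /= conj_real conjC_nat.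
by rewrite eq_sym; case: eqP => [->|]; rewrite ?mulr0.
Qed.

Lemma x2_diag v : pi x2 v = diag d01 v.
Proof.
apply: ell2P => k; rewrite rep_coord x2_star x2E inner_scale_ketl diagE.
by rewrite conj_real.
Qed.

Definition trace_ideal (a : A) : Prop := exists c, pi a = pi (c * x2).
Local Notation J := trace_ideal.

Lemma trace_ideal_sum a : J a -> has_csum (fun k => pi a (e k) k) (dtrace a).
Proof.
move=> [c ac]; have [M cM] := rep_diag_bounded c.
suff [s sP] : exists s, has_csum (fun k => pi a (e k) k) s.
  by rewrite /dtrace (csumE sP).
have coordE k : pi a (e k) k = (d k)%:C%C * pi c (e k) k.
  by rewrite ac (repM piP) x2E rep_Zv.
(* From [x ^+ 2 <= M] follows that the absolute value of [x] is at most [1 + |M|], a bound free of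
   square roots. *)
have bound (x : R) k : x ^+ 2 <= sqmod (pi c (e k) k) ->
    `|d k * x| <= (1 + `|M|) * d k.
  have /andP[d0 _] := d01 k; move=> /le_trans/(_ (cM k)) xM.
  rewrite normrM (ger0_norm d0) mulrC ler_wpM2r //.
  have := ler_norm M; move: (normr_ge0 x) (normr_ge0 M) xM.
  by rewrite -real_normK ?num_real //; nra.
apply: (@has_csum_dominated R I _ (fun k => (1 + `|M|) * d k) ((1 + `|M|) * dmax)).
- move=> k; rewrite coordE; move: (bound (complex.Re (pi c (e k) k)) k).
  case: (pi c (e k) k) => u v /=; rewrite mul0r subr0; apply.
  by rewrite /sqmod /= lerDl sqr_ge0.
- move=> k; rewrite coordE; move: (bound (complex.Im (pi c (e k) k)) k).
  case: (pi c (e k) k) => u v /=; rewrite mul0r addr0; apply.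
  by rewrite /sqmod /= lerDr sqr_ge0.
- by move=> B; rewrite -mulr_sumr ler_wpM2l // addr_ge0.
Qed.

Lemma trace_idealD a b : J a -> J b -> J (a + b).
Proof.
by move=> [c ac] [c' bc]; exists (c + c'); rewrite mulrDl; exact: rep_eqD.
Qed.

Lemma trace_idealZ c a : J a -> J (c *: a).
Proof.
by move=> [b ab]; exists (c *: b); rewrite scale_mulrl; exact: rep_eqZ.
Qed.

Lemma trace_ideal0 : J 0.
Proof. by exists 0; rewrite mul0r. Qed.

Lemma trace_ideal_sumr K (r : seq K) (P : pred K) (F : K -> A) :
  (forall k, J (F k)) -> J (\sum_(k <- r | P k) F k).
Proof. by move=> JF; apply: big_ind => //; [exact: trace_ideal0|exact: trace_idealD]. Qed.

Lemma trace_idealMl a b : J b -> J (a * b).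
Proof.
by move=> [c bc]; exists (a * c); rewrite -mulrA; exact: rep_eqM.
Qed.

Lemma dtraceD a b : J a -> J b -> dtrace (a + b) = dtrace a + dtrace b.
Proof.
move=> Ja Jb; apply: csumE.
apply: eq_has_csum (has_csumD (trace_ideal_sum Ja) (trace_ideal_sum Jb)) => k.
by rewrite rep_D.
Qed.

Lemma dtraceZ c a : J a -> dtrace (c *: a) = c * dtrace a.
Proof.
move=> Ja; apply: csumE; apply: eq_has_csum (has_csumZ c (trace_ideal_sum Ja)) => k.
by rewrite rep_Z.
Qed.

Lemma dtrace0 : dtrace 0 = 0.
Proof. by rewrite -[X in dtrace X](scale0r 0) dtraceZ ?mul0r //; exact: trace_ideal0. Qed.

Lemma dtrace_sum K (r : seq K) (P : pred K) (F : K -> A) : (forall k, J (F k)) ->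
  dtrace (\sum_(k <- r | P k) F k) = \sum_(k <- r | P k) dtrace (F k).
Proof.
move=> JF; elim: r => [|k r IHr]; first by rewrite !big_nil dtrace0.
by rewrite !big_cons; case: ifP => //; rewrite dtraceD ?IHr //; exact: trace_ideal_sumr.
Qed.

(** This makes the left ideal stable on the right: [c x2 b] becomes [c b' x2]. *)
Definition x2_normal (b : A) : Prop := exists b', pi (x2 * b) = pi (b' * x2).

Lemma x2_normalD a b : x2_normal a -> x2_normal b -> x2_normal (a + b).
Proof.
by move=> [c ac] [c' bc]; exists (c + c'); rewrite mulrDl mulrDr; exact: rep_eqD.
Qed.

Lemma x2_normalZ c a : x2_normal a -> x2_normal (c *: a).
Proof.
move=> [b ab]; exists (c *: b); rewrite scale_mulrl scale_mulrr; exact: rep_eqZ.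
Qed.

Lemma x2_normalM a b : x2_normal a -> x2_normal b -> x2_normal (a * b).
Proof.
move=> [c ac] [c' bc]; exists (c * c').
rewrite mulrA (rep_eqM ac (erefl (pi b))) -!mulrA; exact: rep_eqM.
Qed.

Lemma x2_normal1 : x2_normal 1.
Proof. by exists 1; rewrite mul1r mulr1. Qed.

Section ShiftNormal.
Variables (x : A) (f : I -> R) (s g : I -> I) (lam : R).
Hypothesis xP : weighted_shift x f s g.
Hypothesis dlam : forall k, d (s k) = lam * d k.
Hypothesis lam0 : lam != 0.

Lemma shift_commute : pi (x2 * x) = pi (lam%:C%C *: (x * x2)).
Proof.
have [_ xe] := xP; apply: rep_ext => k; rewrite rep_Z !(repM piP) x2E xe.
rewrite !rep_Zv x2E xe !scalerA; congr (_ *: _).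
by rewrite dlam rmorphM /= mulrC.
Qed.

Lemma shift_normal : x2_normal x.
Proof. by exists (lam%:C%C *: x); rewrite shift_commute scale_mulrl. Qed.

Lemma shift_star_normal : x2_normal x^*s.
Proof.
have lamC0 : lam%:C%C != 0 :> R[i] by rewrite (inj_eq (@complexI R)).
exists (lam%:C%C^-1 *: x^*s); rewrite scale_mulrl.
have := rep_eq_star shift_commute; rewrite !(starE A) conj_real => E.
rewrite (rep_eqM (esym x2_star) (erefl (pi x^*s))).
have := rep_eqZ lam%:C%C^-1 E; rewrite scalerA mulVf // scale1r => <-.
by apply: rep_eqZ; apply: rep_eqM => //; exact: x2_star.
Qed.

End ShiftNormal.

Hypothesis all_normal : forall b, x2_normal b.

Lemma trace_idealMr a b : J a -> J (a * b).
Proof.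
move=> [c ac]; have [b' bb'] := all_normal b; exists (c * b').
rewrite (rep_eqM ac (erefl (pi b))) -!mulrA; exact: rep_eqM.
Qed.

(** The adjoint of [c x2] is [x2 c^*s] under [pi], with [x2] on the wrong side; normality of [c^*s]
    brings it back. *)
Lemma trace_ideal_star a : J a -> J a^*s.
Proof.
move=> [c /rep_eq_star ac]; have [c' cc'] := all_normal c^*s; exists c'.
by rewrite ac star_mul -cc'; apply: rep_eqM => //; exact: x2_star.
Qed.

Definition dtrace_central (b : A) : Prop := forall a, J a -> dtrace (b * a) = dtrace (a * b).

Lemma dtrace_centralD a b :
  dtrace_central a -> dtrace_central b -> dtrace_central (a + b).
Proof.
move=> ca cb c Jc; rewrite mulrDl mulrDr !dtraceD ?ca ?cb //;
  by [exact: trace_idealMl|exact: trace_idealMr].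
Qed.

Lemma dtrace_centralZ c a : dtrace_central a -> dtrace_central (c *: a).
Proof.
move=> ca b Jb; rewrite scale_mulrl scale_mulrr !dtraceZ ?ca //;
  by [exact: trace_idealMl|exact: trace_idealMr].
Qed.

(** Two cyclic moves, each legitimate because the ideal is two-sided: [a] passes [b c], then [b]
    passes [c a]. *)
Lemma dtrace_centralM a b :
  dtrace_central a -> dtrace_central b -> dtrace_central (a * b).
Proof.
move=> ca cb c Jc; rewrite -mulrA ca; last exact: trace_idealMl.
by rewrite -mulrA cb ?mulrA //; exact: trace_idealMr.
Qed.

Lemma dtrace_central1 : dtrace_central 1.
Proof. by move=> a _; rewrite mul1r mulr1. Qed.

Lemma shift_central x f s g : weighted_shift x f s g -> dtrace_central x.
Proof.
by move=> xP a Ja; apply: csumE; apply: (shift_reindexl xP);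
  apply: trace_ideal_sum; exact: trace_idealMr.
Qed.

Lemma shift_star_central x f s g : weighted_shift x f s g -> dtrace_central x^*s.
Proof.
move=> xP a Ja; apply: esym; apply: csumE; apply: (shift_reindexr xP).
by apply: trace_ideal_sum; exact: trace_idealMl.
Qed.

(** Split [x2] into two square roots: [c x2] is [c x2^(1/2)] times [x2^(1/2)], and the square root
    is Hilbert-Schmidt since the eigenvalues of [x2] are summable. *)
Lemma trace_ideal_trace_class a : J a ->
  trace_class (pi a) /\ trace (pi a) = dtrace a.
Proof.
move=> [c ac]; split; last first.
  by congr csum; apply: funext => k; rewrite inner_ketl.
have r01 k : 0 <= Num.sqrt (d k) <= 1.
  have /andP[d0 d1] := d01 k; rewrite sqrtr_ge0 /= -[leRHS]sqrtr1.
  exact: ler_wsqrtr.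
have rr (B : {fset I}) : \sum_(k <- B) Num.sqrt (d k) ^+ 2 <= dmax.
  rewrite (le_trans _ (d_summable B)) // ler_sum // => k _.
  by have /andP[d0 _] := d01 k; rewrite sqr_sqrtr.
exists (pi c \o diag r01), (diag r01); split.
- exact: hilbert_schmidt_diag (rep_bounded piP c) rr.
- have idb : bounded_operator (@id (ell2 R I)).
    by split=> //; exists 1 => v; rewrite mul1e.
  exact: hilbert_schmidt_diag idb rr.
- move=> v; rewrite ac /= (repM piP) x2_diag; congr (pi c _).
  apply: ell2P => k; rewrite diagE [RHS]diagE [X in _ = _ * X]diagE mulrA -rmorphM /=.
  by have /andP[d0 _] := d01 k; rewrite -expr2 sqr_sqrtr.
Qed.

End Representation.

(** * Sums of the eigenvalues of [pi x2] *)

Section WeightSums.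
Variables (R : realType) (q : R) (q01 : 0 < q < 1).

Lemma ler_sum_fset (I : choiceType) (B : {fset I}) (s : seq I) (f : I -> R) :
  (forall k, 0 <= f k) -> uniq s -> {subset B <= s} ->
  \sum_(k <- B) f k <= \sum_(k <- s) f k.
Proof.
move=> f0 us Bs; rewrite [leRHS](bigID (mem B)) /=.
rewrite (_ : \sum_(k <- s | k \in B) f k = \sum_(k <- B) f k); last first.
  rewrite -big_filter; apply: perm_big; apply: uniq_perm; rewrite ?filter_uniq //.
  by move=> k; rewrite mem_filter andb_idr // => /Bs.
by rewrite lerDl sumr_ge0.
Qed.

Lemma geometric_sum_le (x : R) m : 0 <= x < 1 ->
  \sum_(k <- iota 0 m) x ^+ k <= (1 - x)^-1.
Proof.
move=> /andP[x0 x1]; have -> : iota 0 m = index_iota 0 m by rewrite /index_iota subn0.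
rewrite big_mkord.
have x1' : 0 < 1 - x by rewrite subr_gt0.
rewrite -(@ler_pM2r _ (1 - x)) // mulVf ?gt_eqF //.
have := subrX1 x m; rewrite -opprB => /(congr1 -%R).
by rewrite opprK -mulNr opprB mulrC => <-; rewrite gerBl exprn_ge0.
Qed.

Definition weight (k : nat * nat) : R := q ^+ (k.1 + 2 * k.2).

Lemma weight01 k : 0 <= weight k <= 1.
Proof.
by case/andP: q01 => q0 q1; rewrite exprn_ge0 ?exprn_ile1 // ltW.
Qed.

Lemma weight_summable (B : {fset nat * nat}) :
  \sum_(k <- B) weight k <= (1 - q)^-1 * (1 - q ^+ 2)^-1.
Proof.
case/andP: q01 => q0 q1.
(* The finite set is enclosed in a square, over which the sum is a product of two geometric sums. *)
have [m Bm] : exists m, forall k, k \in B -> (k.1 < m)%N && (k.2 < m)%N.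
  exists (\sum_(k <- B) (k.1 + k.2)).+1 => k kB.
  by rewrite !ltnS (big_fsetD1 k) //= -addnA leq_addr addnCA leq_addr.
pose s := [seq (i, j) | i <- iota 0 m, j <- iota 0 m].
have us : uniq s.
  by apply: allpairs_uniq; rewrite ?iota_uniq // => -[? ?] [? ?].
apply: (le_trans (ler_sum_fset _ us _)).
- by move=> k; case/andP: (weight01 k).
- move=> [i j] /Bm /= /andP[im jm]; apply/allpairsP; exists (i, j).
  by rewrite !mem_iota.
rewrite big_allpairs /= /weight /=.
under eq_bigr do under eq_bigr do rewrite exprD exprM.
under eq_bigr do rewrite -mulr_sumr.
rewrite -mulr_suml ler_pM ?sumr_ge0 // ?geometric_sum_le ?(ltW q0) //.
- by move=> i _; rewrite exprn_ge0 // ltW.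
- by move=> i _; rewrite !exprn_ge0 // ltW.
- by rewrite exprn_ge0 ?exprn_ilt1 // ltW.
Qed.

Lemma weight_shift1 k : weight (k.1.+1, k.2) = q * weight k.
Proof. by rewrite /weight /= addSn exprS. Qed.

Lemma weight_shift2 k : weight (k.1, k.2.+1) = q ^+ 2 * weight k.
Proof. by rewrite /weight /= mulnS addnCA exprD. Qed.

(** Self-similarity determines the sum. Off the line [k1 = 0] the family is its own shift scaled by
    [q^2]; on that line, off the origin, it is its shift scaled by [q^4]. Summability is established
    beforehand, so that the two linear equations can be solved. *)
Lemma sum_weight_sqr :
  has_csum (fun k => (weight k ^+ 2)%:C%C) ((1 - q ^+ 2)^-1 * (1 - q ^+ 4)^-1)%:C%C.
Proof.
case/andP: q01 => q0 q1.
have w0 k : 0 <= weight k by case/andP: (weight01 k).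
have w2 k : 0 <= weight k ^+ 2 by rewrite exprn_ge0.
have w2le k : weight k ^+ 2 <= weight k.
  by rewrite expr2 ler_piMl //; case/andP: (weight01 k).
pose F (k : nat * nat) : R[i] := (weight k ^+ 2)%:C%C.
pose F0 (k : nat * nat) : R[i] := if k.1 == 0 then F k else 0.
have [|||s sP] := @has_csum_dominated R _ F weight ((1 - q)^-1 * (1 - q ^+ 2)^-1).
- by move=> k; rewrite /F /= ger0_norm ?w2 // w2le.
- by move=> k; rewrite /F /= normr0.
- exact: weight_summable.
have [|||s0 s0P] := @has_csum_dominated R _ F0 weight ((1 - q)^-1 * (1 - q ^+ 2)^-1).
- move=> k; rewrite /F0 /F; case: eqP => _ /=; last by rewrite normr0.
  by rewrite ger0_norm ?w2 // w2le.
- by move=> k; rewrite /F0 /F; case: eqP => _ /=; rewrite normr0.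
- exact: weight_summable.
have sE : s = s0 + (q ^+ 2)%:C%C * s.
  apply: (has_csum_unique sP).
  pose F1 (k : nat * nat) : R[i] := if k.1 == 0 then 0 else F k.
  have F1P : has_csum F1 ((q ^+ 2)%:C%C * s).
    apply: (@has_csum_reindex R _ _ (fun k => (k.1.+1, k.2)) (fun k => (k.1.-1, k.2))).
    - by case.
    - by case=> -[|i] j; rewrite /F1 //= eqxx.
    - apply: eq_has_csum (has_csumZ _ sP) => k.
      by rewrite /F1 /F /= weight_shift1 exprMn [RHS]rmorphM.
  apply: eq_has_csum (has_csumD s0P F1P) => k.
  by rewrite /F0 /F1; case: eqP; rewrite ?addr0 ?add0r.
have s0E : s0 = 1 + (q ^+ 4)%:C%C * s0.
  apply: (has_csum_unique s0P).
  pose F1 (k : nat * nat) : R[i] := if k.2 == 0 then 0 else F0 k.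
  have F1P : has_csum F1 ((q ^+ 4)%:C%C * s0).
    apply: (@has_csum_reindex R _ _ (fun k => (k.1, k.2.+1)) (fun k => (k.1, k.2.-1))).
    - by case.
    - by case=> i [|j]; rewrite /F1 //= eqxx.
    - apply: eq_has_csum (has_csumZ _ s0P) => k.
      rewrite /F1 /F0 /F /= weight_shift2 exprMn -[q ^+ 2 ^+ 2]exprM [in RHS]rmorphM.
      by case: eqP; rewrite ?mulr0.
  pose F2 (k : nat * nat) : R[i] := if k == (0, 0)%N then F k else 0.
  have F2P : has_csum F2 1.
    have := @has_csum_supp1 R _ F2 (0, 0)%N.
    have -> : F2 (0, 0)%N = 1 by rewrite /F2 /F /weight /= expr0 expr1n.
    apply => k /negPf.
    by rewrite /F2 => ->.
  apply: eq_has_csum (has_csumD F2P F1P) => -[i j].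
  rewrite /F2 /F1 /F0 /= xpair_eqE.
  by case: (i =P 0) => _; case: (j =P 0) => _; rewrite ?addr0 ?add0r.
have q2 : 1 - q ^+ 2 != 0 by rewrite subr_eq0 eq_sym lt_eqF // exprn_ilt1 // ltW.
have q4 : 1 - q ^+ 4 != 0 by rewrite subr_eq0 eq_sym lt_eqF // exprn_ilt1 // ltW.
suff -> : ((1 - q ^+ 2)^-1 * (1 - q ^+ 4)^-1)%:C%C = s by [].
have solve (x : R) (a b : R[i]) : 1 - x != 0 -> a = b + x%:C%C * a ->
    a = b * (1 - x)^-1%:C%C.
  move=> x1 E; have x1' : (1 - x)%:C%C != 0 :> R[i] by rewrite (inj_eq (@complexI R)).
  apply: (mulIf x1'); rewrite -mulrA -rmorphM /= mulVf // mulr1 rmorphB /= mulrBr mulr1.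
  by rewrite {1}E [a * _]mulrC addrK.
rewrite (solve _ _ _ q2 sE) (solve _ _ _ q4 s0E) mul1r -rmorphM /=.
by rewrite mulrC.
Qed.

End WeightSums.

(** * Relations and representation of O(S^7_q) *)

Record S7_family (C : numClosedFieldType) (A : starAlgType C) (q : C)
    (x1 x2 x3 x4 : A) : Prop := S7Family {
  S7_x1x1s : x1^*s * x1 = x1 * x1^*s;
  S7_x1sx2 : x1^*s * x2 = q *: (x2 * x1^*s);
  S7_x2sx2 : x2^*s * x2 = x2 * x2^*s + (1 - q ^+ 2) *: (x1 * x1^*s);
  S7_x3sx3 : x3^*s * x3 = x3 * x3^*s + (1 - q ^+ 4) *: (x2 * x2^*s)
    + (1 - q ^+ 2) *: (x1 * x1^*s);
  S7_x3x4 : x3 * x4 = q *: (x4 * x3);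
  S7_x3sx4 : x3^*s * x4 = q *: (x4 * x3^*s) - (q ^+ 4 * (q - q^-1)) *: (x2 * x1^*s);
  S7_sphere : x1 * x1^*s + x2 * x2^*s + x3 * x3^*s + x4 * x4^*s = 1;
  S7_sphere_star : q ^+ 8 *: (x1^*s * x1) + q ^+ 6 *: (x2^*s * x2)
    + q ^+ 2 *: (x3^*s * x3) + x4^*s * x4 = 1
}.

Section S7.
Variables (R : realType) (q : R).
Local Notation qC := (q%:C%C).
Local Notation A := (O_S7 q).
Local Notation x1 := (S7_x q X1).
Local Notation x2 := (S7_x q X2).
Local Notation x3 := (S7_x q X3).
Local Notation x4 := (S7_x q X4).

Local Notation relS7 := (fun s t => List.In (s, t) (S7_relations q)).

Lemma S7_relation i (p := nth (SCst 0, SCst 0) (S7_relations q) i) :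
  (i < 17)%N -> \pi_(presented relS7) p.1 = \pi_(presented relS7) p.2 :> A.
Proof.
move=> lti; apply: (@presented_rel _ _ relS7); rewrite {}/p -surjective_pairing.
by move: i lti; do 17![case=> [_|] /=; first by intuition].
Qed.

Ltac S7_rel i :=
  let H := fresh in
  have H := @S7_relation i isT;
  rewrite /= !(piE relS7) ?scale_mulrl ?mul1r ?scaleNr in H; exact: H.

Lemma S7_familyP : S7_family qC x1 x2 x3 x4.
Proof.
split.
- S7_rel 6%N.
- S7_rel 7%N.
- S7_rel 10%N.
- S7_rel 13%N.
- S7_rel 5%N.
- S7_rel 14%N.
- have H := @S7_relation 15 isT.
  by rewrite /= !(piE relS7) scale1r in H.
- have H := @S7_relation 16 isT.
  by rewrite /= !(piE relS7) !scale_mulrl !mul1r scale1r in H.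
Qed.

Variables (q01 : 0 < q < 1).
Variables (pi : A -> ell2 R (nat * nat)%type -> ell2 R (nat * nat)%type).
Hypothesis piP : is_S7_rep pi.
Let pi_rep : bounded_star_rep pi := proj1 piP.
Local Notation J := (trace_ideal pi x2).
Local Notation tr := (dtrace pi).
Local Notation d := (weight q).

Lemma pi_x2 k : pi x2 (ket R k) = (d k)%:C%C *: ket R k.
Proof. by case: k => i j; have [_ ->] := proj2 piP i j. Qed.

(** [x3] raises [k2] and [x4] raises [k1], scaling the weight by [q^2] and [q]; the truncated
    predecessor is a left inverse. *)
Lemma S7_shift (g : S7_gen) : exists f s s' lam,
  [/\ weighted_shift pi (S7_x q g) f s s', forall k, d (s k) = lam * d k & lam != 0].
Proof.
case/andP: q01 => q0 q1.
have q0' : q != 0 by rewrite gt_eqF.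
case: g.
- exists (fun=> 0), id, id, 1; split; rewrite ?oner_eq0 //.
  + by split=> // -[i j]; have [-> _ _ _] := proj2 piP i j; rewrite scale0r.
  + by move=> k; rewrite mul1r.
- exists d, id, id, 1; split; rewrite ?oner_eq0 //.
  + by split=> // k; rewrite pi_x2.
  + by move=> k; rewrite mul1r.
- exists (fun k => q ^+ k.1 * Num.sqrt (1 - q ^+ (4 * k.2.+1))), (fun k => (k.1, k.2.+1)),
    (fun k => (k.1, k.2.-1)), (q ^+ 2); split.
  + by split=> [[]//|[i j]]; have [_ _ -> _] := proj2 piP i j.
  + by move=> k; rewrite weight_shift2.
  + by rewrite expf_neq0.
- exists (fun k => Num.sqrt (1 - q ^+ (2 * k.1.+1))), (fun k => (k.1.+1, k.2)),
    (fun k => (k.1.-1, k.2)), q; split=> //.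
  + by split=> [[]//|[i j]]; have [_ _ _ ->] := proj2 piP i j.
  + by move=> k; rewrite weight_shift1.
Qed.

Let d01 := weight01 q01.
Let d_summable := weight_summable q01.

(** Taking adjoints turns normality into a condition on the other side of [x2], so the induction
    carries [b] and [b^*s] together. *)
Lemma S7_normal b : x2_normal pi x2 b.
Proof.
suff : x2_normal pi x2 b /\ x2_normal pi x2 b^*s by case.
move: b; apply: presented_ind => [g||x y [xN xN'] [yN yN']|c x [xN xN']|
    x y [xN xN'] [yN yN']|x [xN xN']]; split; rewrite ?(starE A) //.
- have [f [s [s' [lam [xP dlam lam0]]]]] := S7_shift g.
  exact: (shift_normal pi_rep pi_x2 xP dlam).
- have [f [s [s' [lam [xP dlam lam0]]]]] := S7_shift g.
  exact: (shift_star_normal pi_rep pi_x2 xP dlam lam0).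
- exact: x2_normal1.
- exact: x2_normal1.
- exact: (x2_normalD pi_rep).
- exact: (x2_normalD pi_rep).
- exact: (x2_normalZ pi_rep).
- exact: (x2_normalZ pi_rep).
- exact: (x2_normalM pi_rep).
- exact: (x2_normalM pi_rep).
Qed.

Lemma S7_central b : dtrace_central pi x2 b.
Proof.
suff : dtrace_central pi x2 b /\ dtrace_central pi x2 b^*s by case.
move: b; apply: presented_ind => [g||x y [xN xN'] [yN yN']|c x [xN xN']|
    x y [xN xN'] [yN yN']|x [xN xN']]; split; rewrite ?(starE A) //.
- have [f [s [s' [lam [xP dlam lam0]]]]] := S7_shift g.
  exact: (shift_central pi_rep pi_x2 d01 d_summable S7_normal xP).
- have [f [s [s' [lam [xP dlam lam0]]]]] := S7_shift g.
  exact: (shift_star_central pi_rep pi_x2 d01 d_summable xP).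
- exact: dtrace_central1.
- exact: dtrace_central1.
- exact: (dtrace_centralD pi_rep pi_x2 d01 d_summable S7_normal).
- exact: (dtrace_centralD pi_rep pi_x2 d01 d_summable S7_normal).
- exact: (dtrace_centralZ pi_rep pi_x2 d01 d_summable S7_normal).
- exact: (dtrace_centralZ pi_rep pi_x2 d01 d_summable S7_normal).
- exact: (dtrace_centralM pi_rep S7_normal).
- exact: (dtrace_centralM pi_rep S7_normal).
Qed.

Lemma dtrace_comm a b : J a -> tr (b * a) = tr (a * b).
Proof. exact: S7_central. Qed.

Lemma pi_x1 : pi x1 = pi 0.
Proof.
apply: (rep_ext pi_rep) => -[i j]; have [-> _ _ _] := proj2 piP i j.
by rewrite (rep_0 pi_rep).
Qed.

Lemma trace_ideal_x1 : J x1.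
Proof. by exists 0; rewrite mul0r pi_x1. Qed.

Lemma trace_ideal_x2 : J x2.
Proof. by exists 1; rewrite mul1r. Qed.

Lemma dtrace_x2x2s : tr (x2 * x2^*s) = ((1 - q ^+ 2)^-1 * (1 - q ^+ 4)^-1)%:C%C.
Proof.
apply: csumE; apply: eq_has_csum (sum_weight_sqr q01) => k.
rewrite (repM pi_rep) (x2_star pi_rep pi_x2) !(pi_x2, rep_Zv pi_rep).
by rewrite [RHS]ell2Z [X in _ = _ * X]ell2Z ketE eqxx mulr1 -rmorphM.
Qed.

Lemma dtrace_x1x1s : tr (x1 * x1^*s) = 0.
Proof.
rewrite /dtrace (rep_eqM pi_rep pi_x1 (erefl (pi x1^*s))) mul0r.
exact: (dtrace0 pi_rep pi_x2 d01 d_summable).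
Qed.

End S7.

(** * The fibre map O(S^7_q) -> O(SU_q(2)) *)

Section FibreLift.
Variables (R : realType) (q : R) (A : starAlgType R[i]).
Local Notation qC := (q%:C%C).
Variables (x1 x2 x3 x4 : A).

(* A section on formal *-polynomials of the quotient map that kills x1 and x2. *)
Fixpoint fibre_lift (s : sterm R[i] SUq2_gen) : A :=
  match s with
  | SGen Alpha => x4^*s
  | SGen Gamma => - x3
  | SCst c => c *: (1 : A)
  | SAdd s t => fibre_lift s + fibre_lift t
  | SMul s t => fibre_lift s * fibre_lift t
  | SStar s => (fibre_lift s)^*s
  end.

Hypothesis fam : S7_family qC x1 x2 x3 x4.
Hypothesis q0 : qC != 0.

(** The diagonal entries of the unitarity relations come from the two sphere relations, the others
    from the exchange relations of [x4] with [x3] and [x3^*s]. The coefficients of the remainder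
    stand on the left, as membership in a left ideal requires. *)
Lemma fibre_lift_rel s t : SUq2_rel q s t -> exists b c d e,
  fibre_lift s - fibre_lift t = b * x1 + c * x2 + d * x1^*s + e * x2^*s.
Proof.
have conj_q : qC^* = qC by exact: conj_real.
have [x11 x12 x22 x33 x34 x3s4 sph sphs] := fam.
have x43s : x4^*s * x3^*s = qC *: (x3^*s * x4^*s).
  by rewrite -star_mul x34 starZ conj_q star_mul.
have x4s3 : x4^*s * x3 = qC *: (x3 * x4^*s) - (qC ^+ 4 * (qC - qC^-1)) *: (x1 * x2^*s).
  rewrite -{1}[x3]starK -star_mul x3s4 !(starE A).
  by rewrite !(rmorphM, rmorphXn, rmorphB, fmorphV) /= !conj_q.
have x44 : x4 * x4^*s = 1 - x1 * x1^*s - x2 * x2^*s - x3 * x3^*s.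
  by rewrite -sph; linear_eq R[i] A; ring.
have x4s4 : x4^*s * x4 = 1 - qC ^+ 8 *: (x1^*s * x1) - qC ^+ 6 *: (x2^*s * x2)
    - qC ^+ 2 *: (x3^*s * x3).
  by rewrite -sphs; linear_eq R[i] A; ring.
have conj_Nq : (- qC)^* = - qC by rewrite rmorphN /= conj_q.
have E := (mulE A, starE A, conj_Nq, conj_q, @scale1r R[i] A, @scale0r R[i] A).
case=> -[[|[|//]] /= _] [[|[|//]] /= _]; rewrite !E.
- exists (- (qC ^+ 8 *: x1^*s)), (- (qC ^+ 6 *: x2^*s)), 0, 0.
  by rewrite !E !mul0r x4s4; linear_eq R[i] A; ring.
- exists 0, 0, 0, 0.
  by rewrite ?E !mul0r x43s; linear_eq R[i] A; ring.
- exists 0, 0, 0, 0.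
  by rewrite ?E !mul0r x34; linear_eq R[i] A; ring.
- exists 0, 0, (- x1), (- x2).
  by rewrite !E !mul0r x44; linear_eq R[i] A; ring.
- exists 0, 0, (- (qC ^+ 2 *: x1)), (- (qC ^+ 4 *: x2)).
  by rewrite !E !mul0r x44 x33; linear_eq R[i] A; ring.
- exists 0, 0, ((qC ^+ 4 * (qC - qC^-1)) *: x2), 0.
  by rewrite ?E ?mul0r x3s4; linear_eq R[i] A; field.
- exists 0, 0, 0, ((qC ^+ 4 * (qC - qC^-1)) *: x1).
  by rewrite ?E ?mul0r x4s3; linear_eq R[i] A; field.
- exists (- (qC ^+ 8 *: x1^*s)), (- (qC ^+ 6 *: x2^*s)),
    (- ((qC ^+ 2 * (1 - qC ^+ 2)) *: x1)), (- ((qC ^+ 2 * (1 - qC ^+ 4)) *: x2)).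
  by rewrite !E x4s4 x33; linear_eq R[i] A; ring.
Qed.

End FibreLift.

Section Fibre.
Variables (R : realType) (q : R) (q01 : 0 < q < 1).
Local Notation qC := (q%:C%C).
Local Notation A := (O_S7 q).
Local Notation H := (O_SUq2 q).
Local Notation x1 := (S7_x q X1).
Local Notation x2 := (S7_x q X2).
Local Notation x3 := (S7_x q X3).
Local Notation x4 := (S7_x q X4).
Variables (deltaR : A -> tensor A H) (deltaRP : is_S7_coaction deltaR).
Variables (eps : A -> R[i]) (epsP : is_S7_character eps).
Variables (pi : A -> ell2 R (nat * nat)%type -> ell2 R (nat * nat)%type).
Hypothesis piP : is_S7_rep pi.
Let pi_rep : bounded_star_rep pi := proj1 piP.
Local Notation J := (trace_ideal pi x2).

Let q0 : qC != 0.
Proof. by case/andP: q01 => q0 _; rewrite (inj_eq (@complexI R)) gt_eqF. Qed.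

Let eps_hom : is_star_hom eps := proj1 epsP.

Lemma balanced_eps : balanced (fun a (h : H) => eps a *: h).
Proof.
apply: balanced_scale => [a b|c a].
- exact: (star_homD eps_hom).
- exact: (star_homZ eps_hom).
Qed.

(** Restriction to the fibre through the point [eps], dual to the orbit map of that point. *)
Definition fibre (a : A) : H := tlift (fun a (h : H) => eps a *: h) (deltaR a).

Lemma fibre_hom : is_star_hom fibre.
Proof.
pose f := tlift (fun a (h : H) => eps a *: h).
have fE a h : f (tens a h) = eps a *: h by exact: (tlift_tens balanced_eps).
have fD x y : f (x + y) = f x + f y by exact: (tliftD balanced_eps).
have f0 : f 0 = 0 by exact: (tlift0 balanced_eps).
have fZ c x : f (c *: x) = c *: f x.
  apply: (tliftZ balanced_eps) => c' u v.
  by rewrite (star_homZ eps_hom) scalerA.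
have fM (x y : (tensor A H : starAlgType R[i])) : f (x * y) = f x * f y.
  elim/tensor_ind: x => [|a h|x x' IHx IHx'].
  - by rewrite mul0r f0 mul0r.
  - elim/tensor_ind: y => [|b h'|y y' IHy IHy'].
    + by rewrite mulr0 f0 mulr0.
    + rewrite tens_mul !fE (star_homM eps_hom).
      by rewrite scale_mulrl scale_mulrr scalerA.
    + by rewrite mulrDr !fD mulrDr IHy IHy'.
  - by rewrite mulrDl !fD mulrDl IHx IHx'.
have fS (x : (tensor A H : starAlgType R[i])) : f x^*s = (f x)^*s.
  elim/tensor_ind: x => [|a h|x x' IHx IHx'].
  - by rewrite star_zero f0 star_zero.
  - by rewrite tens_star !fE (star_homS eps_hom) starZ.
  - by rewrite starD !fD starD IHx IHx'.
have dP := proj1 deltaRP; split; rewrite /fibre -/f.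
- by move=> c x y; rewrite (star_hom_linear dP) fD fZ.
- by rewrite (star_hom1 dP) [LHS]fE (star_hom1 eps_hom) scale1r.
- by move=> x y; rewrite (star_homM dP) fM.
- by move=> x; rewrite (star_homS dP) fS.
Qed.

Lemma fibre_u i k : fibre (S7_u q i k) = \sum_j eps (S7_u q i j) *: SUq2_T q j k.
Proof.
rewrite /fibre (proj2 deltaRP) (tlift_sum balanced_eps).
by apply: eq_bigr => j _; rewrite (tlift_tens balanced_eps).
Qed.

Lemma fibre_coinvariant b : coinvariants deltaR b -> fibre b = eps b *: (1 : H).
Proof. by move=> bB; rewrite /fibre bB (tlift_tens balanced_eps). Qed.

Lemma S7_uE i k : S7_u q i k = nth 0 (nth [::] [::
    [:: qC *: x1;               qC *: x2];
    [:: - (qC ^+ 2 *: x2^*s); qC ^+ 3 *: x1^*s];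
    [:: - x3;                  x4];
    [:: x4^*s;               qC *: x3^*s]] i) k.
Proof. by rewrite mxE. Qed.

(** [eps] annihilates the whole row of [u] in which [x1] and [x2] stand. *)
Lemma fibre_x1 : fibre x1 = 0.
Proof.
have [e1 e2 e3 e4] := proj2 epsP.
have := fibre_u ord0 ord0; rewrite big_ord_recl big_ord1 !S7_uE /=.
rewrite !(star_homE fibre_hom) !(star_homE eps_hom) e1 e2 scaler0 !scale0r addr0.
by move/(congr1 (fun x => qC^-1 *: x)); rewrite scalerA mulVf // scale1r scaler0.
Qed.

Lemma fibre_x2 : fibre x2 = 0.
Proof.
have [e1 e2 e3 e4] := proj2 epsP.
have := fibre_u ord0 ord_max; rewrite big_ord_recl big_ord1 !S7_uE /=.
rewrite !(star_homE fibre_hom) !(star_homE eps_hom) e1 e2 scaler0 !scale0r addr0.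
by move/(congr1 (fun x => qC^-1 *: x)); rewrite scalerA mulVf // scale1r scaler0.
Qed.

Local Notation alpha := (presented_gen (@SUq2_rel R q) Alpha : H).
Local Notation gamma := (presented_gen (@SUq2_rel R q) Gamma : H).

Lemma SUq2_TE i j : SUq2_T q i j =
  nth 0 (nth [::] [:: [:: alpha; - qC *: gamma^*s]; [:: gamma; alpha^*s]] i) j.
Proof.
rewrite mxE /SUq2_T_term; case: i j => [[|[|//]] /= _] [[|[|//]] /= _] //.
- by rewrite !(piE (@SUq2_rel R q)) scale_mulrl mul1r.
- by rewrite !(piE (@SUq2_rel R q)).
Qed.

(** [eps] sends the row [(- x3, x4)] of [u] to [(0, 1)], hence [fibre] sends it to the last row
    [(gamma, alpha^*s)] of the matrix [T]. *)
Lemma fibre_x3 : fibre x3 = - gamma.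
Proof.
have [e1 e2 e3 e4] := proj2 epsP.
have := fibre_u (inord 2) ord0; rewrite big_ord_recl big_ord1 !S7_uE inordK //=.
rewrite !(star_homE fibre_hom) !(star_homE eps_hom) e3 e4 oppr0 scale0r add0r scale1r.
by rewrite SUq2_TE /= => <-; rewrite opprK.
Qed.

Lemma fibre_x4 : fibre x4 = alpha^*s.
Proof.
have [e1 e2 e3 e4] := proj2 epsP.
have := fibre_u (inord 2) ord_max; rewrite big_ord_recl big_ord1 !S7_uE inordK //=.
rewrite !(star_homE eps_hom) e3 e4 oppr0 scale0r add0r scale1r.
by rewrite SUq2_TE /=.
Qed.

Local Notation fibre_lift := (fibre_lift x3 x4).

Definition fibre_eq (a b : A) : Prop := J (a - b).

Lemma fibre_eq_refl a : fibre_eq a a.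
Proof. by rewrite /fibre_eq subrr; exact: trace_ideal0. Qed.

Lemma fibre_eqD a a' b b' : fibre_eq a a' -> fibre_eq b b' -> fibre_eq (a + b) (a' + b').
Proof. by move=> ab ab'; rewrite /fibre_eq opprD addrACA; exact: trace_idealD. Qed.

Lemma fibre_eqM a a' b b' : fibre_eq a a' -> fibre_eq b b' -> fibre_eq (a * b) (a' * b').
Proof.
move=> aa bb; rewrite /fibre_eq.
have -> : a * b - a' * b' = (a - a') * b + a' * (b - b').
  by rewrite mulrBl mulrBr addrA subrK.
apply: (trace_idealD pi_rep); last exact: trace_idealMl.
exact: (trace_idealMr pi_rep (S7_normal q01 piP)).
Qed.

Lemma fibre_eqS a a' : fibre_eq a a' -> fibre_eq a^*s a'^*s.
Proof.
rewrite /fibre_eq -star_opp -starD.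
exact: (trace_ideal_star pi_rep (pi_x2 piP) (S7_normal q01 piP)).
Qed.

Lemma fibre_eq_sym a b : fibre_eq a b -> fibre_eq b a.
Proof. by move=> ab; rewrite /fibre_eq -opprB -scaleN1r; exact: trace_idealZ. Qed.

Lemma fibre_eq_trans a b c : fibre_eq a b -> fibre_eq b c -> fibre_eq a c.
Proof.
by move=> ab bc; have := trace_idealD pi_rep ab bc; rewrite addrA subrK.
Qed.

Let J12 (a : A) : (exists b c d e, a = b * x1 + c * x2 + d * x1^*s + e * x2^*s) -> J a.
Proof.
have Jx1 := trace_ideal_x1 piP; have Jx2 := trace_ideal_x2 pi.
have Jx1s := trace_ideal_star pi_rep (pi_x2 piP) (S7_normal q01 piP) Jx1.
have Jx2s := trace_ideal_star pi_rep (pi_x2 piP) (S7_normal q01 piP) Jx2.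
move=> [b [c [d [e ->]]]].
by do !apply: (trace_idealD pi_rep); exact: trace_idealMl.
Qed.

(** The lift is well defined modulo the ideal: the algebra axioms hold exactly, and only the
    defining relations leave a remainder. *)
Lemma fibre_lift_congr s t : scongr (@SUq2_rel R q) s t ->
  fibre_eq (fibre_lift s) (fibre_lift t).
Proof.
elim=> {s t} /=.
- by move=> s t /(fibre_lift_rel (S7_familyP q) q0); exact: J12.
- by move=> s; exact: fibre_eq_refl.
- by move=> s t _; exact: fibre_eq_sym.
- by move=> s t u _ st _; exact: fibre_eq_trans.
- by move=> s s' t t' _ ss _; exact: fibre_eqD.
- by move=> s s' t t' _ ss _; exact: fibre_eqM.
- by move=> s s' _; exact: fibre_eqS.
- by move=> s t u; rewrite addrA; exact: fibre_eq_refl.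
- by move=> s t; rewrite addrC; exact: fibre_eq_refl.
- by move=> s; rewrite scale0r add0r; exact: fibre_eq_refl.
- by move=> s; rewrite scaleN1r mulN1r addNr scale0r; exact: fibre_eq_refl.
- by move=> s t u; rewrite mulrA; exact: fibre_eq_refl.
- by move=> s; rewrite scale1r mul1r; exact: fibre_eq_refl.
- by move=> s; rewrite scale1r mulr1; exact: fibre_eq_refl.
- by move=> s t u; rewrite mulrDl; exact: fibre_eq_refl.
- by move=> s t u; rewrite mulrDr; exact: fibre_eq_refl.
- by move=> a b; rewrite scalerDl; exact: fibre_eq_refl.
- by move=> a b; rewrite scale_mulrl mul1r scalerA; exact: fibre_eq_refl.
- by move=> a s; rewrite scale_mulrl scale_mulrr mul1r mulr1; exact: fibre_eq_refl.
- by move=> a; rewrite starZ star_one; exact: fibre_eq_refl.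
- by move=> s; rewrite starK; exact: fibre_eq_refl.
- by move=> s t; rewrite starD; exact: fibre_eq_refl.
- by move=> s t; rewrite star_mul; exact: fibre_eq_refl.
Qed.

(** Lifting the image of [a] gives back [a] modulo the ideal. This passes to sums, products and
    adjoints, and on the generators [x1] and [x2], which lie in the ideal, the lift is 0. *)
Lemma fibre_lift_exists a : exists s,
  fibre a = \pi_(presented (@SUq2_rel R q)) s :> H /\ fibre_eq a (fibre_lift s).
Proof.
move: a; apply: presented_ind.
- have Jx1 := trace_ideal_x1 piP; have Jx2 := trace_ideal_x2 pi.
  have h := piE (@SUq2_rel R q).
  case.
  + exists (SCst 0); rewrite [LHS]fibre_x1 !h scale0r; split=> //=.
    by rewrite /fibre_eq scale0r subr0.
  + exists (SCst 0); rewrite [LHS]fibre_x2 !h scale0r; split=> //=.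
    by rewrite /fibre_eq scale0r subr0.
  + exists (SMul (SCst (-1)) (SGen Gamma)); rewrite [LHS]fibre_x3 !h; split=> /=.
      by rewrite scaleN1r mulN1r.
    by rewrite scaleN1r mulrNN mul1r; exact: fibre_eq_refl.
  + exists (SStar (SGen Alpha)); rewrite [LHS]fibre_x4 !h; split=> //=.
    by rewrite starK; exact: fibre_eq_refl.
- exists (SCst 1); rewrite (star_hom1 fibre_hom) (pi_cst (@SUq2_rel R q)) scale1r.
  by split=> //=; rewrite scale1r; exact: fibre_eq_refl.
- move=> a b [s [as_ Js]] [t [bt Jt]]; exists (SAdd s t).
  rewrite (star_homD fibre_hom) (pi_add (@SUq2_rel R q)) as_ bt; split=> //=.
  exact: fibre_eqD.
- move=> c a [s [as_ Js]]; exists (SMul (SCst c) s).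
  rewrite (star_homZ fibre_hom) !(piE (@SUq2_rel R q)) as_ scale_mulrl mul1r; split=> //=.
  rewrite (_ : c *: a = (c *: (1 : A)) * a); last by rewrite scale_mulrl mul1r.
  by apply: fibre_eqM => //; exact: fibre_eq_refl.
- move=> a b [s [as_ Js]] [t [bt Jt]]; exists (SMul s t).
  rewrite (star_homM fibre_hom) (pi_mul (@SUq2_rel R q)) as_ bt; split=> //=.
  exact: fibre_eqM.
- move=> a [s [as_ Js]]; exists (SStar s).
  rewrite (star_homS fibre_hom) (pi_star (@SUq2_rel R q)) as_; split=> //=.
  exact: fibre_eqS.
Qed.

(* If fibre a = c then a - c lies in the kernel of the fibre map, which is
   generated by x1 and x2 up to the kernel of pi. *)
Lemma fibre_kernel a c : fibre a = c *: (1 : H) -> J (a - c *: (1 : A)).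
Proof.
have [s [-> Js]] := fibre_lift_exists a => sc.
apply: (fibre_eq_trans Js).
apply: (@fibre_lift_congr s (SCst c)); apply/pi_presentedP.
by rewrite [LHS]sc [RHS](pi_cst (@SUq2_rel R q)).
Qed.

Lemma coinvariant_trace_ideal b : coinvariants deltaR b -> J (b - eps b *: (1 : A)).
Proof. by move=> bB; apply: fibre_kernel; exact: fibre_coinvariant. Qed.

End Fibre.

(** * Corepresentations of SU_q(2) *)

Section LinearRelations.
Variables (C : nzRingType) (V : lmodType C).

(** Certificates: an identity is proved by writing its difference as a combination of known ones.
    Cofactors from the algebra are multiplied in beforehand by [congr1]. *)
Lemma eq_lin1 (k1 : C) (x1 y1 x y : V) : x1 = y1 -> x - y = k1 *: (x1 - y1) -> x = y.
Proof. by move=> -> ; rewrite subrr scaler0 => /eqP; rewrite subr_eq0 => /eqP. Qed.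

Lemma eq_lin2 (k1 k2 : C) (x1 y1 x2 y2 x y : V) : x1 = y1 -> x2 = y2 ->
  x - y = k1 *: (x1 - y1) + k2 *: (x2 - y2) -> x = y.
Proof.
by move=> -> ->; rewrite !subrr !scaler0 addr0 => /eqP; rewrite subr_eq0 => /eqP.
Qed.

Lemma eq_lin3 (k1 k2 k3 : C) (x1 y1 x2 y2 x3 y3 x y : V) : x1 = y1 -> x2 = y2 -> x3 = y3 ->
  x - y = k1 *: (x1 - y1) + k2 *: (x2 - y2) + k3 *: (x3 - y3) -> x = y.
Proof.
by move=> -> -> ->; rewrite !subrr !scaler0 !addr0 => /eqP; rewrite subr_eq0 => /eqP.
Qed.

Lemma eq_lin4 (k1 k2 k3 k4 : C) (x1 y1 x2 y2 x3 y3 x4 y4 x y : V) :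
  x1 = y1 -> x2 = y2 -> x3 = y3 -> x4 = y4 ->
  x - y = k1 *: (x1 - y1) + k2 *: (x2 - y2) + k3 *: (x3 - y3) + k4 *: (x4 - y4) ->
  x = y.
Proof.
by move=> -> -> -> ->; rewrite !subrr !scaler0 !addr0 => /eqP; rewrite subr_eq0 => /eqP.
Qed.

End LinearRelations.

(** Coefficients after multiplication by [Y]; the 0 stands for the coefficient of index -1. *)
Definition prev (V : nmodType) (s : nat -> V) (l : nat) : V :=
  if l is l'.+1 then s l' else 0.

Record SLq_family (C : numClosedFieldType) (H : starAlgType C) (q : C)
    (a b c d : H) : Prop := SLqFamily {
  SLq_ab : a * b = q *: (b * a);
  SLq_ac : a * c = q *: (c * a);
  SLq_bd : b * d = q *: (d * b);
  SLq_cd : c * d = q *: (d * c);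
  SLq_bc : b * c = c * b;
  SLq_ad : a * d = 1 + q *: (c * b);
  SLq_da : d * a = 1 + q^-1 *: (c * b)
}.

(* [corep n k l] is the coefficient of Y^l X^(n-l) in
   (c X + d Y)^k (a X + b Y)^(n-k), where X Y = q Y X. *)
Section Corepresentation.
Variables (C : numClosedFieldType) (H : starAlgType C) (q : C) (a b c d : H).

(** Left multiplication by [a X + b Y] on coefficients of [Y^l]; moving [X] past [Y^l] costs
    [q ^+ l]. Likewise [colY] for [c X + d Y]. *)
Definition colX (s : nat -> H) (l : nat) : H := q ^+ l *: (a * s l) + b * prev s l.
Definition colY (s : nat -> H) (l : nat) : H := q ^+ l *: (c * s l) + d * prev s l.

Definition corep (n k : nat) : nat -> H :=
  iter k colY (iter (n - k) colX (fun l => (l == 0)%:R)).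

Lemma corepY n k : corep n.+1 k.+1 = colY (corep n k).
Proof. by rewrite /corep subSS. Qed.

Lemma corep_pred n k : corep n k.+1 = colY (corep n.-1 k).
Proof. by rewrite /corep subnS predn_sub. Qed.

Lemma corepX0 n : corep n.+1 0 = colX (corep n 0).
Proof. by rewrite /corep !subn0. Qed.

Lemma corep0 n k l : (k <= n)%N -> (n < l)%N -> corep n k l = 0.
Proof.
rewrite /corep => kn.
have X m s : (forall l, (m < l)%N -> s l = 0) -> forall l, (m.+1 < l)%N -> colX s l = 0.
  by move=> s0 [//|l']; rewrite ltnS => ml; rewrite /colX /= !s0 // ?mulr0 ?scaler0 ?addr0 // ltnW.
have Y m s : (forall l, (m < l)%N -> s l = 0) -> forall l, (m.+1 < l)%N -> colY s l = 0.
  by move=> s0 [//|l']; rewrite ltnS => ml; rewrite /colY /= !s0 // ?mulr0 ?scaler0 ?addr0 // ltnW.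
have Xn m : forall l, (m < l)%N -> iter m colX (fun l => (l == 0)%:R) l = 0.
  by elim: m => [[]//|m IHm]; exact: X.
have {X Y Xn} : forall l, (k + (n - k) < l)%N ->
    iter k colY (iter (n - k) colX (fun l => (l == 0)%:R)) l = 0.
  elim: k {kn} (n - k)%N => [|k IHk] m; first exact: Xn.
  exact: (Y _ _ (IHk m)).
by rewrite subnKC //; apply.
Qed.

Hypothesis fam : SLq_family q a b c d.
Hypothesis q0 : q != 0.
Let ab := SLq_ab fam.
Let ac := SLq_ac fam.
Let bd := SLq_bd fam.
Let cd := SLq_cd fam.
Let bc := SLq_bc fam.
Let ad := SLq_ad fam.
Let da := SLq_da fam.

(** [a X + b Y] and [c X + d Y] again satisfy the relation of the quantum plane. *)
Lemma colXY s l : colX (colY s) l = q *: colY (colX s) l.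
Proof.
rewrite /colX /colY; case: l => [|l] /=.
  by rewrite !mulr0 !addr0 expr0 !scale1r !(mulE H) ac !(mulE H).
rewrite !(mulE H) !exprS ac bd ad bc da !(mulE H).
by linear_eq C H; field.
Qed.

Lemma colYZ e s l : colY (fun l => e *: s l) l = e *: colY s l.
Proof.
rewrite /colY; case: l => [|l] /=.
  by rewrite !mulr0 !addr0 !(mulE H) mulrC.
by rewrite !(mulE H) mulrC.
Qed.

(** A factor [a X + b Y] on the left is moved past [k] factors [c X + d Y]. *)
Lemma corepX n k l : (k <= n)%N -> colX (corep n k) l = q ^+ k *: corep n.+1 k l.
Proof.
move=> kn; rewrite /corep subSn //=.
elim: k {kn} (n - k)%N l => [|k IHk] m l /=; first by rewrite expr0 scale1r.
rewrite colXY exprS -scalerA; congr (_ *: _).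
rewrite -colYZ; congr (colY _ l); apply: funext => l'; exact: IHk.
Qed.

(* Up to normalization the q-integers [n - l] and [l]: cA n l = q^l (1 - q^(2(n-l))),
   without truncated subtraction. *)
Definition cA (n l : nat) : C := q ^+ l - q ^+ (2 * n) / q ^+ l.
Definition cB (k : nat) : C := 1 - q ^+ (2 * k).

(** Chain rule for the partial q-derivatives in [X] and [Y] under the change of variables: [cA] and
    [cB] are the factors produced by differentiating [Y^l X^(n-l)]. *)
Lemma corep_derivation n k : (k <= n)%N -> forall l,
  cA n l *: corep n k l = cA n k *: (a * corep n.-1 k l) + cB k *: (c * corep n.-1 k.-1 l)
  /\ cB l *: corep n k l =
     cA n k *: (b * prev (corep n.-1 k) l) + cB k *: (d * prev (corep n.-1 k.-1) l).
Proof.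
elim: n k => [|n IHn] k.
  rewrite leqn0 => /eqP -> l; rewrite /cA /cB !muln0 !expr0 divr1 subrr !scale0r addr0.
  by case: l => [|l]; split; rewrite /corep /= ?expr0 ?divr1 ?muln0 ?subrr ?scaler0 ?scale0r.
have e2 m : q ^+ (2 * m) = (q ^+ m) ^+ 2 by rewrite mulnC exprM.
case: k => [|k] kn l.
  pose v := corep n 0; pose v' := corep n.-1 0.
  have cB0 : cB 0 = 0 by rewrite /cB muln0 subrr.
  have E1 l' : cA n l' *: v l' = cA n 0 *: (a * v' l').
    by rewrite (IHn 0 (leq0n n) l').1 cB0 scale0r addr0.
  have E2 l' : cB l' *: v l' = cA n 0 *: (b * prev v' l').
    by rewrite (IHn 0 (leq0n n) l').2 cB0 scale0r addr0.
  rewrite corepX0 cB0 !scale0r !addr0 /= -/v.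
  case: l => [|l].
    by rewrite /colX /= !mulr0 !addr0 expr0 !scale1r cB0 scale0r scaler0.
  have {}E1 := E1 l; have {}E2 := E2 l.+1.
  rewrite /cA /cB /colX /= !e2 !exprS !expr0 in E1 E2 *.
  have Q0 : q ^+ l != 0 by rewrite expf_neq0.
  move: (q ^+ l) Q0 E1 E2 => Q Q0 E1 E2; split.
    (* The two hypotheses contribute [b a] and [a b] times the same coefficient of lower degree; the
       factors cancel these by [a b = q b a]. *)
    apply: (eq_lin2 (k1 := q) (k2 := -1) (congr1 (fun x => b * x) E1)
      (congr1 (fun x => a * x) E2)).
    by rewrite !(mulE H) ab !(mulE H); linear_eq C H; field; rewrite ?q0 ?Q0.
  apply: (eq_lin2 (k1 := - q ^+ 2 * Q) (k2 := q * Q) (congr1 (fun x => b * x) E1)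
      (congr1 (fun x => a * x) E2)).
  by rewrite !(mulE H) ab !(mulE H); linear_eq C H; field; rewrite ?q0 ?Q0.
pose v := corep n k; pose u := corep n.-1 k; pose w := corep n.-1 k.-1.
have E1 l' : cA n l' *: v l' = cA n k *: (a * u l') + cB k *: (c * w l').
  by rewrite (IHn k kn l').1.
have E2 l' : cB l' *: v l' = cA n k *: (b * prev u l') + cB k *: (d * prev w l').
  by rewrite (IHn k kn l').2.
(* For [k = 0] the index [k.-1] is meaningless, and both sides vanish with [cB q 0]. *)
have E3 l' : cB k *: v l' = cB k *: colY w l'.
  rewrite /v /w; case: (k) => [|k']; first by rewrite /cB muln0 subrr !scale0r.
  by rewrite corep_pred.
rewrite corepY /= corep_pred -/v -/u.
have K0 : q ^+ k != 0 by rewrite expf_neq0.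
case: l => [|l].
  have {}E1 := E1 0; have {}E3 := E3 0; rewrite /= !mulr0 !scaler0.
  rewrite /cA /cB /colY /= !mulr0 !addr0 !e2 !exprS !expr0 in E1 E3 *.
  move: (q ^+ k) K0 E1 E3 => K K0 E1 E3; split; last by rewrite !mulr1 subrr scale0r.
  apply: (eq_lin2 (k1 := q ^+ 2) (k2 := - q ^+ 2) (congr1 (fun x => c * x) E1)
      (congr1 (fun x => c * x) E3)).
  by rewrite !(mulE H) ac !(mulE H); linear_eq C H; field; rewrite ?q0 ?K0.
have E1' := E1 l.+1; have E2' := E2 l.+1; have E3' := E3 l.+1.
have {}E1 := E1 l; have {}E2 := E2 l; have {}E3 := E3 l.
rewrite /cA /cB /colY /= !e2 !exprS in E1 E2 E3 E1' E2' E3' *.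
have Q0 : q ^+ l != 0 by rewrite expf_neq0.
move: (q ^+ k) (q ^+ l) K0 Q0 E1 E2 E3 E1' E2' E3' => K Q K0 Q0 E1 E2 E3 E1' E2' E3'.
split.
  apply: (eq_lin4 (k1 := q ^+ 3 * Q) (k2 := q) (k3 := q ^+ 2 - 1) (k4 := - q ^+ 2)
    (congr1 (fun x => c * x) E1') (congr1 (fun x => d * x) E1)
    (congr1 (fun x => c * x) E2') (congr1 (fun x => c * x) E3')).
  by rewrite !(mulE H) ac ad da ?cd !(mulE H); linear_eq C H; field; rewrite ?q0 ?Q0 ?K0.
apply: (eq_lin3 (k1 := q * Q) (k2 := q ^+ 2) (k3 := - q ^+ 2)
    (congr1 (fun x => c * x) E2') (congr1 (fun x => d * x) E2)
    (congr1 (fun x => d * x) E3)).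
by rewrite !(mulE H) bd bc cd !(mulE H); linear_eq C H; field; rewrite ?q0 ?Q0 ?K0.
Qed.

(** For [X' = a X + b Y] and [Y' = c X + d Y] the determinant relations give [a Y' - q c X' = Y],
    and [b Y' - q d X' = - q X] for [corep_det2]. The remaining power of [q] comes from moving [X']
    past [Y'^m]. *)
Lemma corep_det1 n m l : (m <= n)%N ->
  a * corep n.+1 m.+1 l - q ^+ m.+1 *: (c * corep n.+1 m l) = prev (corep n m) l.
Proof.
move=> mn; rewrite corepY exprS -scalerA -scale_mulrr -corepX // /colX /colY.
rewrite !(mulE H) ac ad !(mulE H).
by linear_eq C H; ring.
Qed.

Lemma corep_det2 n m l : (m <= n)%N ->
  b * corep n.+1 m.+1 l - q ^+ m.+1 *: (d * corep n.+1 m l) = - q ^+ l.+1 *: corep n m l.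
Proof.
move=> mn; rewrite corepY [q ^+ m.+1]exprS -scalerA -scale_mulrr -corepX // /colX /colY.
rewrite !(mulE H) bd da bc !(mulE H) exprS.
by linear_eq C H; field.
Qed.

End Corepresentation.

(** * Decompositions of corepresentation matrices *)

Section Splitting.
Variables (C : numClosedFieldType) (H : starAlgType C).
Implicit Types I J : finType.

Definition intertwines_rows I J (Y : J -> I -> C) (t : I -> I -> H) (t' : J -> J -> H) :=
  forall m p, \sum_i Y m i *: t i p = \sum_j Y j p *: t' m j.

Definition intertwines_cols I J (X : I -> J -> C) (t : I -> I -> H) (t' : J -> J -> H) :=
  forall p m, \sum_i X i m *: t p i = \sum_j X p j *: t' j m.

(* [X1], [X2] are the inclusions and [Y1], [Y2] the projections of a decomposition
   of [t] into [t1] and [t2]. *)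
Record splitting I I1 I2 (X1 : I -> I1 -> C) (Y1 : I1 -> I -> C)
    (X2 : I -> I2 -> C) (Y2 : I2 -> I -> C) : Prop := Splitting {
  splitting1 : forall i j, \sum_m X1 i m * Y1 m j + \sum_m X2 i m * Y2 m j = (i == j)%:R;
  splitting11 : forall m m', \sum_i Y1 m i * X1 i m' = (m == m')%:R;
  splitting12 : forall m m', \sum_i Y1 m i * X2 i m' = 0;
  splitting21 : forall m m', \sum_i Y2 m i * X1 i m' = 0;
  splitting22 : forall m m', \sum_i Y2 m i * X2 i m' = (m == m')%:R
}.

Lemma sum_delta_scale (V : lmodType C) I (f : I -> V) i :
  \sum_j (i == j)%:R *: f j = f i.
Proof.
rewrite (bigD1 i) //= eqxx scale1r big1 ?addr0 // => j /negPf ji.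
by rewrite eq_sym ji scale0r.
Qed.

Section Splitting.
Variables (I I1 I2 : finType) (X1 : I -> I1 -> C) (Y1 : I1 -> I -> C).
Variables (X2 : I -> I2 -> C) (Y2 : I2 -> I -> C).
Hypothesis XY : splitting X1 Y1 X2 Y2.
Variables (t : I -> I -> H) (t1 : I1 -> I1 -> H) (t2 : I2 -> I2 -> H).
Hypothesis Y1t : intertwines_rows Y1 t t1.
Hypothesis Y2t : intertwines_rows Y2 t t2.

Lemma splitting_decomposition p p' : t p p' =
  \sum_m \sum_m' (X1 p m * Y1 m' p') *: t1 m m' +
  \sum_m \sum_m' (X2 p m * Y2 m' p') *: t2 m m'.
Proof.
rewrite -(sum_delta_scale (fun i => t i p') p).
under eq_bigr do rewrite -(splitting1 XY) scalerDl !scaler_suml.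
rewrite big_split /=; congr (_ + _); rewrite exchange_big /=; apply: eq_bigr => m _.
- under eq_bigr do rewrite -scalerA.
  rewrite -scaler_sumr Y1t scaler_sumr; apply: eq_bigr => m' _.
  by rewrite scalerA.
- under eq_bigr do rewrite -scalerA.
  rewrite -scaler_sumr Y2t scaler_sumr; apply: eq_bigr => m' _.
  by rewrite scalerA.
Qed.

Lemma sum_block J K (Z : I -> K -> C) (W : J -> I -> C) (s : J -> J -> H) (X : I -> J -> C)
    (Q : J -> K -> C) p m :
  (forall j, \sum_i W j i * Z i m = Q j m) ->
  \sum_i Z i m *: (\sum_j \sum_j' (X p j * W j' i) *: s j j') =
  \sum_j \sum_j' (X p j * Q j' m) *: s j j'.
Proof.
move=> WZ; under eq_bigr do rewrite scaler_sumr.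
rewrite exchange_big /=; apply: eq_bigr => j _.
under eq_bigr do rewrite scaler_sumr.
rewrite exchange_big /=; apply: eq_bigr => j' _.
under eq_bigr do rewrite scalerA.
rewrite -scaler_suml -WZ mulr_sumr; congr (_ *: _); apply: eq_bigr => i _.
by rewrite [LHS]mulrC -mulrA.
Qed.

(** That the inclusions intertwine follows from the same fact for the projections, through the block
    decomposition of [t]. *)
Lemma splitting_cols1 : intertwines_cols X1 t t1.
Proof.
move=> p m; under eq_bigr do rewrite splitting_decomposition scalerDr.
rewrite big_split /=.
apply: (eq_trans (congr2 +%R
  (sum_block (Z := X1) (Q := (fun j m => (j == m)%:R)) t1 X1 p
    (fun j => splitting11 XY j m))
  (sum_block (Z := X1) (Q := (fun _ _ => 0)) t2 X2 p
    (fun j => splitting21 XY j m)))).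
rewrite [X in _ + X]big1 ?addr0 => [|j _]; last first.
  by rewrite big1 // => j' _; rewrite mulr0 scale0r.
apply: eq_bigr => j _.
rewrite -(sum_delta_scale (fun j' => X1 p j *: t1 j j') m).
by apply: eq_bigr => j' _; rewrite scalerA mulrC eq_sym.
Qed.

Lemma splitting_cols2 : intertwines_cols X2 t t2.
Proof.
move=> p m; under eq_bigr do rewrite splitting_decomposition scalerDr.
rewrite big_split /=.
apply: (eq_trans (congr2 +%R
  (sum_block (Z := X2) (Q := (fun _ _ => 0)) t1 X1 p
    (fun j => splitting12 XY j m))
  (sum_block (Z := X2) (Q := (fun j m => (j == m)%:R)) t2 X2 p
    (fun j => splitting22 XY j m)))).
rewrite [X in X + _]big1 ?add0r => [|j _]; last first.
  by rewrite big1 // => j' _; rewrite mulr0 scale0r.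
apply: eq_bigr => j _.
rewrite -(sum_delta_scale (fun j' => X2 p j *: t2 j j') m).
by apply: eq_bigr => j' _; rewrite scalerA mulrC eq_sym.
Qed.

End Splitting.

End Splitting.

(** * Sums against Kronecker deltas *)

Section DeltaSums.
Variables (C : nzRingType) (V : lmodType C).

Lemma sum_ord_delta n (f : nat -> V) (m : nat) :
  \sum_(l < n) (m == l :> nat)%:R *: f l = (m < n)%:R *: f m.
Proof.
have [mn|nm] := ltnP m n.
  rewrite (bigD1 (Ordinal mn)) //= eqxx big1 ?addr0 // => l lm.
  by rewrite (_ : (m == l :> nat) = false) ?scale0r // eq_sym; exact: negPf lm.
rewrite scale0r big1 // => l _; rewrite gtn_eqF ?scale0r //.
exact: leq_trans (ltn_ord l) nm.
Qed.

Lemma sum_ord_deltaS n (f : nat -> V) (m : nat) :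
  \sum_(l < n) (m == l.+1 :> nat)%:R *: f l = (0 < m <= n)%:R *: f m.-1.
Proof.
case: m => [|m]; last exact: sum_ord_delta.
by rewrite scale0r big1 // => l _; rewrite scale0r.
Qed.

Lemma sum_ord_delta_sym n (f : nat -> V) (m : nat) :
  \sum_(l < n) (l == m :> nat)%:R *: f l = (m < n)%:R *: f m.
Proof. by rewrite -sum_ord_delta; apply: eq_bigr => l _; rewrite eq_sym. Qed.

End DeltaSums.

Lemma sum_ord2_pair (V : nmodType) n (F : 'I_2 * 'I_n -> V) :
  \sum_p F p = \sum_(l < n) F (ord0, l) + \sum_(l < n) F (ord_max, l).
Proof.
rewrite (eq_bigr (fun p => F (p.1, p.2))) => [|[] //].
rewrite -(pair_bigA _ (fun i j => F (i, j))) /= big_ord_recl big_ord1.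
by rewrite (_ : lift ord0 ord0 = ord_max) //; exact: val_inj.
Qed.

Lemma sum_ord_single (C : nzRingType) N (F : nat -> C) k :
  (forall m, m != k -> F m = 0) -> \sum_(m < N) F m = (k < N)%:R * F k.
Proof.
move=> F0; have [kN|Nk] := ltnP k N.
  by rewrite (bigD1 (Ordinal kN)) //= mul1r big1 ?addr0 // => m /F0.
rewrite mul0r big1 // => m _; apply: F0; rewrite neq_ltn.
by rewrite (leq_trans (ltn_ord m)).
Qed.

(** * Clebsch-Gordan decomposition of V_1 (x) V_n *)

Section ClebschGordan.
Variables (C : numClosedFieldType) (H : starAlgType C) (q : C) (a b c d : H).
Hypothesis fam : SLq_family q a b c d.
Hypothesis q0 : q != 0.
Variable n : nat.
Hypothesis D0 : cB q n.+1 != 0.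
Local Notation D := (cB q n.+1).
Local Notation w := (corep q a b c d).

Definition matT (i j : 'I_2) : H := nth 0 (nth [::] [:: [:: a; b]; [:: c; d]] i) j.

(** Indexed by the dimension: [corep_mx] at 0 is the zero corepresentation, so the splitting
    includes that of V_1 (x) V_0. *)
Definition corep_mx m (i j : 'I_m) : H := w m.-1 i j.

Definition tensor_mx m (p p' : 'I_2 * 'I_m) : H :=
  matT p.1 p'.1 * corep_mx p.2 p'.2.

(* A basis vector e_i (x) e_k of V_1 (x) V_n has weight i + k; in each weight the
   change of basis is a 2 x 2 matrix. *)
Definition cg_weight m (p : 'I_2 * 'I_m) : nat := p.1 + p.2.

(** In weight [s], the rows [cg_y1] come from the q-derivatives and the rows [cg_y2] from the
    determinant identities. The columns [cg_x1] and [cg_x2] form the inverse matrix, by the identity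
    [cA_cB]. *)
Definition cg_x1 (i : 'I_2) s : C := if i == 0 :> nat then q ^+ s else 1.
Definition cg_y1 (i : 'I_2) s : C := (if i == 0 :> nat then cA q n.+1 s else cB q s) / D.
Definition cg_x2 (i : 'I_2) s : C := (if i == 0 :> nat then cB q s else - cA q n.+1 s) / D.
Definition cg_y2 (i : 'I_2) s : C := if i == 0 :> nat then 1 else - q ^+ s.

Definition cgX1 (p : 'I_2 * 'I_n.+1) (m : 'I_n.+2) : C :=
  (m == cg_weight p :> nat)%:R * cg_x1 p.1 m.
Definition cgY1 (m : 'I_n.+2) (p : 'I_2 * 'I_n.+1) : C :=
  (m == cg_weight p :> nat)%:R * cg_y1 p.1 m.
(** The shift [m.+1] is there because the smaller summand occupies the weights 1 to [n]. *)
Definition cgX2 (p : 'I_2 * 'I_n.+1) (m : 'I_n) : C :=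
  (m.+1 == cg_weight p :> nat)%:R * cg_x2 p.1 m.+1.
Definition cgY2 (m : 'I_n) (p : 'I_2 * 'I_n.+1) : C :=
  (m.+1 == cg_weight p :> nat)%:R * cg_y2 p.1 m.+1.

Lemma cA_cB m : (m <= n.+1)%N -> q ^+ m * cA q n.+1 m + cB q m = D.
Proof.
move=> mn; rewrite /cA /cB mulrBr mulrCA mulfV ?expf_neq0 // mulr1.
by rewrite (_ : q ^+ (2 * m) = q ^+ m ^+ 2) 1?mulnC ?exprM //; ring.
Qed.

Let cA0 : cA q n.+1 n.+1 = 0.
Proof. by rewrite /cA mul2n -addnn exprD mulfK ?subrr ?expf_neq0. Qed.

Let cB0 : cB q 0 = 0.
Proof. by rewrite /cB muln0 subrr. Qed.

Lemma cg_weight_sum (V : lmodType C) (f : 'I_2 -> nat -> V) s :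
  \sum_(p : 'I_2 * 'I_n.+1) (s == cg_weight p :> nat)%:R *: f p.1 p.2 =
  (s <= n)%:R *: f ord0 s + (0 < s <= n.+1)%:R *: f ord_max s.-1.
Proof.
rewrite sum_ord2_pair /cg_weight /=; congr (_ + _).
  exact: (sum_ord_delta _ (f ord0)).
exact: (sum_ord_deltaS _ (f ord_max)).
Qed.

(** The chain rule [corep_derivation] in matrix form. *)
Lemma cg_rows1 : intertwines_rows cgY1 (@tensor_mx n.+1) (@corep_mx n.+2).
Proof.
move=> m [j l]; rewrite /tensor_mx /corep_mx /cgY1 /=.
have mn : (m <= n.+1)%N by rewrite -ltnS.
under eq_bigr do rewrite -scalerA.
rewrite (cg_weight_sum (fun i k => cg_y1 i m *: (matT i j * w n k l)) m) /cg_y1 /=.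
(* In the extreme weights only one basis vector exists; the missing one is masked by [cA] vanishing
   at [n.+1] and, in the next step, by [cB] vanishing at 0. *)
have -> : (m <= n)%:R *: ((cA q n.+1 m / D) *: (matT ord0 j * w n m l)) =
    (cA q n.+1 m / D) *: (matT ord0 j * w n m l).
  move: mn; rewrite leq_eqVlt => /predU1P[->|]; last by rewrite ltnS => ->; rewrite scale1r.
  by rewrite cA0 mul0r !scale0r scaler0.
have -> : (0 < m <= n.+1)%:R *: ((cB q m / D) *: (matT ord_max j * w n m.-1 l)) =
    (cB q m / D) *: (matT ord_max j * w n m.-1 l).
  by case: (m : nat) mn => [_|m' ->]; rewrite ?cB0 ?mul0r ?scale0r ?scaler0 ?scale1r.
under [RHS]eq_bigr do rewrite -scalerA.
have ln : (l < n.+2)%N by exact: leqW (ltn_ord l).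
have sl : \sum_(k < n.+2) (k == (j + l)%N :> nat)%:R *: (cg_y1 j k *: w n.+1 m k) =
    cg_y1 j (j + l)%N *: w n.+1 m (j + l)%N.
  rewrite (sum_ord_delta_sym _ (fun k => cg_y1 j k *: w n.+1 m k)).
  case: j => [[|[|//]] /= ?]; last by rewrite add1n ltnS ltn_ord scale1r.
  by rewrite add0n ln scale1r.
rewrite [RHS]sl /cg_y1 {sl}.
rewrite [cA _ _ m / D]mulrC [cB _ m / D]mulrC -!scalerA -scalerDr.
case: j => [[|[|//]] /= ?]; rewrite /matT /= [RHS]scalerA [_ * D^-1]mulrC -[RHS]scalerA; congr (_ *: _).
- by have [/= <- _] := corep_derivation fam q0 mn l.
- by have [_ /= <-] := corep_derivation fam q0 mn l.+1.
Qed.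

(** The identities [corep_det1] and [corep_det2] in matrix form. *)
Lemma cg_rows2 : intertwines_rows cgY2 (@tensor_mx n.+1) (@corep_mx n).
Proof.
move=> m [j l]; rewrite /tensor_mx /corep_mx /cgY2 /=.
have [n' nE] : exists n', n = n'.+1 by case: (n) m => [[]//|n' _]; exists n'.
have mn : (m <= n')%N by rewrite -ltnS -nE.
have nE' : n.-1 = n' by rewrite nE.
under eq_bigr do rewrite -scalerA.
rewrite (cg_weight_sum (fun i k => cg_y2 i m.+1 *: (matT i j * w n k l)) m.+1).
rewrite (ltn_ord m) (_ : (0 < m.+1 <= n.+1)%N) ?ltnS ?(ltnW (ltn_ord m)) //.
rewrite !scale1r /cg_y2 /= ?scale1r scaleNr.
have det1 := corep_det1 fam q0 l mn; have det2 := corep_det2 fam q0 l mn.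
rewrite -nE in det1 det2; rewrite nE'.
under [RHS]eq_bigr do rewrite -scalerA.
case: j => [[|[|//]] /= ?]; rewrite /matT /cg_weight /=.
- rewrite det1 add0n {det1 det2}.
  case: l => -[|l] /= ln.
    by rewrite big1 // => k _; rewrite scale0r.
  rewrite (eq_bigr (fun k : 'I_n => (l == k :> nat)%:R *: w n' m k)) => [|k _].
    by rewrite (sum_ord_delta _ (w n' m)) -ltnS ln scale1r.
  by rewrite eqSS eq_sym ?scale1r.
- rewrite det2 {det1 det2}.
  rewrite (eq_bigr (fun k : 'I_n => (l == k :> nat)%:R *: (- q ^+ k.+1 *: w n' m k))) => [|k _].
    rewrite (sum_ord_delta _ (fun k => - q ^+ k.+1 *: w n' m k)).
    case: ltnP => [_|nl]; rewrite ?scale1r // scale0r corep0 ?scaler0 //.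
    by rewrite -nE.
  by rewrite eqSS eq_sym.
Qed.

Lemma cg_splitting : splitting cgX1 cgY1 cgX2 cgY2.
Proof.
have DD : D / D = 1 by rewrite mulfV.
have weightsum (f : 'I_2 -> C) (s : nat) (s' : bool) :
    \sum_(p : 'I_2 * 'I_n.+1) (s == cg_weight p :> nat)%:R * (s'%:R * f p.1) =
    s'%:R * ((s <= n)%:R * f ord0 + (0 < s <= n.+1)%:R * f ord_max).
  rewrite (@cg_weight_sum C^o (fun i k => s'%:R * f i) s) mulrDr.
  by congr (_ + _); rewrite mulrCA.
have ABD s : (s <= n.+1)%N -> (q ^+ s * cA q n.+1 s + cB q s) / D = 1.
  by move=> sn; rewrite cA_cB.
have end0 (x : C) s : (s <= n.+1)%N ->
    (s <= n)%:R * (cA q n.+1 s / D * x) = cA q n.+1 s / D * x.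
  rewrite leq_eqVlt => /predU1P[->|]; last by rewrite ltnS => ->; rewrite mul1r.
  by rewrite cA0 !mul0r mulr0.
have end1 (x : C) s : (s <= n.+1)%N ->
    (0 < s <= n.+1)%:R * (cB q s / D * x) = cB q s / D * x.
  by case: s => [_|s ->]; rewrite ?cB0 ?mul0r ?mul1r.
(* Matrices that preserve the weight pair only equal weights, and then the sum has at most two
   terms. *)
have blk (f g : 'I_2 -> C) (s s' : nat) :
    \sum_(p : 'I_2 * 'I_n.+1) ((s == cg_weight p)%:R * f p.1) *
      ((s' == cg_weight p)%:R * g p.1) =
    (s == s')%:R * ((s <= n)%:R * (f ord0 * g ord0) +
      (0 < s <= n.+1)%:R * (f ord_max * g ord_max)).
  rewrite -(weightsum (fun i => f i * g i)); apply: eq_bigr => p _; rewrite -mulrA.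
  case: (eqVneq s (cg_weight p)) => [<-|_]; last by rewrite !mul0r.
  by rewrite [s' == s]eq_sym !mul1r mulrCA.
split.
- move=> p p'; have pn : (cg_weight p <= n.+1)%N.
    by case: p => i k; apply: (@leq_add _ _ 1 n); rewrite -ltnS ltn_ord.
  set s := cg_weight p; set s' := cg_weight p'.
  have -> : (p == p') = (s == s') && (p.1 == p'.1).
    rewrite /s /s' /cg_weight; case: (p) (p') => i k [j l] /=; rewrite xpair_eqE.
    case: (eqVneq i j) => [->|]; rewrite ?andbF ?andbT //=.
    by rewrite eqn_add2l.
  rewrite -mulnb natrM.
  have -> : \sum_m cgX1 p m * cgY1 m p' = (s == s')%:R * (cg_x1 p.1 s * cg_y1 p'.1 s).
    rewrite /cgX1 /cgY1 -/s -/s'.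
    rewrite (@sum_ord_single _ _ (fun m => (m == s)%:R * cg_x1 p.1 m *
      ((m == s')%:R * cg_y1 p'.1 m)) s) => [|m /negPf ->]; last by rewrite !mul0r.
    by rewrite eqxx ltnS pn !mul1r mulrCA.
  have -> : \sum_m cgX2 p m * cgY2 m p' = (s == s')%:R * (cg_x2 p.1 s * cg_y2 p'.1 s).
    rewrite /cgX2 /cgY2 -/s -/s'.
    have [s0|s0] := posnP s.
      rewrite big1 => [|m _]; last by rewrite s0 !mul0r.
      have -> : cg_x2 p.1 s = 0; last by rewrite mul0r mulr0.
      rewrite /cg_x2 s0; case: ifP => [|/eqP]; first by rewrite cB0 mul0r.
      by move: s0; rewrite /s /cg_weight; case: (p.1 : nat).
    rewrite (@sum_ord_single _ _ (fun m => (m.+1 == s)%:R * cg_x2 p.1 m.+1 *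
      ((m.+1 == s')%:R * cg_y2 p'.1 m.+1)) s.-1) => [|m ms]; last first.
      by rewrite (_ : (m.+1 == s) = false) ?mul0r // -(prednK s0) eqSS (negPf ms).
    rewrite prednK // eqxx mul1r [cg_x2 _ _ * _]mulrCA.
    move: (pn); rewrite leq_eqVlt => /predU1P[sn|]; last by rewrite ltnS => ->; rewrite mul1r.
    have -> : cg_x2 p.1 s = 0; last by rewrite mul0r !mulr0.
    rewrite /cg_x2 (sn : s = n.+1); case: ifP => [/eqP p0|]; last by rewrite cA0 oppr0 mul0r.
    by move: sn (ltn_ord p.2); rewrite /cg_weight p0 add0n => ->; rewrite ltnn.
  rewrite -mulrDr; case: (s == s'); rewrite ?mul0r // !mul1r /cg_x1 /cg_x2 /cg_y1 /cg_y2.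
  have := ABD s pn; rewrite mulrDl => sABD.
  case: p.1 p'.1 => [[|[|//]] /= ?] [[|[|//]] /= ?].
  + by rewrite -[RHS]sABD; field.
  + by field.
  + by field.
  + by rewrite -[RHS]sABD; field.
- move=> m m'; have mn : (m <= n.+1)%N by rewrite -ltnS.
  rewrite (blk (cg_y1^~ m) (cg_x1^~ m')) -val_eqE /=.
  case: eqP => [<-|_]; rewrite ?mul0r // mul1r /cg_y1 /cg_x1 /= end0 // end1 //.
  by rewrite -[RHS](ABD m mn); field.
- move=> m m'; have mn : (m <= n.+1)%N by rewrite -ltnS.
  rewrite (blk (cg_y1^~ m) (cg_x2^~ m'.+1)).
  case: eqP => [<-|_]; rewrite ?mul0r // mul1r /cg_y1 /cg_x2 /= end0 // end1 //.
  by field.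
- move=> m m'.
  rewrite (blk (cg_y2^~ m.+1) (cg_x1^~ m')).
  case: eqP => [<-|_]; rewrite ?mul0r // mul1r /cg_y2 /cg_x1 /= (ltn_ord m).
  by rewrite ltnW ?ltnS ?ltn_ord // !mul1r mulr1 subrr.
- move=> m m'.
  rewrite (blk (cg_y2^~ m.+1) (cg_x2^~ m'.+1)) -val_eqE eqSS /=.
  case: eqP => [<-|_]; rewrite ?mul0r // mul1r /cg_y2 /cg_x2 /= (ltn_ord m).
  have mn : (m.+1 <= n.+1)%N by rewrite ltnW ?ltnS ?ltn_ord.
  by rewrite mn !mul1r -[RHS](ABD m.+1 mn); field.
Qed.

End ClebschGordan.

(** * Coproduct and counit on the explicit corepresentations *)

Section SUq2.
Variables (R : realType) (q0 : R) (q01 : 0 < q0 < 1).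
Local Notation C := R[i].
Local Notation q := (q0%:C%C).
Local Notation H := (O_SUq2 q0).
Local Notation rel := (@SUq2_rel R q0).
Local Notation alpha := (presented_gen rel Alpha : H).
Local Notation gamma := (presented_gen rel Gamma : H).
Local Notation T := (SUq2_T q0).

Lemma qC_neq0 : q != 0.
Proof. by case/andP: q01 => q0' _; rewrite (inj_eq (@complexI R)) gt_eqF. Qed.

Lemma SUq2_T_mat i j : T i j = matT alpha (- q *: gamma^*s) gamma alpha^*s i j.
Proof. exact: SUq2_TE. Qed.

Lemma SUq2_TT i k : T i ord0 * (T k ord0)^*s + T i ord_max * (T k ord_max)^*s =
  (i == k)%:R *: (1 : H).
Proof.
have := presented_rel (@SUq2_TTstar R q0 i k).
by rewrite !(piE rel) !mxE.
Qed.

Lemma SUq2_TT' i k : (T ord0 i)^*s * T ord0 k + (T ord_max i)^*s * T ord_max k =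
  (i == k)%:R *: (1 : H).
Proof.
have := presented_rel (@SUq2_TstarT R q0 i k).
by rewrite !(piE rel) !mxE.
Qed.

(** Each relation is a multiple of one entry of the unitarity relations, except [b c = c b], which
    combines two diagonal entries. *)
Lemma SUq2_family : SLq_family q alpha (- q *: gamma^*s) gamma alpha^*s.
Proof.
have qN0 := qC_neq0.
have conj_q : q^* = q by exact: conj_real.
have conj_Nq : (- q)^* = - q by rewrite rmorphN /= conj_q.
have E := (mulE H, starE H, conj_Nq, conj_q, @scale1r C H, @scale0r C H).
have TT i k := SUq2_TT i k; have TT' i k := SUq2_TT' i k.
have h01 := TT ord0 ord_max; have h10 := TT ord_max ord0.
have h11 := TT ord_max ord_max; have k00 := TT' ord0 ord0.
have k01 := TT' ord0 ord_max; have k10 := TT' ord_max ord0; have k11 := TT' ord_max ord_max.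
move: h01 h10 h11 k00 k01 k10 k11; rewrite !SUq2_T_mat /matT /= !E.
move: alpha gamma => a c h01 h10 h11 k00 k01 k10 k11.
have lin1 := @eq_lin1 C H; have lin2 := @eq_lin2 C H.
split.
- by apply: (lin1 (- q) _ _ _ _ h01); rewrite !E; linear_eq R[i] (O_SUq2 q0); ring.
- by apply: (lin1 1 _ _ _ _ k10); rewrite ?E; linear_eq R[i] (O_SUq2 q0); ring.
- by apply: (lin1 (- q) _ _ _ _ k01); rewrite !E; linear_eq R[i] (O_SUq2 q0); ring.
- by apply: (lin1 1 _ _ _ _ h10); rewrite ?E; linear_eq R[i] (O_SUq2 q0); ring.
- by apply: (lin2 (- q) q _ _ _ _ _ _ k00 h11); rewrite !E; linear_eq R[i] (O_SUq2 q0); ring.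
- by apply: (lin1 1 _ _ _ _ k11); rewrite !E; linear_eq R[i] (O_SUq2 q0); ring.
- by apply: (lin1 1 _ _ _ _ h11); rewrite !E; linear_eq R[i] (O_SUq2 q0); field.
Qed.

Local Notation w := (corep q alpha (- q *: gamma^*s) gamma alpha^*s).

Section Coproduct.
Variables (Delta : H -> tensor H H) (DeltaP : is_SUq2_coproduct Delta).
Let Delta_hom := proj1 DeltaP.

Lemma Delta_T i j : Delta (T i j) =
  tens (T i ord0) (T ord0 j) + tens (T i ord_max) (T ord_max j).
Proof.
rewrite (proj2 DeltaP) big_ord_recl big_ord1.
by rewrite (_ : lift ord0 ord0 = ord_max) //; exact: val_inj.
Qed.

(** Treats [colX] and [colY] together, as multiplication by row [i] of [T]. On the second leg
    [corepX] and [corepY] recombine the terms; [s n.+1 = 0] discards the last one. *)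
Lemma Delta_col (n : nat) (s : nat -> H) i : s n.+1 = 0 ->
  (forall l, Delta (s l) = \sum_(m < n.+1) tens (s m) (w n m l)) ->
  forall l, Delta (q ^+ l *: (T i ord0 * s l) + T i ord_max * prev s l) =
    \sum_(m < n.+2) tens (q ^+ m *: (T i ord0 * s m) + T i ord_max * prev s m) (w n.+1 m l).
Proof.
move=> sn Ds l.
have Dp : Delta (prev s l) = \sum_(m < n.+1) tens (s m) (prev (w n m) l).
  case: l => [|l] /=; last exact: Ds.
  by rewrite (star_hom0 Delta_hom) big1 // => m _; rewrite tens0r.
rewrite (star_homD Delta_hom) (star_homZ Delta_hom) !(star_homM Delta_hom) !Delta_T Ds Dp.
have expand (x y x' y' : H) (u v : nat -> H) :
    ((tens x x' : (tensor H H : starAlgType C)) + tens y y') *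
      \sum_(m < n.+1) tens (u m) (v m) =
    \sum_(m < n.+1) (tens (x * u m) (x' * v m) + tens (y * u m) (y' * v m)).
  by rewrite mulr_sumr; apply: eq_bigr => m _; rewrite mulrDl !tens_mul.
rewrite (expand _ _ _ _ s (fun m => w n m l)) (expand _ _ _ _ s (fun m => prev (w n m) l)).
rewrite scaler_sumr -big_split /=.
transitivity (\sum_(m < n.+1) (q ^+ m *: tens (T i ord0 * s m) (w n.+1 m l) +
    tens (T i ord_max * s m) (w n.+1 m.+1 l))).
  apply: eq_bigr => m _.
  have mn : (m <= n)%N by rewrite -ltnS.
  rewrite -tensZr -(corepX SUq2_family qC_neq0) // corepY /colX /colY !tensDr.
  rewrite scalerDr -!tensZr addrACA !SUq2_T_mat /matT /=.
  by rewrite addrACA.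
rewrite [RHS](eq_bigr (fun m : 'I_n.+2 => q ^+ m *: tens (T i ord0 * s m) (w n.+1 m l) +
  tens (T i ord_max * prev s m) (w n.+1 m l))) => [|m _]; last first.
  by rewrite tensDl tensZl.
rewrite !big_split /=; congr (_ + _).
  by rewrite [RHS]big_ord_recr /= sn mulr0 tens0l scaler0 addr0.
by rewrite [RHS]big_ord_recl /= mulr0 tens0l add0r.
Qed.

Lemma Delta_corep n k l : (k <= n)%N ->
  Delta (w n k l) = \sum_(m < n.+1) tens (w n k m) (w n m l).
Proof.
elim: n k l => [|n IHn] k l.
  rewrite leqn0 => /eqP ->; rewrite big_ord1 /=; case: l => [|l] /=.
    by rewrite (star_hom1 Delta_hom).
  by rewrite (star_hom0 Delta_hom) tens0r.
have TX s l' : colX q alpha (- q *: gamma^*s) s l' =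
    q ^+ l' *: (T ord0 ord0 * s l') + T ord0 ord_max * prev s l'.
  by rewrite !SUq2_T_mat.
have TY s l' : colY q gamma alpha^*s s l' =
    q ^+ l' *: (T ord_max ord0 * s l') + T ord_max ord_max * prev s l'.
  by rewrite !SUq2_T_mat.
case: k => [_|k kn].
  rewrite corepX0 TX (@Delta_col n) //; last by move=> l'; exact: IHn.
    by apply: eq_bigr => m _; rewrite -TX.
  exact: corep0.
rewrite corepY TY (@Delta_col n) //; last by move=> l'; exact: IHn.
  by apply: eq_bigr => m _; rewrite -TY.
exact: corep0.
Qed.

End Coproduct.

Lemma counit_corep counit (counitP : is_SUq2_counit counit) n k l : (k <= n)%N ->
  counit (w n k l) = (k == l)%:R.
Proof.
have [chom cT] := counitP.
have ca : counit alpha = 1 by have := cT ord0 ord0; rewrite SUq2_T_mat.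
have cb : counit (- q *: gamma^*s) = 0 by have := cT ord0 ord_max; rewrite SUq2_T_mat.
have cc : counit gamma = 0 by have := cT ord_max ord0; rewrite SUq2_T_mat.
have cd : counit alpha^*s = 1 by have := cT ord_max ord_max; rewrite SUq2_T_mat.
elim: n k l => [|n IHn] k l.
  rewrite leqn0 => /eqP ->; case: l => [|l] /=; first exact: (star_hom1 chom).
  exact: (star_hom0 chom).
have E := (star_homD chom, star_homM chom, ca, cb, cc, cd, mul0r, mul1r, addr0, add0r).
case: k => [_|k kn].
  rewrite corepX0 /colX (star_homD chom) (star_homZ chom) !E IHn //.
  by case: l => [|l]; [rewrite expr0 scale1r|rewrite scaler0].
rewrite corepY /colY (star_homD chom) (star_homZ chom) !E scaler0 add0r.
by case: l => [|l] /=; [exact: (star_hom0 chom)|rewrite IHn].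
Qed.

End SUq2.

(** * Irreducible comodules *)

Section LadderFunctional.
Variables (R : realType) (q0 : R) (q01 : 0 < q0 < 1).
Local Notation C := R[i].
Local Notation q := (q0%:C%C).
Local Notation H := (O_SUq2 q0).
Local Notation rel := (@SUq2_rel R q0).
Local Notation alpha := (presented_gen rel Alpha : H).
Local Notation gamma := (presented_gen rel Gamma : H).
Local Notation w := (corep q alpha (- q *: gamma^*s) gamma alpha^*s).
Local Notation M := 'M[C]_2.
Variables (x y : C).

(** A morphism into upper triangular matrices has characters on the diagonal and a twisted
    derivation in the corner. The latter plays the part of a generator E or F of U_q(sl_2); [x] and
    [y] are its values on [gamma] and [gamma^*s]. *)
Definition mx2 (a b d : C) : M := \matrix_(i, j) nth 0 (nth [::] [:: [:: a; b]; [:: 0; d]] i) j.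

Lemma mx2M a b d a' b' d' : mx2 a b d *m mx2 a' b' d' = mx2 (a * a') (a * b' + b * d') (d * d').
Proof.
apply/matrixP => -[[|[|//]] i] [[|[|//]] j]; rewrite !mxE !big_ord_recl big_ord0 !mxE /=;
  by rewrite ?mul0r ?mulr0 ?addr0 ?add0r.
Qed.

Lemma mx2D a b d a' b' d' : mx2 a b d + mx2 a' b' d' = mx2 (a + a') (b + b') (d + d').
Proof. by apply/matrixP => -[[|[|//]] i] [[|[|//]] j]; rewrite !mxE /= ?addr0. Qed.

Lemma mx2_scalar a : a%:M = mx2 a 0 a.
Proof. by apply/matrixP => -[[|[|//]] i] [[|[|//]] j]; rewrite !mxE /= ?mulr1n ?mulr0n. Qed.

(* The morphism does not respect the star, hence the value at a term is carried
   along with the value at its star. *)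
Fixpoint ladder_term (s : sterm C SUq2_gen) : M * M :=
  match s with
  | SGen Alpha => (mx2 q 0 1, mx2 q^-1 0 1)
  | SGen Gamma => (mx2 0 x 0, mx2 0 y 0)
  | SCst c => (c%:M, (c^*)%:M)
  | SAdd s t => ((ladder_term s).1 + (ladder_term t).1, (ladder_term s).2 + (ladder_term t).2)
  | SMul s t => ((ladder_term s).1 *m (ladder_term t).1, (ladder_term t).2 *m (ladder_term s).2)
  | SStar s => ((ladder_term s).2, (ladder_term s).1)
  end.

Lemma ladder_term_rel s t : rel s t -> ladder_term s = ladder_term t.
Proof.
have qN0 := qC_neq0 q01.
have conj_Nq : (- q)^* = - q by rewrite rmorphN /= conj_real.
case=> -[[|[|//]] /= i0] [[|[|//]] /= k0]; congr (_, _); rewrite !(mx2_scalar, mx2M, mx2D).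
all: by rewrite ?conj_Nq ?(conjC1, conjC0); congr mx2; field.
Qed.

Lemma ladder_term_congr s t : scongr rel s t -> ladder_term s = ladder_term t.
Proof.
elim=> {s t} /=.
- exact: ladder_term_rel.
- by [].
- by move=> s t _ ->.
- by move=> s t u _ -> _ ->.
- by move=> s s' t t' _ -> _ ->.
- by move=> s s' t t' _ -> _ ->.
- by move=> s s' _ ->.
- by move=> s t u; rewrite !addrA.
- by move=> s t; congr (_, _); rewrite addrC.
- by move=> s; rewrite conjC0 raddf0 !add0r; case: ladder_term.
- have conj_N1 : (-1 : C)^* = -1 by rewrite rmorphN /= conjC1.
  move=> s; rewrite conj_N1 conjC0 !raddfN /= mulNmx mul1mx mulmx1 !addNr.
  by rewrite raddf0.
- by move=> s t u; rewrite !mulmxA.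
- by move=> s; rewrite conjC1 mul1mx mulmx1; case: ladder_term.
- by move=> s; rewrite conjC1 mul1mx mulmx1; case: ladder_term.
- by move=> s t u; rewrite mulmxDl mulmxDr.
- by move=> s t u; rewrite mulmxDl mulmxDr.
- by move=> a b; rewrite !raddfD.
- move=> a b; congr (_, _); first exact: scalar_mxM.
  rewrite (_ : (a * b)^* = b^* * a^*); first exact: scalar_mxM.
  by rewrite rmorphM mulrC.
- by move=> a s; rewrite !scalar_mxC.
- by move=> a; rewrite conjCK.
- by move=> s; case: ladder_term.
- by [].
- by [].
Qed.

Definition ladder_mx (h : H) : M := (ladder_term (repr h)).1.

Lemma ladder_mx_pi s : ladder_mx (\pi_(presented rel) s) = (ladder_term s).1.
Proof. by rewrite /ladder_mx (ladder_term_congr (repr_presented rel s)). Qed.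

Lemma ladder_mxD h h' : ladder_mx (h + h') = ladder_mx h + ladder_mx h'.
Proof.
elim/quotW: h => s; elim/quotW: h' => t.
by rewrite -(pi_add rel) !ladder_mx_pi.
Qed.

Lemma ladder_mxM h h' : ladder_mx (h * h') = ladder_mx h *m ladder_mx h'.
Proof.
elim/quotW: h => s; elim/quotW: h' => t.
by rewrite -(pi_mul rel) !ladder_mx_pi.
Qed.

Lemma ladder_mxZ c h : ladder_mx (c *: h) = c *: ladder_mx h.
Proof.
elim/quotW: h => s; have -> : c *: (\pi_(presented rel) s : H) = \pi_(presented rel) (SMul (SCst c) s).
  by rewrite [RHS](pi_mul rel) (pi_cst rel) scale_mulrl mul1r.
by rewrite !ladder_mx_pi /= mul_scalar_mx.
Qed.

Definition ladder (h : H) : C := ladder_mx h ord0 ord_max.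

Lemma ladderD h h' : ladder (h + h') = ladder h + ladder h'.
Proof. by rewrite /ladder ladder_mxD mxE. Qed.

Lemma ladderZ c h : ladder (c *: h) = c * ladder h.
Proof. by rewrite /ladder ladder_mxZ mxE. Qed.

Definition last_entry (h : H) : C := ladder_mx h ord_max ord_max.

Lemma ladder_entries (u v : H) a b d : ladder_mx u = mx2 a b d ->
  ladder (u * v) = a * ladder v + b * last_entry v /\
  last_entry (u * v) = d * last_entry v.
Proof.
move=> uE; rewrite /ladder /last_entry ladder_mxM uE !mxE !big_ord_recl !big_ord0 !mxE /=.
rewrite !addr0 mul0r add0r; have -> : lift ord0 ord0 = ord_max :> 'I_2 by exact: val_inj.
by [].
Qed.

Lemma last_entryD h h' : last_entry (h + h') = last_entry h + last_entry h'.
Proof. by rewrite /last_entry ladder_mxD mxE. Qed.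

Lemma last_entryZ c h : last_entry (c *: h) = c * last_entry h.
Proof. by rewrite /last_entry ladder_mxZ mxE. Qed.

(** The symmetric q-integer [q^(k-1) + q^(k-3) + ... + q^(1-k)]; [lower_coef] is
    [- q (1 + q^2 + ... + q^(2(m-1)))]. They are real, so that signs show them to be nonzero. *)
Fixpoint raise_coef (k : nat) : R := if k is k'.+1 then q0 ^+ k' + q0^-1 * raise_coef k' else 0.
Fixpoint lower_coef (m : nat) : R := if m is m'.+1 then q0 ^+ 2 * lower_coef m' - q0 else 0.

(** A twisted derivation acts on one factor at a time of [(c X + d Y)^k (a X + b Y)^(n-k)]. Through
    [c] it replaces a [Y] by an [X], through [b] an [X] by a [Y]. *)
Lemma ladder_corep n k l :
  ladder (w n k l) = (l.+1 == k)%:R * (x * (raise_coef k)%:C%C) +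
    (l == k.+1)%:R * (y * (q^-1 ^+ k * (lower_coef (n - k))%:C%C)).
Proof.
have qN0 := qC_neq0 q01.
have la : ladder_mx alpha = mx2 q 0 1 by rewrite /presented_gen ladder_mx_pi.
have lc : ladder_mx gamma = mx2 0 x 0 by rewrite /presented_gen ladder_mx_pi.
have ld : ladder_mx alpha^*s = mx2 q^-1 0 1 by rewrite -(pi_star rel) ladder_mx_pi.
have lb : ladder_mx (- q *: gamma^*s) = mx2 0 (- q * y) 0.
  rewrite ladder_mxZ -(pi_star rel) ladder_mx_pi /=.
  by apply/matrixP => -[[|[|//]] i] [[|[|//]] j]; rewrite !mxE /= ?mulr0.
have l0 : ladder 0 = 0 by rewrite -(scale0r (0 : H)) ladderZ mul0r.
have e0 : last_entry 0 = 0 by rewrite -(scale0r (0 : H)) last_entryZ mul0r.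
have lprev s l' : ladder (prev s l') = prev (fun j => ladder (s j)) l' by case: l'.
have eprev s l' : last_entry (prev s l') = prev (fun j => last_entry (s j)) l' by case: l'.
have X m : forall l,
    last_entry (iter m (colX q alpha (- q *: gamma^*s)) (fun l => (l == 0)%:R) l) = (l == 0)%:R /\
    ladder (iter m (colX q alpha (- q *: gamma^*s)) (fun l => (l == 0)%:R) l) =
      (l == 1)%:R * (y * (lower_coef m)%:C%C).
  elim: m => [|m IHm] l' /=.
    rewrite mulr0 mulr0.
    case: l' => [|l'] /=; last by rewrite l0 e0.
    have -> : 1 = \pi_(presented rel) (SCst 1) :> H by rewrite (pi_cst rel) scale1r.
    by rewrite /ladder /last_entry !ladder_mx_pi /= mx2_scalar !mxE.
  rewrite /colX ladderD last_entryD ladderZ last_entryZ.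
  have [-> ->] := ladder_entries (iter m (colX q alpha (- q *: gamma^*s)) (fun l => (l == 0)%:R) l') la.
  have [-> ->] := ladder_entries (prev (iter m (colX q alpha (- q *: gamma^*s)) (fun l => (l == 0)%:R)) l') lb.
  rewrite (IHm l').1 (IHm l').2 eprev.
  case: l' => [|l'] /=; first by rewrite !mulr0 expr0; split; rewrite ?mul0r ?mulr0 ?addr0 ?mul1r //.
  rewrite (IHm l').1 eqSS; case: l' => [|l'] /=; rewrite !(mul0r, mulr0, addr0, add0r) //.
  split=> //; rewrite rmorphB rmorphM /= rmorphXn /=; ring.
rewrite /corep; move: (n - k)%N (X (n - k)%N) => m {}X.
suff : forall l,
    last_entry (iter k (colY q gamma alpha^*s) (iter m (colX q alpha (- q *: gamma^*s))
      (fun l => (l == 0)%:R)) l) = (l == k)%:R /\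
    ladder (iter k (colY q gamma alpha^*s) (iter m (colX q alpha (- q *: gamma^*s))
      (fun l => (l == 0)%:R)) l) = (l.+1 == k)%:R * (x * (raise_coef k)%:C%C) +
    (l == k.+1)%:R * (y * (q^-1 ^+ k * (lower_coef m)%:C%C)).
  by move=> /(_ l)[].
elim: k => [|k IHk] l' /=.
  by rewrite (X l').1 (X l').2 mul0r add0r expr0 mul1r.
move: (iter k _ _) IHk => s IHk; rewrite /colY ladderD last_entryD ladderZ last_entryZ.
have [-> ->] := ladder_entries (s l') lc.
have [-> ->] := ladder_entries (prev s l') ld.
rewrite (IHk l').1 (IHk l').2 eprev lprev.
case: l' => [|l'] /=.
  rewrite !(mul0r, mulr0, addr0, add0r) expr0 mul1r eqSS; split=> //.
  case: k {IHk} => [|k]; last by rewrite !mul0r mulr0.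
  by rewrite /= expr0 mulr0 addr0 mul1r rmorph1.
rewrite (IHk l').1 (IHk l').2 !eqSS !mul0r !addr0 add0r mul1r; split.
  by rewrite mulr0 add0r.
rewrite [q^-1 ^+ k.+1]exprS rmorphD rmorphM rmorphXn fmorphV /=.
by case: (l'.+1 =P k) => [<-|_]; rewrite ?mul0r ?mulr0; ring.
Qed.

Lemma raise_coef_gt0 k : (0 < k)%N -> 0 < raise_coef k.
Proof.
case/andP: q01 => q00 _.
case: k => // k _; elim: k => [|k IHk] /=; first by rewrite mulr0 addr0 ltr01.
by rewrite addr_gt0 ?exprn_gt0 // mulr_gt0 ?invr_gt0.
Qed.

Lemma lower_coef_lt0 m : (0 < m)%N -> lower_coef m < 0.
Proof.
case/andP: q01 => q00 _.
case: m => // m _; elim: m => [|m IHm] /=; first by rewrite mulr0 add0r oppr_lt0.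
by rewrite subr_lt0 (lt_trans _ q00) // pmulr_rlt0 // exprn_gt0.
Qed.

End LadderFunctional.

(** * The matrix coefficients span O(SU_q(2)) *)

Section PeterWeyl.
Variables (R : realType) (q0 : R) (q01 : 0 < q0 < 1).
Local Notation C := R[i].
Local Notation q := (q0%:C%C).
Local Notation H := (O_SUq2 q0).
Local Notation rel := (@SUq2_rel R q0).
Local Notation alpha := (presented_gen rel Alpha : H).
Local Notation gamma := (presented_gen rel Gamma : H).
Local Notation w := (corep q alpha (- q *: gamma^*s) gamma alpha^*s).
Local Notation T := (SUq2_T q0).

Lemma cB_neq0 n : cB q n.+1 != 0.
Proof.
case/andP: q01 => q00 q1; rewrite /cB -rmorphXn /= -(rmorph1 (real_complex R)).
rewrite -rmorphB /= (inj_eq (@complexI R)) subr_eq0 eq_sym lt_eqF //.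
by rewrite exprn_ilt1 // ltW.
Qed.

Definition corep_sum (V : lmodType C) M (u : nat -> nat -> nat -> V) : tensor H V :=
  \sum_(n < M) \sum_(k < n.+1) \sum_(l < n.+1) tens (w n k l) (u n k l).

Lemma corep_sum_pad (V : lmodType C) M M' (u : nat -> nat -> nat -> V) : (M <= M')%N ->
  corep_sum M u = corep_sum M' (fun n => if (n < M)%N then u n else fun _ _ => 0).
Proof.
move=> MM'; rewrite /corep_sum (big_ord_widen _ (fun n => \sum_(k < n.+1) \sum_(l < n.+1)
  tens (w n k l) (u n k l)) MM') big_mkcond; apply: eq_bigr => n _.
case: ifP => // _; rewrite big1 // => k _; rewrite big1 // => l _; exact: tens0r.
Qed.

Lemma corep_sumD (V : lmodType C) M (u u' : nat -> nat -> nat -> V) :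
  corep_sum M u + corep_sum M u' = corep_sum M (fun n k l => u n k l + u' n k l).
Proof.
rewrite /corep_sum -big_split; apply: eq_bigr => n _; rewrite -big_split; apply: eq_bigr => k _.
by rewrite -big_split; apply: eq_bigr => l _; rewrite tensDr.
Qed.

Definition corep_span (h : H) : Prop := exists M (u : nat -> nat -> nat -> C),
  h = \sum_(n < M) \sum_(k < n.+1) \sum_(l < n.+1) u n k l *: w n k l.

Lemma corep_span_corep n k l : (k <= n)%N -> (l <= n)%N -> corep_span (w n k l).
Proof.
move=> kn ln; exists n.+1, (fun n' k' l' => ((n' == n) && (k' == k) && (l' == l))%:R).
rewrite big_ord_recr /= big1 ?add0r => [|m _]; last first.
  by rewrite big1 // => i _; rewrite big1 // => j _; rewrite ltn_eqF // scale0r.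
rewrite (bigD1 (Ordinal (kn : (k < n.+1)%N))) //= [X in _ + X]big1 ?addr0 => [|i ik]; last first.
  by rewrite big1 // => j _; rewrite (_ : (i == k :> nat) = false) ?andbF ?scale0r //; exact: negPf ik.
rewrite (bigD1 (Ordinal (ln : (l < n.+1)%N))) //= !eqxx scale1r big1 ?addr0 // => j jl.
by rewrite (_ : (j == l :> nat) = false) ?andbF ?scale0r //; exact: negPf jl.
Qed.

Lemma corep_span0 : corep_span 0.
Proof. by exists 0%N, (fun _ _ _ => 0); rewrite big_ord0. Qed.

Lemma corep_spanD h h' : corep_span h -> corep_span h' -> corep_span (h + h').
Proof.
have pad M M' (u : nat -> nat -> nat -> C) : (M <= M')%N ->
    \sum_(n < M) \sum_(k < n.+1) \sum_(l < n.+1) u n k l *: w n k l =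
    \sum_(n < M') \sum_(k < n.+1) \sum_(l < n.+1)
      (if (n < M)%N then u n k l else 0) *: w n k l.
  move=> MM'; rewrite (big_ord_widen _ (fun n => \sum_(k < n.+1) \sum_(l < n.+1)
    u n k l *: w n k l) MM') big_mkcond; apply: eq_bigr => n _.
  by case: ifP => // _; rewrite big1 // => k _; rewrite big1 // => l _; rewrite scale0r.
move=> [M [u ->]] [M' [u' ->]].
rewrite (pad M (maxn M M')) ?leq_maxl // (pad M' (maxn M M')) ?leq_maxr //.
exists (maxn M M'), (fun n k l => (if (n < M)%N then u n k l else 0) +
  (if (n < M')%N then u' n k l else 0)).
rewrite -big_split; apply: eq_bigr => n _; rewrite -big_split; apply: eq_bigr => k _.
by rewrite -big_split; apply: eq_bigr => l _; rewrite scalerDl.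
Qed.

Lemma corep_spanZ c h : corep_span h -> corep_span (c *: h).
Proof.
move=> [M [u ->]]; exists M, (fun n k l => c * u n k l).
rewrite scaler_sumr; apply: eq_bigr => n _; rewrite scaler_sumr; apply: eq_bigr => k _.
by rewrite scaler_sumr; apply: eq_bigr => l _; rewrite scalerA.
Qed.

Lemma corep_span_sum I (r : seq I) (P : pred I) (F : I -> H) :
  (forall i, corep_span (F i)) -> corep_span (\sum_(i <- r | P i) F i).
Proof. by move=> Fs; apply: big_ind => //; [exact: corep_span0|exact: corep_spanD]. Qed.

(** By Clebsch-Gordan the product is a combination of coefficients of highest weights [n + 1] and
    [n - 1]. *)
Lemma corep_span_mulT i j h : corep_span h -> corep_span (T i j * h).
Proof.
move=> [M [u ->]]; rewrite mulr_sumr; apply: corep_span_sum => n.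
rewrite mulr_sumr; apply: corep_span_sum => k.
rewrite mulr_sumr; apply: corep_span_sum => l.
rewrite scale_mulrr; apply: corep_spanZ.
have fam := SUq2_family q01; have qN0 := qC_neq0 q01; have D0 := cB_neq0 n.
have -> : T i j * w n k l = tensor_mx q alpha (- q *: gamma^*s) gamma alpha^*s (i, k) (j, l).
  by rewrite /tensor_mx /corep_mx /= SUq2_T_mat.
rewrite (splitting_decomposition (cg_splitting qN0 D0) (cg_rows1 fam qN0 (n := n))
  (cg_rows2 fam qN0 (n := n))).
apply: corep_spanD; apply: corep_span_sum => m; apply: corep_span_sum => m';
  apply: corep_spanZ; apply: corep_span_corep; rewrite -ltnS ?prednK //;
  exact: leq_ltn_trans (ltn_ord m).
Qed.

(** The span contains 1, so it is enough that left multiplication by [h] preserves it; [h^*s] is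
    carried along for the induction. *)
Lemma corep_span_all h : corep_span h.
Proof.
have qN0 := qC_neq0 q01.
have mulgen c i j (g : H) : g = c *: T i j -> forall x, corep_span x -> corep_span (g * x).
  by move=> -> x xs; rewrite scale_mulrl; apply: corep_spanZ; exact: corep_span_mulT.
suff : (forall x, corep_span x -> corep_span (h * x)) /\
    (forall x, corep_span x -> corep_span (h^*s * x)).
  move=> [/(_ 1) + _]; rewrite mulr1; apply.
  exact: (@corep_span_corep 0 0 0).
move: h; apply: presented_ind => [g||x y [xN xN'] [yN yN']|c x [xN xN']|
    x y [xN xN'] [yN yN']|x [xN xN']]; split=> z zs; rewrite ?(starE H) ?scale_mulrl ?mulrDl ?mul1r //.
- case: g; [apply: (mulgen 1 ord0 ord0)|apply: (mulgen 1 ord_max ord0)] => //;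
    by rewrite SUq2_T_mat scale1r.
- case: g; [apply: (mulgen 1 ord_max ord_max)|apply: (mulgen (- q^-1) ord0 ord_max)] => //;
    rewrite SUq2_T_mat /matT /= ?scale1r // scalerA mulrNN mulVf // scale1r //.
- exact: corep_spanD (xN _ zs) (yN _ zs).
- exact: corep_spanD (xN' _ zs) (yN' _ zs).
- exact/corep_spanZ/xN.
- exact/corep_spanZ/xN'.
- by rewrite -mulrA; apply: xN; exact: yN.
- by rewrite -mulrA; apply: yN'; exact: xN'.
- exact: xN'.
- exact: xN.
Qed.

Lemma corep_sum_all (V : lmodType C) (x : tensor H V) : exists M u, x = corep_sum M u.
Proof.
elim/tensor_ind: x => [|h v|x y [M [u ->]] [M' [u' ->]]].
- by exists 0%N, (fun _ _ _ => 0); rewrite /corep_sum big_ord0.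
- have [M [u ->]] := corep_span_all h; exists M, (fun n k l => u n k l *: v).
  rewrite tens_suml; apply: eq_bigr => n _; rewrite tens_suml; apply: eq_bigr => k _.
  by rewrite tens_suml; apply: eq_bigr => l _; rewrite tensZl tensZr.
- rewrite (corep_sum_pad u (leq_maxl M M')) (corep_sum_pad u' (leq_maxr M M')) corep_sumD.
  by eexists; eexists.
Qed.

End PeterWeyl.

(** * Maps between tensor products *)

Section LinearMaps.
Variable K : fieldType.
Implicit Types (U V W : lmodType K).

Lemma linear_fun0 U V (f : U -> V) : linear f -> f 0 = 0.
Proof. by move=> fL; have := fL (-1) 0 0; rewrite scaleN1r addNr scaleN1r addNr. Qed.

Lemma linear_funD U V (f : U -> V) : linear f -> {morph f : u v / u + v}.
Proof. by move=> fL u v; have := fL 1 u v; rewrite !scale1r. Qed.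

Lemma linear_funZ U V (f : U -> V) : linear f -> forall c u, f (c *: u) = c *: f u.
Proof.
by move=> fL c u; have := fL c u 0; rewrite !addr0 (linear_fun0 fL) addr0.
Qed.

Lemma balanced_map U V U' V' (f : U -> U') (g : V -> V') : linear f -> linear g ->
  balanced (fun u v => tens (f u) (g v)).
Proof.
move=> fL gL; split=> [v u u'|u v v'|c u v].
- by rewrite (linear_funD fL) tensDl.
- by rewrite (linear_funD gL) tensDr.
- by rewrite (linear_funZ fL) (linear_funZ gL) tensZl tensZr.
Qed.

Lemma id_linear U : linear (@id U).
Proof. by []. Qed.

Lemma tmap_tens U V U' V' (f : U -> U') (g : V -> V') u v : linear f -> linear g ->
  tmap f g (tens u v) = tens (f u) (g v).
Proof. by move=> fL gL; apply: tlift_tens; exact: balanced_map. Qed.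

Lemma tmapD U V U' V' (f : U -> U') (g : V -> V') : linear f -> linear g ->
  {morph tmap f g : x y / x + y}.
Proof. by move=> fL gL; apply: tliftD; exact: balanced_map. Qed.

Lemma tmap0 U V U' V' (f : U -> U') (g : V -> V') : linear f -> linear g ->
  tmap f g 0 = 0.
Proof. by move=> fL gL; apply: tlift0; exact: balanced_map. Qed.

Lemma tmap_sum U V U' V' (f : U -> U') (g : V -> V') I (r : seq I) (P : pred I)
    (F : I -> tensor U V) : linear f -> linear g ->
  tmap f g (\sum_(i <- r | P i) F i) = \sum_(i <- r | P i) tmap f g (F i).
Proof. by move=> fL gL; apply: tlift_sum; exact: balanced_map. Qed.

Lemma linear_comp U V W (g : V -> W) (f : U -> V) : linear g -> linear f ->
  linear (fun u => g (f u)).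
Proof. by move=> gL fL c u v; rewrite fL gL. Qed.

Lemma linear_iter U (f : U -> U) n : linear f -> linear (iter n f).
Proof. by move=> fL; elim: n => [|n IHn] c u v //=; rewrite IHn fL. Qed.

Lemma tmap_comp U U' U'' V (g : U' -> U'') (f : U -> U') (z : tensor U V) :
  linear g -> linear f -> tmap g (@id V) (tmap f (@id V) z) = tmap (fun u => g (f u)) (@id V) z.
Proof.
move=> gL fL; have gfL := linear_comp gL fL; have idL := @id_linear V.
elim/tensor_ind: z => [|u v|x y IHx IHy].
- by rewrite (tmap0 fL idL) (tmap0 gL idL) (tmap0 gfL idL).
- by rewrite (tmap_tens _ _ fL idL) (tmap_tens _ _ gL idL) (tmap_tens _ _ gfL idL).
- by rewrite (tmapD fL idL) (tmapD gL idL) (tmapD gfL idL) IHx IHy.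
Qed.

Lemma tmap_id U V (z : tensor U V) : tmap (@id U) (@id V) z = z.
Proof.
have idU := @id_linear U; have idV := @id_linear V.
elim/tensor_ind: z => [|u v|x y IHx IHy].
- exact: (tmap0 idU idV).
- exact: (tmap_tens _ _ idU idV).
- by rewrite (tmapD idU idV) IHx IHy.
Qed.

Lemma balanced_assoc U V W u : balanced (fun (v : V) (w : W) => tens (tens (u : U) v) w).
Proof.
split=> [w v v'|v w w'|c v w].
- by rewrite tensDr tensDl.
- by rewrite tensDr.
- by rewrite tensZr tensZl tensZr.
Qed.

Lemma balanced_tassoc U V W :
  balanced (fun (u : U) => tlift (fun (v : V) (w : W) => tens (tens u v) w)).
Proof.
split=> [x u u'|u x x'|c u x].
- elim/tensor_ind: x => [|v w|x y IHx IHy].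
  + by rewrite !(tlift0 (balanced_assoc V W _)) addr0.
  + by rewrite !(tlift_tens (balanced_assoc V W _)) !tensDl.
  + by rewrite !(tliftD (balanced_assoc V W _)) IHx IHy addrACA.
- exact: (tliftD (balanced_assoc V W _)).
- elim/tensor_ind: x => [|v w|x y IHx IHy].
  + by rewrite scaler0 !(tlift0 (balanced_assoc V W _)).
  + by rewrite -tensZl !(tlift_tens (balanced_assoc V W _)) [tens (c *: u) v]tensZl tensZr.
  + by rewrite scalerDr !(tliftD (balanced_assoc V W _)) IHx IHy.
Qed.

Lemma tassoc_tens U V W (u : U) (v : V) (w : W) :
  tassoc (tens u (tens v w)) = tens (tens u v) w.
Proof.
by rewrite /tassoc (tlift_tens (balanced_tassoc U V W)) (tlift_tens (balanced_assoc V W _)).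
Qed.

Lemma tassocD U V W (x y : tensor U (tensor V W)) : tassoc (x + y) = tassoc x + tassoc y.
Proof. exact: (tliftD (balanced_tassoc U V W)). Qed.

Lemma tassoc0 U V W : tassoc (0 : tensor U (tensor V W)) = 0.
Proof. exact: (tlift0 (balanced_tassoc U V W)). Qed.

End LinearMaps.

(** * Functionals on H acting on comodules *)

Section Slices.
Variables (C : numClosedFieldType) (H : starAlgType C).
Variables (Delta : H -> tensor H H) (counit : H -> C).
Hypothesis Delta_lin : linear Delta.
Variables (V : lmodType C) (delta : V -> tensor H V).
Hypothesis comod : left_comodule Delta counit delta.
Let delta_lin := comod_linear comod.
Variable f : H -> C.
Hypothesis fD : forall g h, f (g + h) = f g + f h.
Hypothesis fZ : forall c h, f (c *: h) = c * f h.

Let fb (W : lmodType C) : balanced (fun h (x : W) => f h *: x) := balanced_scale W fD fZ.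

Definition slice (v : V) : V := tlift (fun h x => f h *: x) (delta v).
Definition slice_alg (h : H) : H := tlift (fun h h' => f h *: h') (Delta h).

Lemma slice_lin : linear slice.
Proof.
move=> c u v; rewrite /slice delta_lin (tliftD (fb V)).
by rewrite (tliftZ (fb V)) // => c' h x; rewrite fZ scalerA.
Qed.

Lemma slice_alg_lin : linear slice_alg.
Proof.
move=> c u v; rewrite /slice_alg Delta_lin (tliftD (fb H)).
by rewrite (tliftZ (fb H)) // => c' h x; rewrite fZ scalerA.
Qed.

(** Coassociativity: seen through [delta], the action of [f] on V only concerns the leg in H. [E1]
    and [E2] apply [f] to the two sides of that axiom. *)
Lemma delta_slice v : delta (slice v) = tmap slice_alg id (delta v).
Proof.
pose L (hh : tensor H H) := tlift (fun h (h' : H) => f h *: h') hh.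
have L_lin : linear L.
  move=> c x y; rewrite /L (tliftD (fb H)) (tliftZ (fb H)) // => c' h x'.
  by rewrite fZ scalerA.
have idl (W : lmodType C) : linear (@id W) by [].
have E1 z : tmap L id (tmap Delta id z) = tmap slice_alg id z.
  elim/tensor_ind: z => [|h x|y z IHy IHz].
  - by rewrite !tmap0 //; exact: slice_alg_lin.
  - by rewrite !tmap_tens //; exact: slice_alg_lin.
  - by rewrite !tmapD ?IHy ?IHz //; exact: slice_alg_lin.
have E2 z : tmap L id (tassoc (tmap id delta z)) = delta (tlift (fun h x => f h *: x) z).
  elim/tensor_ind: z => [|h x|y z IHy IHz].
  - by rewrite (tmap0 (idl _) delta_lin) tassoc0 (tmap0 L_lin (idl _)) (tlift0 (fb V))
      (linear_fun0 delta_lin).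
  - rewrite (tmap_tens _ _ (idl _) delta_lin) (tlift_tens (fb V)) (linear_funZ delta_lin).
    elim/tensor_ind: (delta x) => [|h' x'|y z IHy IHz].
    + by rewrite tens0r tassoc0 (tmap0 L_lin (idl _)) scaler0.
    + by rewrite tassoc_tens (tmap_tens _ _ L_lin (idl _)) /L (tlift_tens (fb H)) tensZl.
    + by rewrite tensDr tassocD (tmapD L_lin (idl _)) IHy IHz scalerDr.
  - by rewrite (tmapD (idl _) delta_lin) tassocD (tmapD L_lin (idl _)) IHy IHz
      (tliftD (fb V)) (linear_funD delta_lin).
by rewrite -E1 (comod_coassoc comod) E2.
Qed.

End Slices.

(** * Ladder operators on matrix coefficients *)

Section Irreducible.
Variables (R : realType) (q0 : R) (q01 : 0 < q0 < 1).
Local Notation C := R[i].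
Local Notation q := (q0%:C%C).
Local Notation H := (O_SUq2 q0).
Local Notation rel := (@SUq2_rel R q0).
Local Notation alpha := (presented_gen rel Alpha : H).
Local Notation gamma := (presented_gen rel Gamma : H).
Local Notation w := (corep q alpha (- q *: gamma^*s) gamma alpha^*s).
Variables (Delta : H -> tensor H H) (DeltaP : is_SUq2_coproduct Delta).
Variables (counit : H -> C) (counitP : is_SUq2_counit counit).
Let Delta_lin : linear Delta := star_hom_linear (proj1 DeltaP).

Let raise : H -> C := ladder 1 0.
Let lower : H -> C := ladder 0 1.
Let raiseD := ladderD q01 1 0.
Let raiseZ := ladderZ q01 1 0.
Let lowerD := ladderD q01 0 1.
Let lowerZ := ladderZ q01 0 1.

Definition raising_factor (k : nat) : C := (raise_coef q0 k)%:C%C.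
Definition lowering_factor (n k : nat) : C := q^-1 ^+ k * (lower_coef q0 (n - k))%:C%C.

Lemma raising_factor_neq0 k : (0 < k)%N -> raising_factor k != 0.
Proof.
move=> k0; rewrite /raising_factor (inj_eq (@complexI R)).
by rewrite gt_eqF // raise_coef_gt0.
Qed.

Lemma lowering_factor_neq0 n k : (k < n)%N -> lowering_factor n k != 0.
Proof.
move=> kn; apply: mulf_neq0; first by rewrite expf_neq0 // invr_eq0 qC_neq0.
by rewrite (inj_eq (@complexI R)) lt_eqF // lower_coef_lt0 // subn_gt0.
Qed.

Lemma raise_corep n k l : raise (w n k l) = (l.+1 == k)%:R * raising_factor k.
Proof.
have -> : raise (w n k l) = (l.+1 == k)%:R * (1 * raising_factor k) +
    (l == k.+1)%:R * (0 * lowering_factor n k) by exact: ladder_corep.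
by rewrite mul1r mul0r mulr0 addr0.
Qed.

Lemma lower_corep n k l : lower (w n k l) = (l == k.+1)%:R * lowering_factor n k.
Proof.
have -> : lower (w n k l) = (l.+1 == k)%:R * (0 * raising_factor k) +
    (l == k.+1)%:R * (1 * lowering_factor n k) by exact: ladder_corep.
by rewrite mul1r mul0r mulr0 add0r.
Qed.

Lemma slice_alg_corep f n k l : (forall g h, f (g + h) = f g + f h) ->
  (forall c h, f (c *: h) = c * f h) -> (k <= n)%N ->
  slice_alg Delta f (w n k l) = \sum_(m < n.+1) f (w n k m) *: w n m l.
Proof.
move=> fD fZ kn; rewrite /slice_alg (Delta_corep q01 DeltaP) //.
rewrite (tlift_sum (balanced_scale H fD fZ)); apply: eq_bigr => m _.
exact: (tlift_tens (balanced_scale H fD fZ)).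
Qed.

(** At [k = 0] the factor vanishes, which makes the truncated [k.-1] harmless; for [slice_lower] the
    same happens at [k = n]. *)
Lemma slice_raise n k l : (k <= n)%N ->
  slice_alg Delta raise (w n k l) = raising_factor k *: w n k.-1 l.
Proof.
move=> kn; rewrite slice_alg_corep //.
case: k kn => [|k] kn.
  rewrite /raising_factor /= scale0r big1 // => m _.
  by rewrite raise_corep mul0r scale0r.
under eq_bigr do rewrite raise_corep eqSS -scalerA.
by rewrite (sum_ord_delta_sym _ (fun m => raising_factor k.+1 *: w n m l)) ltnW ?ltnS // scale1r.
Qed.

Lemma slice_lower n k l : (k <= n)%N ->
  slice_alg Delta lower (w n k l) = lowering_factor n k *: w n k.+1 l.
Proof.
move=> kn; rewrite slice_alg_corep //.
under eq_bigr do rewrite lower_corep -scalerA.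
rewrite (sum_ord_delta_sym _ (fun m => lowering_factor n k *: w n m l)) ltnS.
move: kn; rewrite leq_eqVlt => /predU1P[->|->]; last by rewrite scale1r.
by rewrite ltnn scale0r /lowering_factor subnn mulr0 scale0r.
Qed.

Lemma iter_slice_raise N n k l : (k <= n)%N ->
  iter N (slice_alg Delta raise) (w n k l) =
  (\prod_(i < N) raising_factor (k - i)) *: w n (k - N) l.
Proof.
move=> kn; elim: N => [|N IHN] /=; first by rewrite big_ord0 scale1r subn0.
rewrite IHN (linear_funZ (slice_alg_lin Delta_lin raiseD raiseZ)).
by rewrite slice_raise ?(leq_trans (leq_subr _ _)) // scalerA big_ord_recr subnS.
Qed.

Lemma iter_slice_lower N n k l : (k <= n)%N ->
  iter N (slice_alg Delta lower) (w n k l) =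
  (\prod_(i < N) lowering_factor n (k + i)) *: w n (k + N) l.
Proof.
move=> kn; elim: N => [|N IHN] /=; first by rewrite big_ord0 scale1r addn0.
rewrite IHN (linear_funZ (slice_alg_lin Delta_lin lowerD lowerZ)) big_ord_recr /=.
have [kN|nk] := leqP (k + N) n; first by rewrite slice_lower // scalerA addnS.
suff -> : \prod_(i < N) lowering_factor n (k + i) = 0 by rewrite !mul0r !scale0r.
apply/eqP; rewrite prodf_seq_eq0; apply/hasP.
have nkN : (n - k < N)%N by rewrite ltn_subLR.
exists (Ordinal nkN); first exact: mem_index_enum.
by rewrite /= subnKC // /lowering_factor subnn mulr0 eqxx.
Qed.

Lemma raising_prod_eq0 N k : (k < N)%N -> \prod_(i < N) raising_factor (k - i) = 0.
Proof.
move=> kN; rewrite (bigD1 (Ordinal kN)) //= subnn.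
by rewrite {1}/raising_factor /= mul0r.
Qed.

Lemma raising_prod_neq0 N k : (N <= k)%N -> \prod_(i < N) raising_factor (k - i) != 0.
Proof.
move=> Nk; apply/prodf_neq0 => i _; apply: raising_factor_neq0.
by rewrite subn_gt0 (leq_trans (ltn_ord i)).
Qed.

Lemma lowering_prod_eq0 N n k : (k <= n)%N -> (n < k + N)%N ->
  \prod_(i < N) lowering_factor n (k + i) = 0.
Proof.
move=> kn nkN; have nk : (n - k < N)%N by rewrite ltn_subLR.
rewrite (bigD1 (Ordinal nk)) //= subnKC // {1}/lowering_factor subnn.
by rewrite mulr0 mul0r.
Qed.

Lemma lowering_prod_neq0 N n k : (k + N <= n)%N ->
  \prod_(i < N) lowering_factor n (k + i) != 0.
Proof.
move=> kNn; apply/prodf_neq0 => i _; apply: lowering_factor_neq0.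
by rewrite (leq_trans _ kNn) // ltn_add2l.
Qed.

(* Lowering N - a times and then raising N times isolates the a-th row of the
   corepresentation of highest weight N among those of weight at most N. *)
Lemma ladder_select N a : (a <= N)%N -> exists2 kappa, kappa != 0 &
  forall n k l, (n <= N)%N -> (k <= n)%N ->
    iter N (slice_alg Delta raise) (iter (N - a) (slice_alg Delta lower) (w n k l)) =
    if (n == N) && (k == a) then kappa *: w N 0 l else 0.
Proof.
move=> aN; exists ((\prod_(i < N - a) lowering_factor N (a + i)) *
  \prod_(i < N) raising_factor (N - i)).
  by rewrite mulf_neq0 ?raising_prod_neq0 // lowering_prod_neq0 // subnKC.
move=> n k l nN kn.
have rlin c h : iter N (slice_alg Delta raise) (c *: h) =
    c *: iter N (slice_alg Delta raise) h.
  elim: (N) => //= m ->.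
  by rewrite (linear_funZ (slice_alg_lin Delta_lin raiseD raiseZ)).
rewrite iter_slice_lower // rlin.
have [kK|kK] := leqP (k + (N - a)) n; last first.
  rewrite lowering_prod_eq0 // scale0r; case: andP => // -[/eqP nE /eqP kE].
  by rewrite nE kE subnKC // ltnn in kK.
rewrite iter_slice_raise // scalerA.
(* [N <= k + (N - a) <= n <= N] forces [n = N] and [k = a]; otherwise raising [N] times passes below
   row 0. *)
have [NkK|NkK] := leqP N (k + (N - a)).
  have nE : n = N by apply/eqP; rewrite eqn_leq nN (leq_trans NkK).
  have kE : k = a.
    apply/eqP; rewrite -(eqn_add2r (N - a)) subnKC // eqn_leq NkK andbT.
    exact: leq_trans kK nN.
  by rewrite nE kE !eqxx /= subnKC // subnn.
rewrite raising_prod_eq0 // mulr0 scale0r; case: andP => // -[_ /eqP kE].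
by rewrite kE subnKC // ltnn in NkK.
Qed.

End Irreducible.

(** * Weight bases of irreducible comodules *)

Section IrreducibleComodule.
Variables (R : realType) (q0 : R) (q01 : 0 < q0 < 1).
Local Notation C := R[i].
Local Notation q := (q0%:C%C).
Local Notation H := (O_SUq2 q0).
Local Notation rel := (@SUq2_rel R q0).
Local Notation alpha := (presented_gen rel Alpha : H).
Local Notation gamma := (presented_gen rel Gamma : H).
Local Notation w := (corep q alpha (- q *: gamma^*s) gamma alpha^*s).
Variables (Delta : H -> tensor H H) (DeltaP : is_SUq2_coproduct Delta).
Variables (counit : H -> C) (counitP : is_SUq2_counit counit).
Let Delta_lin : linear Delta := star_hom_linear (proj1 DeltaP).

Local Notation raise := (ladder 1 0 : H -> C).
Local Notation lower := (ladder 0 1 : H -> C).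
Let raiseD := ladderD q01 1 0.
Let raiseZ := ladderZ q01 1 0.
Let lowerD := ladderD q01 0 1.
Let lowerZ := ladderZ q01 0 1.

Variables (V : vectType C) (delta : V -> tensor H V).
Hypothesis irr : irreducible_left_comodule Delta counit delta.
Let comod : left_comodule Delta counit delta. Proof. by case: irr. Qed.
Let delta_lin := comod_linear comod.
Let counit_hom := proj1 counitP.

Lemma delta_iter_slice f N v : (forall g h, f (g + h) = f g + f h) ->
  (forall c h, f (c *: h) = c * f h) ->
  delta (iter N (slice delta f) v) = tmap (iter N (slice_alg Delta f)) id (delta v).
Proof.
move=> fD fZ; have sL := slice_alg_lin Delta_lin fD fZ.
elim: N => [|N IHN]; first by rewrite tmap_id.
rewrite [LHS](delta_slice Delta_lin comod fD fZ) IHN.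
exact: (tmap_comp _ sL (linear_iter N sL)).
Qed.

Lemma tmap_corep_sum (g : H -> H) M (u : nat -> nat -> nat -> V) : linear g ->
  tmap g id (corep_sum q0 M u) =
  \sum_(n < M) \sum_(k < n.+1) \sum_(l < n.+1) tens (g (w n k l)) (u n k l).
Proof.
move=> gL; have idL : linear (@id V) := @id_linear _ V.
rewrite /corep_sum (tmap_sum _ _ _ gL idL); apply: eq_bigr => n _.
rewrite (tmap_sum _ _ _ gL idL); apply: eq_bigr => k _.
rewrite (tmap_sum _ _ _ gL idL); apply: eq_bigr => l _.
exact: (tmap_tens _ _ gL idL).
Qed.

Let counitD g h : counit (g + h) = counit g + counit h := star_homD counit_hom g h.
Let counitZ c h : counit (c *: h) = c * counit h := star_homZ counit_hom c h.

Lemma delta_eq0 v : delta v = 0 -> v = 0.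
Proof.
move=> dv; rewrite -[v](comod_counit comod) dv.
exact: (tlift0 (balanced_scale V counitD counitZ)).
Qed.

(* A nonzero comodule map from the corepresentation of highest weight N. *)
Lemma weight_vectors : exists N (y : nat -> V),
  (exists2 j, (j <= N)%N & y j != 0) /\
  forall j, (j <= N)%N -> delta (y j) = \sum_(l < N.+1) tens (w N j l) (y l).
Proof.
have [_ V0 _] := irr; have [v _ v0] : exists2 v : V, v \in fullv & v != 0.
  by exists (vpick fullv); [exact: memv_pick|rewrite vpick0].
(* With the least number of weights in an expansion of [delta v], some coefficient of the top weight
   [N] is nonzero. *)
have exM : exists M, `[< exists u, delta v = corep_sum q0 M u >].
  by have [M [u uE]] := corep_sum_all q01 (delta v); exists M; apply/asboolP; exists u.
case: (ex_minnP exM) => -[/asboolP[u]|N /asboolP[u dvE] minN].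
  by rewrite /corep_sum big_ord0 => /delta_eq0 vE; rewrite vE eqxx in v0.
have [a [b [aN bN uab]]] : exists a b, [/\ (a <= N)%N, (b <= N)%N & u N a b != 0].
  apply: contrapT => no; suff : (N < N)%N by rewrite ltnn.
  apply: minN; apply/asboolP; exists u; rewrite dvE /corep_sum big_ord_recr /=.
  rewrite [X in _ + X]big1 ?addr0 // => k _; rewrite big1 // => l _.
  have [->|ukl] := eqVneq (u N k l) 0; first by rewrite tens0r.
  by case: no; exists k, l; split; rewrite // -ltnS.
(* The coefficients of one nonzero row of top weight. [v'] isolates this row and moves it to row 0;
   lowering [v'] then reaches every row [j] with the same vectors. *)
pose y l := u N a l.
have [kappa kappa0 sel] := ladder_select q01 DeltaP aN.
pose v' := iter N (slice delta raise) (iter (N - a) (slice delta lower) v).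
have raiseL := linear_iter N (slice_alg_lin Delta_lin raiseD raiseZ).
have lowerL m := linear_iter m (slice_alg_lin Delta_lin lowerD lowerZ).
have gL := linear_comp raiseL (lowerL (N - a)%N).
have idL : linear (@id V) := @id_linear _ V.
have dv' : delta v' = kappa *: \sum_(l < N.+1) tens (w N 0 l) (y l).
  rewrite /v' (delta_iter_slice _ _ raiseD raiseZ) (delta_iter_slice _ _ lowerD lowerZ).
  rewrite (tmap_comp _ raiseL (lowerL _)) dvE (tmap_corep_sum _ _ gL).
  rewrite big_ord_recr /= big1 ?add0r => [|n _]; last first.
    rewrite big1 // => k _; rewrite big1 // => l _.
    rewrite sel; [|by rewrite ltnW|by rewrite -ltnS].
    by rewrite ltn_eqF // tens0l.
  rewrite (bigD1 (Ordinal (aN : (a < N.+1)%N))) //= [X in _ + X]big1 ?addr0 => [|k ka]; last first.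
    rewrite big1 // => l _; rewrite sel; [|by []|by rewrite -ltnS].
    by rewrite (_ : (k == a :> nat) = false) ?andbF ?tens0l //; exact: negPf ka.
  rewrite scaler_sumr; apply: eq_bigr => l _.
  by rewrite sel // !eqxx /= tensZl.
have dj j : (j <= N)%N -> exists2 c, c != 0 & delta (iter j (slice delta lower) v') =
    c *: \sum_(l < N.+1) tens (w N j l) (y l).
  move=> jN; exists (kappa * \prod_(i < j) lowering_factor q0 N (0 + i)).
    by rewrite mulf_neq0 // (lowering_prod_neq0 q01).
  rewrite (delta_iter_slice _ _ lowerD lowerZ) dv' -scalerA !scaler_sumr.
  rewrite (tmap_sum _ _ _ (lowerL j) idL); apply: eq_bigr => l _.
  rewrite -[X in tmap _ _ X]tensZl (tmap_tens _ _ (lowerL j) idL) (linear_funZ (lowerL j)) tensZl.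
  by rewrite (iter_slice_lower q01 DeltaP) // tensZl.
exists N, y; split; first by exists b.
move=> j jN; have [c c0 dc] := dj j jN.
have cb := balanced_scale V counitD counitZ.
(* The counit is a Kronecker delta on the [w N j l], hence recovers the vector [y j] from its
   coaction. *)
have yE : iter j (slice delta lower) v' = c *: y j.
  rewrite -[LHS](comod_counit comod) dc (tliftZ cb) => [|c' h x]; last first.
    by rewrite counitZ scalerA.
  congr (_ *: _); rewrite (tlift_sum cb) (bigD1 (Ordinal (jN : (j < N.+1)%N))) //=.
  rewrite (tlift_tens cb) (counit_corep counitP) // eqxx scale1r big1 ?addr0 // => l lj.
  rewrite (tlift_tens cb) (counit_corep counitP) //.
  by rewrite (_ : (j == l :> nat) = false) ?scale0r // eq_sym; exact: negPf lj.
apply: (scalerI c0); rewrite -(linear_funZ delta_lin) -yE.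
exact: dc.
Qed.

Section WeightBasis.
Variables (N : nat) (y : nat -> V).
Hypothesis dy : forall j, (j <= N)%N -> delta (y j) = \sum_(l < N.+1) tens (w N j l) (y l).
Hypothesis y_neq0 : exists2 j, (j <= N)%N & y j != 0.

Lemma slice_weight_vector f j : (forall g h, f (g + h) = f g + f h) ->
  (forall c h, f (c *: h) = c * f h) -> (j <= N)%N ->
  slice delta f (y j) = \sum_(l < N.+1) f (w N j l) *: y l.
Proof.
move=> fD fZ jN; have fb := balanced_scale V fD fZ.
rewrite /slice dy // (tlift_sum fb); apply: eq_bigr => l _.
exact: (tlift_tens fb).
Qed.

Lemma raise_weight_vector j : (j <= N)%N ->
  slice delta raise (y j) = raising_factor q0 j *: y j.-1.
Proof.
move=> jN; rewrite (slice_weight_vector raiseD raiseZ) //.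
case: j jN => [|j] jN.
  rewrite /raising_factor /= scale0r big1 // => l _.
  by rewrite (raise_corep q01) mul0r scale0r.
under eq_bigr do rewrite (raise_corep q01) eqSS -scalerA.
rewrite (sum_ord_delta_sym _ (fun m => raising_factor q0 j.+1 *: y m)).
by rewrite ltnW ?ltnS // scale1r.
Qed.

Lemma lower_weight_vector j : (j < N)%N ->
  slice delta lower (y j) = lowering_factor q0 N j *: y j.+1.
Proof.
move=> jN; rewrite (slice_weight_vector lowerD lowerZ) //; last exact: ltnW.
under eq_bigr do rewrite (lower_corep q01) -scalerA.
rewrite (sum_ord_delta_sym _ (fun m => lowering_factor q0 N j *: y m)).
by rewrite ltnS jN scale1r.
Qed.

(** If [y 0] were 0, lowering it would annihilate all the [y j] in turn. *)
Lemma weight_vector0_neq0 : y 0 != 0.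
Proof.
apply/eqP => y0; have lL := slice_lin comod lowerD lowerZ.
suff y_eq0 j : (j <= N)%N -> y j = 0.
  by have [j jN] := y_neq0; rewrite y_eq0 // eqxx.
elim: j => // j IHj jN; apply: (scalerI (lowering_factor_neq0 q01 jN)).
rewrite -lower_weight_vector // IHj ?(ltnW jN) // scaler0.
exact: (linear_fun0 lL).
Qed.

Lemma iter_raise_weight_vector a j : (j <= N)%N ->
  iter a (slice delta raise) (y j) =
  (\prod_(i < a) raising_factor q0 (j - i)) *: y (j - a)%N.
Proof.
move=> jN; have rL := slice_lin comod raiseD raiseZ.
elim: a => [|a IHa] /=; first by rewrite big_ord0 scale1r subn0.
rewrite IHa (linear_funZ rL) raise_weight_vector ?(leq_trans (leq_subr _ _)) //.
by rewrite scalerA big_ord_recr subnS.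
Qed.

(** Raising [a] times annihilates every [y j] with [j < a] and sends [y a] to a nonzero multiple of
    [y 0]; this isolates the last coefficient. *)
Lemma weight_vectors_free (mu : nat -> C) a : (a <= N.+1)%N -> \sum_(j < a) mu j *: y j = 0 ->
  forall j, (j < a)%N -> mu j = 0.
Proof.
have rL m := linear_iter m (slice_lin comod raiseD raiseZ).
elim: a => // a IHa aN; rewrite big_ord_recr /= => sum0.
suff mu_a : mu a = 0.
  move=> j; rewrite ltnS leq_eqVlt => /predU1P[->//|].
  by apply: IHa; [exact: ltnW|rewrite -[RHS]sum0 mu_a scale0r addr0].
have := congr1 (iter a (slice delta raise)) sum0.
rewrite (linear_funD (rL a)) (linear_fun0 (rL a)).
rewrite (big_morph _ (linear_funD (rL a)) (linear_fun0 (rL a))) big1 ?add0r => [|j _]; last first.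
  rewrite (linear_funZ (rL a)) iter_raise_weight_vector ?raising_prod_eq0 ?scale0r ?scaler0 //.
  by rewrite ltnW // (leq_trans (ltn_ord j)) // -ltnS ltnW.
rewrite (linear_funZ (rL a)) iter_raise_weight_vector // subnn scalerA => /eqP.
rewrite scaler_eq0 (negPf weight_vector0_neq0) orbF mulf_eq0.
by rewrite (negPf (raising_prod_neq0 q01 (leqnn a))) orbF => /eqP.
Qed.

Definition weight_tuple : N.+1.-tuple V := [tuple y j | j < N.+1].

Lemma weight_tupleE (j : 'I_N.+1) : weight_tuple`_j = y j.
Proof. by rewrite -tnth_nth tnth_mktuple. Qed.

Lemma weight_tuple_free : free weight_tuple.
Proof.
apply/freeP => k ksum j.
pose mu m := if insub m is Some i then k i else 0.
have muE (i : 'I_N.+1) : mu i = k i by rewrite /mu valK.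
rewrite -muE; apply: (weight_vectors_free (leqnn _)) => //.
by rewrite -[RHS]ksum; apply: eq_bigr => i _; rewrite muE weight_tupleE.
Qed.

(** The span is a subcomodule containing [y 0], which is nonzero; irreducibility does the rest. *)
Lemma weight_tuple_span : <<weight_tuple>>%VS = fullv.
Proof.
have [_ _ /(_ <<weight_tuple>>%VS)] := irr; case=> //.
- move=> v /coord_span ->; set mu := coord _.
  exists [seq (mu i v *: w N i l, y l) | i : 'I_N.+1 <- index_enum _, l : 'I_N.+1 <- index_enum _].
  split.
    apply/allP => p /allpairsP[[i l] /= [_ _ ->]] /=.
    by rewrite -weight_tupleE memv_span // mem_nth // size_tuple.
  rewrite big_allpairs_dep /= (big_morph _ (linear_funD delta_lin) (linear_fun0 delta_lin)).
  apply: eq_bigr => i _; rewrite (linear_funZ delta_lin) weight_tupleE dy; last by rewrite -ltnS.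
  by rewrite scaler_sumr; apply: eq_bigr => l _; rewrite tensZl.
- have mem0 : y 0 \in weight_tuple by rewrite -(weight_tupleE ord0) mem_nth // size_tuple.
  move/eqP; rewrite -subv0 => /span_subvP/(_ (y 0) mem0).
  by rewrite memv0 (negPf weight_vector0_neq0).
Qed.

Lemma weight_tuple_basis : basis_of fullv weight_tuple.
Proof. by rewrite /basis_of weight_tuple_span eqxx weight_tuple_free. Qed.

End WeightBasis.

Lemma irreducible_basis n : \dim (fullv : {vspace V}) = n.+1 ->
  exists y : n.+1.-tuple V, basis_of fullv y /\
    forall j : 'I_n.+1, delta y`_j = \sum_(l < n.+1) tens (w n j l) y`_l.
Proof.
move=> Vn; have [N [y [y0 dy]]] := weight_vectors.
have bas := weight_tuple_basis dy y0.
have Nn : N.+1 = n.+1 by rewrite -Vn -(size_basis bas).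
case: Nn => Nn; subst N.
exists (weight_tuple n y); split=> // j; rewrite weight_tupleE dy; last by rewrite -ltnS.
by apply: eq_bigr => l _; rewrite weight_tupleE.
Qed.

End IrreducibleComodule.

(** * Frames and their Chern numbers *)

Section Frames.
Variables (R : realType) (q : R) (q01 : 0 < q < 1).
Local Notation C := R[i].
Local Notation A := (O_S7 q).
Local Notation H := (O_SUq2 q).
Local Notation x2 := (S7_x q X2).
Variables (deltaR : A -> tensor A H) (deltaRP : is_S7_coaction deltaR).
Variables (eps : A -> R[i]) (epsP : is_S7_character eps).
Variables (pi : A -> ell2 R (nat * nat)%type -> ell2 R (nat * nat)%type).
Hypothesis piP : is_S7_rep pi.
Let pi_rep : bounded_star_rep pi := proj1 piP.
Let eps_hom : is_star_hom eps := proj1 epsP.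
Let delta_hom := proj1 deltaRP.
Local Notation B := (coinvariants deltaR).
Local Notation J := (trace_ideal pi x2).
Local Notation tr := (dtrace pi).

Lemma coinvariant1 : B 1.
Proof. exact: (star_hom1 delta_hom). Qed.

Lemma coinvariantD b b' : B b -> B b' -> B (b + b').
Proof. by move=> Bb Bb'; rewrite /coinvariants /= (star_homD delta_hom) Bb Bb' tensDl. Qed.

Lemma coinvariantZ c b : B b -> B (c *: b).
Proof. by move=> Bb; rewrite /coinvariants /= (star_homZ delta_hom) Bb tensZl. Qed.

Lemma coinvariant0 : B 0.
Proof. by rewrite -(scale0r (1 : A)); apply: coinvariantZ; exact: coinvariant1. Qed.

Lemma coinvariantM b b' : B b -> B b' -> B (b * b').
Proof.
move=> Bb Bb'; rewrite /coinvariants /= (star_homM delta_hom) Bb Bb'.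
by rewrite [LHS]tens_mul mul1r.
Qed.

Lemma coinvariant_sum I (r : seq I) (P : pred I) (F : I -> A) :
  (forall i, B (F i)) -> B (\sum_(i <- r | P i) F i).
Proof. by move=> BF; apply: big_ind => //; [exact: coinvariant0|exact: coinvariantD]. Qed.

Definition chern_number (b : A) : C := tr (b - eps b *: (1 : A)).
Local Notation ch := chern_number.

Lemma ch_ideal b : B b -> J (b - eps b *: (1 : A)).
Proof. exact: coinvariant_trace_ideal. Qed.

Let d01 := weight01 q01.
Let d_summable := weight_summable q01.

Lemma chD b b' : B b -> B b' -> ch (b + b') = ch b + ch b'.
Proof.
move=> Bb Bb'; rewrite /chern_number -(dtraceD pi_rep (pi_x2 piP) d01 d_summable (ch_ideal Bb) (ch_ideal Bb')).
by rewrite (star_homD eps_hom) scalerDl opprD addrACA.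
Qed.

Lemma ch_scalar c : ch (c *: (1 : A)) = 0.
Proof.
rewrite /chern_number (star_homZ eps_hom) (star_hom1 eps_hom).
rewrite (_ : c *: (1 : C) = c) ?subrr; last exact: mulr1.
exact: (dtrace0 pi_rep (pi_x2 piP) d01 d_summable).
Qed.

Lemma ch_sum I (r : seq I) (F : I -> A) :
  (forall i, B (F i)) -> ch (\sum_(i <- r) F i) = \sum_(i <- r) ch (F i).
Proof.
move=> BF; elim: r => [|i r IHr]; first by rewrite !big_nil -(scale0r (1 : A)) ch_scalar.
by rewrite !big_cons chD ?IHr //; exact: coinvariant_sum.
Qed.

(** With [b0 = b - eps b] and [b0' = b' - eps b'], both products minus their value under [eps] are,
    up to order, [b0 b' + eps b b0']. The first term is in the ideal, where the trace is cyclic. *)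
Lemma chC b b' : B b -> B b' -> ch (b * b') = ch (b' * b).
Proof.
move=> Bb Bb'; have Jb := ch_ideal Bb.
have split_ch c (x : A) : x - eps x *: (1 : A) = c + eps b *: (b' - eps b' *: (1 : A)) ->
    J c -> ch x = tr c + eps b * ch b'.
  move=> E Jc; have Jb' := ch_ideal Bb'; have JZ := trace_idealZ pi_rep (eps b) Jb'.
  rewrite /chern_number E (dtraceD pi_rep (pi_x2 piP) d01 d_summable Jc JZ).
  by rewrite (dtraceZ pi_rep (pi_x2 piP) d01 d_summable _ Jb').
have E1 : b * b' - eps (b * b') *: (1 : A) =
    (b - eps b *: (1 : A)) * b' + eps b *: (b' - eps b' *: (1 : A)).
  rewrite (star_homM eps_hom) mulrBl scale_mulrl mul1r scalerBr scalerA.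
  by rewrite addrA subrK.
have E2 : b' * b - eps (b' * b) *: (1 : A) =
    b' * (b - eps b *: (1 : A)) + eps b *: (b' - eps b' *: (1 : A)).
  rewrite (star_homM eps_hom) mulrBr scale_mulrr mulr1 scalerBr scalerA.
  by rewrite addrA subrK mulrC.
rewrite (split_ch _ _ E1); last exact: (trace_idealMr pi_rep (S7_normal q01 piP)).
rewrite (split_ch _ _ E2); last exact: trace_idealMl.
by congr (_ + _); apply: esym; exact: (dtrace_comm q01 piP _ Jb).
Qed.

Lemma ch_exchange (I I' : finType) (b : I -> I' -> A) (b' : I' -> I -> A) :
  (forall i j, B (b i j)) -> (forall i j, B (b' i j)) ->
  ch (\sum_i \sum_j b i j * b' j i) = ch (\sum_j \sum_i b' j i * b i j).
Proof.
move=> Bb Bb'; have BM i j := coinvariantM (Bb i j) (Bb' j i).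
have BM' i j := coinvariantM (Bb' j i) (Bb i j).
rewrite ch_sum => [|i]; last exact: coinvariant_sum.
rewrite [RHS]ch_sum => [|j]; last exact: coinvariant_sum.
under eq_bigr do rewrite ch_sum //.
under [RHS]eq_bigr do rewrite ch_sum //.
rewrite exchange_big /=; apply: eq_bigr => j _; apply: eq_bigr => i _.
exact: chC.
Qed.

Definition equivariant (I : finType) (t : I -> I -> H) (e : I -> A) : Prop :=
  forall k, deltaR (e k) = \sum_l tens (e l) (t l k).

(* The pairing condition replaces the covariance of v under the contragredient of t. *)
Record frame (I N : finType) (t : I -> I -> H) (w v : N -> I -> A) : Prop := Frame {
  frame_equivariant : forall j, equivariant t (w j);
  frame_pairing : forall j e, equivariant t e -> B (\sum_k v j k * e k);
  frame_unit : forall k m, \sum_j w j k * v j m = (k == m)%:R *: (1 : A)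
}.

Definition frame_trace (I N : finType) (w v : N -> I -> A) : A :=
  \sum_j \sum_k v j k * w j k.

Lemma frame_trace_coinvariant I N t w v : @frame I N t w v -> B (frame_trace w v).
Proof.
move=> F; apply: coinvariant_sum => j; apply: (frame_pairing F).
exact: (frame_equivariant F).
Qed.

(** The values of [eps] commute, so [v w] may be replaced by [w v], which is 1 for each index. *)
Lemma eps_frame_trace I N t w v : @frame I N t w v -> eps (frame_trace w v) = #|I|%:R.
Proof.
move=> F; transitivity (\sum_(k : I) (1 : C)); last by rewrite sumr_const.
rewrite /frame_trace (star_hom_sum eps_hom).
under eq_bigr do rewrite (star_hom_sum eps_hom).
rewrite exchange_big /=; apply: eq_bigr => k _; have := congr1 eps (frame_unit F k k).
rewrite eqxx scale1r (star_hom_sum eps_hom) (star_hom1 eps_hom) => <-.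
by apply: eq_bigr => j _; rewrite !(star_homM eps_hom) mulrC.
Qed.

(* With the coinvariants b_jj' = sum_k v_j^k w'_j'^k and b'_j'j = sum_k v'_j'^k w_j^k,
   the two traces are the sums of the b b' and of the b' b. *)
Lemma frame_trace_unique I N N' t w v w' v' :
  @frame I N t w v -> @frame I N' t w' v' -> ch (frame_trace w v) = ch (frame_trace w' v').
Proof.
move=> F F'.
have expand (M M' : finType) (u s : M -> I -> A) (u' s' : M' -> I -> A) : frame t u' s' ->
    frame_trace u s =
    \sum_j \sum_j' (\sum_k s j k * u' j' k) * (\sum_m s' j' m * u j m).
  move=> F1; apply: eq_bigr => j _.
  under [RHS]eq_bigr do rewrite mulr_suml; rewrite exchange_big /=; apply: eq_bigr => k _.
  under [RHS]eq_bigr do rewrite mulr_sumr; rewrite exchange_big /=.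
  have inner m : \sum_j' s j k * u' j' k * (s' j' m * u j m) =
      s j k * ((k == m)%:R *: u j m).
    transitivity (s j k * ((\sum_j' u' j' k * s' j' m) * u j m)).
      rewrite mulr_suml mulr_sumr; apply: eq_bigr => j' _; by rewrite !mulrA.
    by rewrite (frame_unit F1) scale_mulrl mul1r.
  under [RHS]eq_bigr do rewrite inner.
  rewrite [RHS](bigD1 k) //= eqxx scale1r big1 ?addr0 // => m mk.
  by rewrite eq_sym (negPf mk) scale0r mulr0.
rewrite (expand _ _ _ _ _ _ F') (expand _ _ _ _ _ _ F) ch_exchange //.
- by move=> i j; apply: (frame_pairing F); exact: (frame_equivariant F').
- by move=> i j; apply: (frame_pairing F'); exact: (frame_equivariant F).
Qed.

Section Transfer.
Variables (I I' N : finType) (t : I -> I -> H) (t' : I' -> I' -> H) (w v : N -> I -> A).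
Variables (X : I -> I' -> C) (Y : I' -> I -> C).

Definition transfer_w (j : N) (m : I') : A := \sum_i X i m *: w j i.
Definition transfer_v (j : N) (m : I') : A := \sum_i Y m i *: v j i.

(** [X] carries [w], and [Y] carries [v]: being an intertwiner, [Y] turns an equivariant family for
    [t'] into one for [t], with which [v] pairs. *)
Lemma frame_transfer : frame t w v -> intertwines_cols X t t' -> intertwines_rows Y t t' ->
  (forall m m', \sum_i Y m i * X i m' = (m == m')%:R) -> frame t' transfer_w transfer_v.
Proof.
move=> F tX Yt YX; split.
- move=> j m; rewrite /transfer_w (star_hom_sum delta_hom).
  under eq_bigr do rewrite (star_homZ delta_hom) (frame_equivariant F) scaler_sumr.
  rewrite exchange_big /=.
  under [RHS]eq_bigr do rewrite tens_suml.
  rewrite [RHS]exchange_big /=; apply: eq_bigr => l _.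
  under eq_bigr do rewrite -tensZr.
  under [RHS]eq_bigr do rewrite tensZl -tensZr.
  by rewrite -!tens_sumr tX.
- move=> j e te; rewrite /transfer_v.
  pose e' i := \sum_m Y m i *: e m.
  have -> : \sum_m (\sum_i Y m i *: v j i) * e m = \sum_i v j i * e' i.
    under eq_bigr do rewrite mulr_suml; rewrite exchange_big /=; apply: eq_bigr => i _.
    rewrite mulr_sumr; apply: eq_bigr => m _.
    by rewrite scale_mulrl scale_mulrr.
  apply: (frame_pairing F) => i; rewrite /e' (star_hom_sum delta_hom).
  under eq_bigr do rewrite (star_homZ delta_hom) te scaler_sumr.
  rewrite exchange_big /=.
  under [RHS]eq_bigr do rewrite tens_suml.
  rewrite [RHS]exchange_big /=; apply: eq_bigr => m _.
  under eq_bigr do rewrite -tensZr.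
  under [RHS]eq_bigr do rewrite tensZl -tensZr.
  by rewrite -!tens_sumr Yt.
- move=> k m; rewrite /transfer_w /transfer_v.
  under eq_bigr do rewrite mulr_suml.
  rewrite exchange_big /=.
  under eq_bigr => i _.
    under eq_bigr do rewrite mulr_sumr.
    rewrite exchange_big /=.
    under eq_bigr => i' _.
      under eq_bigr do rewrite scale_mulrl scale_mulrr scalerA.
      rewrite -scaler_sumr (frame_unit F) scalerA.
      over.
    over.
  rewrite [k == m]eq_sym -YX scaler_suml; apply: eq_bigr => i _.
  rewrite (bigD1 i) //= eqxx mulr1 big1 ?addr0 => [|i' i'i]; first by congr (_ *: _); exact: mulrC.
  by rewrite eq_sym (negPf i'i) mulr0 scale0r.
Qed.

End Transfer.

Lemma frame_trace_splitting (I I1 I2 N : finType) (w v : N -> I -> A)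
    (X1 : I -> I1 -> C) Y1 (X2 : I -> I2 -> C) Y2 : splitting X1 Y1 X2 Y2 ->
  frame_trace w v = frame_trace (transfer_w w X1) (transfer_v v Y1) +
    frame_trace (transfer_w w X2) (transfer_v v Y2).
Proof.
move=> XY; rewrite /frame_trace -big_split; apply: eq_bigr => j _ /=.
have expand (I' : finType) (X : I -> I' -> C) Y : \sum_m transfer_v v Y j m * transfer_w w X j m =
    \sum_i \sum_i' (\sum_m X i' m * Y m i) *: (v j i * w j i').
  rewrite /transfer_v /transfer_w.
  under eq_bigr do rewrite mulr_suml; rewrite exchange_big /=; apply: eq_bigr => i _.
  under eq_bigr do rewrite mulr_sumr; rewrite exchange_big /=; apply: eq_bigr => i' _.
  rewrite scaler_suml; apply: eq_bigr => m _.
  by rewrite scale_mulrl scale_mulrr scalerA [X i' m * _]mulrC.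
rewrite !expand -big_split; apply: eq_bigr => i _ /=.
rewrite -big_split (bigD1 i) //= -scalerDl (splitting1 XY) eqxx scale1r.
rewrite big1 ?addr0 // => i' i'i.
by rewrite -scalerDl (splitting1 XY) (negPf i'i) scale0r.
Qed.

End Frames.

(** * The frame given by the matrix u *)

Section TensorByU.
Variables (R : realType) (q : R) (q01 : 0 < q < 1).
Local Notation C := R[i].
Local Notation qC := (q%:C%C).
Local Notation A := (O_S7 q).
Local Notation H := (O_SUq2 q).
Local Notation x1 := (S7_x q X1).
Local Notation x2 := (S7_x q X2).
Local Notation x3 := (S7_x q X3).
Local Notation x4 := (S7_x q X4).
Local Notation u := (S7_u q).
Local Notation T := (SUq2_T q).
Variables (deltaR : A -> tensor A H) (deltaRP : is_S7_coaction deltaR).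
Let delta_hom := proj1 deltaRP.
Local Notation AH := (tensor A H : starAlgType C).
Local Notation equivariant := (equivariant deltaR).

Let qN0 : qC != 0 := qC_neq0 q01.
Let conj_q : qC^* = qC. Proof. exact: conj_real. Qed.
Let conj_qX n : (qC ^+ n)^* = qC ^+ n. Proof. by rewrite rmorphXn /= conj_q. Qed.

(* Weights that make u and its adjoint mutually inverse, by the two sphere relations. *)
Definition u_left (i : 'I_4) : C := nth 0 [:: qC ^+ 4; (qC ^+ 2)^-1; qC ^+ 2; 1] i.
Definition u_right (k : 'I_2) : C := if k == 0 :> nat then 1 else (qC ^+ 2)^-1.
Definition uw i k : A := u_left i *: u i k.
Definition uv i k : A := u_right k *: (u i k)^*s.

Lemma uw_equivariant i : equivariant T (uw i).
Proof.
move=> k; rewrite /uw (star_homZ delta_hom) (proj2 deltaRP) scaler_sumr.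
by apply: eq_bigr => l _; rewrite tensZl.
Qed.

Lemma delta_uv i k : deltaR (uv i k) = u_right k *: \sum_l tens (u i l)^*s (T l k)^*s.
Proof.
rewrite /uv (star_homZ delta_hom) (star_homS delta_hom) (proj2 deltaRP); congr (_ *: _).
rewrite [LHS](@star_sum _ AH); apply: eq_bigr => l _; exact: tens_star.
Qed.

(** The relation [T T^* = 1] with its factors in the opposite order; the weights 1 and [q^-2] make
    up for noncommutativity. *)
Lemma T_contragredient l i :
  \sum_k u_right k *: ((T l k)^*s * T i k) = ((l == i)%:R * u_right l) *: (1 : H).
Proof.
have conj_Nq : (- qC)^* = - qC by rewrite rmorphN /= conj_q.
have E := (mulE H, starE H, conj_Nq, conj_q, @scale1r C H, @scale0r C H).
have TT := @SUq2_TT R q.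
have h00 := TT ord0 ord0; have h01 := TT ord0 ord_max; have h10 := TT ord_max ord0.
have h11 := TT ord_max ord_max; rewrite big_ord_recl big_ord1.
move: h00 h01 h10 h11; rewrite !SUq2_T_mat /u_right /matT /= !E.
move: (presented_gen _ Alpha : H) (presented_gen _ Gamma : H) => a c h00 h01 h10 h11.
have lin1 := @eq_lin1 C H.
case: l i => [[|[|//]] /= ?] [[|[|//]] /= ?]; rewrite ?E ?mul0r ?mul1r.
- by apply: (lin1 1 _ _ _ _ h11); rewrite ?E; linear_eq R[i] (O_SUq2 q); field.
- by apply: (lin1 (- qC^-1) _ _ _ _ h10); rewrite ?E; linear_eq R[i] (O_SUq2 q); field.
- by apply: (lin1 (- qC^-1) _ _ _ _ h01); rewrite ?E; linear_eq R[i] (O_SUq2 q); field.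
- by apply: (lin1 (qC ^+ 2)^-1 _ _ _ _ h00); rewrite ?E; linear_eq R[i] (O_SUq2 q); field.
Qed.

Lemma sum_ord4 (W : nmodType) (F : 'I_4 -> W) :
  \sum_i F i = F ord0 + F (inord 1) + F (inord 2) + F (inord 3).
Proof.
rewrite !big_ord_recl big_ord0 addr0 !addrA; congr (_ + _ + _ + _); congr (F _);
  by apply: val_inj; rewrite /= ?inordK.
Qed.

Local Notation SE := (mulE A, starE A, conj_q, conj_qX, @scale1r C A,
  @scale0r C A, opprK, @opprD A, @scalerBr C A, mulr1, mul1r).

Let x44s : x4 * x4^*s = 1 - x1 * x1^*s - x2 * x2^*s - x3 * x3^*s.
Proof. by rewrite -(S7_sphere (S7_familyP q)); linear_eq R[i] (O_S7 q); ring. Qed.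

Let x4s4 : x4^*s * x4 = 1 - qC ^+ 8 *: (x1^*s * x1) - qC ^+ 6 *: (x2^*s * x2)
  - qC ^+ 2 *: (x3^*s * x3).
Proof. by rewrite -(S7_sphere_star (S7_familyP q)); linear_eq R[i] (O_S7 q); ring. Qed.

Lemma u_unit k m : \sum_i uw i k * uv i m = (k == m)%:R *: (1 : A).
Proof.
have [r11 r12 r22 r33 r34 r34s sph sphs] := S7_familyP q.
have conj_N1 : (-1 : C)^* = -1 by rewrite rmorphN1.
have r21 : x2^*s * x1 = qC *: (x1 * x2^*s).
  by have := congr1 star r12; rewrite !(starE A, conj_q).
have r43 : x4^*s * x3 = qC *: (x3 * x4^*s) - (qC ^+ 4 * (qC - qC^-1)) *: (x1 * x2^*s).
  have conj_c : (qC ^+ 4 * (qC - qC^-1))^* = qC ^+ 4 * (qC - qC^-1).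
    by rewrite rmorphM rmorphB fmorphV /= conj_q conj_qX.
  by have := congr1 star r34s; rewrite !(starE A, conj_q, conj_N1, conj_c, mulN1r, scaleNr, scale1r).
rewrite sum_ord4 /uw /uv !S7_uE /u_left /u_right /= !inordK //=.
case: k m => [[|[|//]] /= ?] [[|[|//]] /= ?]; rewrite ?(SE, conj_N1).
- by rewrite x4s4 r33 r22 r11; linear_eq R[i] (O_S7 q); field; exact: qN0.
- by rewrite r21 r43; linear_eq R[i] (O_S7 q); field; exact: qN0.
- by rewrite r12 r34s; linear_eq R[i] (O_S7 q); field; exact: qN0.
- by rewrite x44s r33 r11; linear_eq R[i] (O_S7 q); field; exact: qN0.
Qed.

Definition u_trace : A := \sum_i \sum_k uv i k * uw i k.

(** The constant is the inverse of the trace of [x2 x2^*s], which makes the Chern number -1. *)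
Lemma u_traceE : u_trace = 2%:R *: (1 : A) -
  ((1 - qC ^+ 2) * (1 - qC ^+ 4)) *: (x1 * x1^*s + x2 * x2^*s).
Proof.
have [r11 r12 r22 r33 r34 r34s sph sphs] := S7_familyP q.
rewrite /u_trace sum_ord4 !big_ord_recl !big_ord0 /uw /uv !S7_uE /u_left /u_right /= !inordK //=.
rewrite !addr0 !SE x4s4 x44s r33 r22 r11; linear_eq R[i] (O_S7 q); field; exact: qN0.
Qed.

End TensorByU.

Lemma sum_pair (V : nmodType) (I1 I2 : finType) (F : I1 * I2 -> V) :
  \sum_p F p = \sum_i \sum_j F (i, j).
Proof. by rewrite pair_bigA; apply: eq_bigr => [[i j]]. Qed.

(** * Tensor product of a frame with u *)

Section ProductFrame.
Variables (R : realType) (q : R) (q01 : 0 < q < 1).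
Local Notation C := R[i].
Local Notation qC := (q%:C%C).
Local Notation A := (O_S7 q).
Local Notation H := (O_SUq2 q).
Local Notation x2 := (S7_x q X2).
Local Notation u := (S7_u q).
Local Notation T := (SUq2_T q).
Local Notation uw := (@uw R q).
Local Notation uv := (@uv R q).
Variables (deltaR : A -> tensor A H) (deltaRP : is_S7_coaction deltaR).
Variables (eps : A -> R[i]) (epsP : is_S7_character eps).
Variables (pi : A -> ell2 R (nat * nat)%type -> ell2 R (nat * nat)%type).
Hypothesis piP : is_S7_rep pi.
Let pi_rep : bounded_star_rep pi := proj1 piP.
Let delta_hom := proj1 deltaRP.
Local Notation B := (coinvariants deltaR).
Local Notation J := (trace_ideal pi x2).
Local Notation tr := (dtrace pi).
Local Notation AH := (tensor A H : starAlgType C).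
Local Notation ch := (chern_number eps pi).
Local Notation frame := (frame deltaR).
Local Notation equivariant := (equivariant deltaR).
Let d01 := weight01 q01.
Let d_summable := weight_summable q01.

Variables (I N : finType) (t : I -> I -> H) (w v : N -> I -> A).
Hypothesis F : frame t w v.

Definition prod_t (p p' : 'I_2 * I) : H := T p.1 p'.1 * t p.2 p'.2.
Definition prod_w (j : 'I_4 * N) (p : 'I_2 * I) : A := uw j.1 p.1 * w j.2 p.2.
(** The order is reversed with respect to [prod_w], so that the sum of the [w v] collapses between
    [uw] and [uv]. *)
Definition prod_v (j : 'I_4 * N) (p : 'I_2 * I) : A := v j.2 p.2 * uv j.1 p.1.

Lemma tens_mul_sum (I1 I2 : finType) (f : I1 -> A) (f' : I1 -> H) (g : I2 -> A) (g' : I2 -> H) :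
  ((\sum_i tens (f i) (f' i) : AH) * (\sum_j tens (g j) (g' j) : AH) : AH) =
  \sum_i \sum_j tens (f i * g j) (f' i * g' j).
Proof.
rewrite [LHS]mulr_suml; apply: eq_bigr => i _; rewrite [LHS]mulr_sumr; apply: eq_bigr => j _.
exact: tens_mul.
Qed.

Lemma prod_w_equivariant j : equivariant prod_t (prod_w j).
Proof.
move=> k; rewrite /prod_w (star_homM delta_hom) (uw_equivariant deltaRP) (frame_equivariant F).
by rewrite tens_mul_sum pair_bigA.
Qed.

(** Contraction with [uv] removes the V_1 leg: [T_contragredient] cancels the entries of [T]
    contributed by [uv] and by [e]. *)
Lemma contraction_equivariant i (e : 'I_2 * I -> A) : equivariant prod_t e ->
  equivariant t (fun k => \sum_a uv i a * e (a, k)).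
Proof.
move=> te k; rewrite (star_hom_sum delta_hom).
pose f l (p : 'I_2 * I) : AH := tens ((u i l)^*s * e p)
  (\sum_a u_right q a *: ((T l a)^*s * T p.1 a * t p.2 k)).
have E a : deltaR (uv i a * e (a, k)) = \sum_l \sum_p tens ((u i l)^*s * e p)
    (u_right q a *: ((T l a)^*s * T p.1 a * t p.2 k)).
  rewrite (star_homM delta_hom) (delta_uv deltaRP) te.
  rewrite [LHS](scale_mulrl (A := AH)) [X in _ *: X]tens_mul_sum scaler_sumr.
  apply: eq_bigr => l _; rewrite scaler_sumr; apply: eq_bigr => p _.
  by rewrite -tensZr /prod_t /= mulrA.
transitivity (\sum_l \sum_p f l p).
  under eq_bigr do rewrite E.
  rewrite exchange_big; apply: eq_bigr => l _; rewrite exchange_big; apply: eq_bigr => p _.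
  by rewrite /f tens_sumr.
have Ef l p : f l p = (l == p.1)%:R *: tens (uv i p.1 * e p) (t p.2 k).
  rewrite /f; have -> : \sum_a u_right q a *: ((T l a)^*s * T p.1 a * t p.2 k) =
      ((l == p.1)%:R * u_right q l) *: t p.2 k.
    rewrite -[in RHS](mul1r (t _ _)) -scale_mulrl -(T_contragredient q01) mulr_suml.
    by apply: eq_bigr => a _; rewrite scale_mulrl.
  have [->|_] := eqVneq l p.1; last by rewrite mul0r !scale0r tens0r.
  by rewrite mul1r scale1r tensZr -tensZl -scale_mulrl.
under eq_bigr do under eq_bigr do rewrite Ef.
rewrite exchange_big /=.
have Ep (p : 'I_2 * I) : \sum_(l < 2) (l == p.1)%:R *: tens (uv i p.1 * e p) (t p.2 k) =
    tens (uv i p.1 * e p) (t p.2 k).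
  rewrite (bigD1 p.1) //= eqxx scale1r big1 ?addr0 // => l /negPf ->.
  by rewrite scale0r.
under eq_bigr do rewrite Ep.
rewrite sum_pair exchange_big /=.
by apply: eq_bigr => m _; rewrite -tens_suml.
Qed.

Lemma prod_frame : frame prod_t prod_w prod_v.
Proof.
split; first exact: prod_w_equivariant.
- move=> j e te; have := frame_pairing F j.2 (contraction_equivariant j.1 te).
  congr (B _); rewrite sum_pair exchange_big /=.
  by apply: eq_bigr => k _; rewrite mulr_sumr; apply: eq_bigr => a _; rewrite mulrA.
- move=> [a k] [b m]; rewrite /prod_w /prod_v.
  rewrite sum_pair /=.
  have E i : \sum_j uw i a * w j k * (v j m * uv i b) = (k == m)%:R *: (uw i a * uv i b).
    transitivity (uw i a * (\sum_j w j k * v j m) * uv i b).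
      by rewrite mulr_sumr mulr_suml; apply: eq_bigr => j _; rewrite !mulrA.
    by rewrite (frame_unit F) [X in X * _](scale_mulrr _ (uw i a)) mulr1 [LHS]scale_mulrl.
  under eq_bigr do rewrite E.
  rewrite -scaler_sumr (u_unit q01) scalerA -natrM mulnb xpair_eqE andbC.
  by [].
Qed.

Local Notation theta := (u_trace q).
Local Notation theta' := (theta - 2%:R *: (1 : A)).

Lemma prod_frame_trace : frame_trace prod_w prod_v = \sum_j \sum_k v j k * theta * w j k.
Proof.
rewrite /frame_trace /prod_w /prod_v /=.
rewrite sum_pair exchange_big /=; apply: eq_bigr => j _.
have E i : \sum_(p : 'I_2 * I) v j p.2 * uv i p.1 * (uw i p.1 * w j p.2) =
    \sum_k v j k * (\sum_a uv i a * uw i a) * w j k.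
  rewrite sum_pair exchange_big /=.
  apply: eq_bigr => k _; rewrite mulr_sumr mulr_suml; apply: eq_bigr => a _.
  by rewrite !mulrA.
under eq_bigr do rewrite E.
rewrite exchange_big /=; apply: eq_bigr => k _.
by rewrite /u_trace [in RHS]mulr_sumr [RHS]mulr_suml.
Qed.

Lemma trace_ideal_theta : J theta'.
Proof.
have Jx x : J x -> J (x * x^*s).
  by move=> Jx; apply: (trace_idealMr pi_rep (S7_normal q01 piP)).
rewrite (u_traceE q01) addrAC subrr add0r -scaleNr; apply: trace_idealZ => //.
by apply: trace_idealD => //; apply: Jx; [exact: trace_ideal_x1|exact: trace_ideal_x2].
Qed.

Lemma dtrace_theta : tr theta' = -1.
Proof.
have Jx x : J x -> J (x * x^*s).
  by move=> Jx; apply: (trace_idealMr pi_rep (S7_normal q01 piP)).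
have J1 := Jx _ (trace_ideal_x1 piP); have J2 := Jx _ (trace_ideal_x2 pi).
have J12 := trace_idealD pi_rep J1 J2.
rewrite (u_traceE q01) addrAC subrr add0r -scaleNr.
rewrite (dtraceZ pi_rep (pi_x2 piP) d01 d_summable _ J12).
rewrite (dtraceD pi_rep (pi_x2 piP) d01 d_summable J1 J2).
rewrite (dtrace_x1x1s q01 piP) (dtrace_x2x2s q01 piP) add0r.
have one_sub_neq0 n : (0 < n)%N -> 1 - q ^+ n != 0.
  move=> n0; case/andP: q01 => q0 q1.
  by rewrite subr_eq0 eq_sym lt_eqF // exprn_ilt1 // ?ltW // -lt0n.
have -> : (1 - qC ^+ 2) * (1 - qC ^+ 4) = ((1 - q ^+ 2) * (1 - q ^+ 4))%:C%C.
  by rewrite rmorphM !rmorphB !rmorphXn !rmorph1.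
by rewrite mulNr -rmorphM mulrACA !divff ?one_sub_neq0 ?mulr1 ?rmorph1.
Qed.

(** Split [v theta w] into [v theta' w + 2 v w]. The first part is in the ideal, so [v] moves
    cyclically to the end and [frame_unit] leaves [theta'] alone. *)
Lemma ch_prod_frame :
  ch (frame_trace prod_w prod_v) = 2%:R * ch (frame_trace w v) - #|I|%:R.
Proof.
have Jt := trace_ideal_theta; have FB := frame_trace_coinvariant deltaRP F.
have Jn := ch_ideal q01 deltaRP epsP piP FB.
have Jw j k : J (theta' * w j k) by apply: (trace_idealMr pi_rep (S7_normal q01 piP)).
have Jvw j k : J (v j k * (theta' * w j k)) by apply: trace_idealMl.
have Jk k : J (\sum_j v j k * (theta' * w j k)).
  by apply: (big_ind J) => // [|x y]; [exact: trace_ideal0|exact: trace_idealD].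
rewrite /chern_number (eps_frame_trace epsP prod_frame) card_prod card_ord natrM.
rewrite (eps_frame_trace epsP F).
have -> : frame_trace prod_w prod_v - (2%:R * #|I|%:R) *: (1 : A) =
   \sum_k \sum_j v j k * (theta' * w j k) +
   2%:R *: (frame_trace w v - #|I|%:R *: (1 : A)).
  rewrite scalerBr scalerA addrA; congr (_ - _).
  have -> : frame_trace w v = \sum_k \sum_j v j k * w j k by exact: exchange_big.
  rewrite prod_frame_trace exchange_big /= scaler_sumr.
  apply: esym; apply: (eq_trans (esym (big_split _ _ _ _ _))); apply: eq_bigr => k _.
  rewrite scaler_sumr; apply: (eq_trans (esym (big_split _ _ _ _ _))); apply: eq_bigr => j _ /=.
  have -> : theta' * w j k = theta * w j k - 2%:R *: w j k.
    by rewrite mulrBl; congr (_ - _); rewrite scale_mulrl; congr (_ *: _); exact: mul1r.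
  have -> : v j k * (theta * w j k - 2%:R *: w j k) = v j k * theta * w j k - 2%:R *: (v j k * w j k).
    by rewrite -mulrA -scale_mulrr; exact: mulrBr.
  by rewrite subrK.
have JS : J (\sum_k \sum_j v j k * (theta' * w j k)) by apply: trace_ideal_sumr.
have J2 := trace_idealZ pi_rep 2%:R Jn; rewrite (eps_frame_trace epsP F) in Jn J2.
rewrite (dtraceD pi_rep (pi_x2 piP) d01 d_summable JS J2).
rewrite (dtraceZ pi_rep (pi_x2 piP) d01 d_summable _ Jn) addrC; congr (_ + _).
rewrite (dtrace_sum pi_rep (pi_x2 piP) d01 d_summable) //.
rewrite -sumr_const -sumrN; apply: eq_bigr => k _.
have Jwv j : J (theta' * w j k * v j k) by apply: (trace_idealMr pi_rep (S7_normal q01 piP)).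
rewrite (dtrace_sum pi_rep (pi_x2 piP) d01 d_summable) //.
under eq_bigr do rewrite (dtrace_comm q01 piP _ (Jw _ k)).
rewrite -(dtrace_sum pi_rep (pi_x2 piP) d01 d_summable) //.
rewrite -dtrace_theta; congr (tr _).
transitivity (theta' * (\sum_j w j k * v j k)).
  by rewrite mulr_sumr; apply: eq_bigr => j _; rewrite mulrA.
by rewrite (frame_unit F) eqxx scale1r mulr1.
Qed.

End ProductFrame.

(** * The recurrence for the Chern numbers *)

Section FrameInduction.
Variables (R : realType) (q : R) (q01 : 0 < q < 1).
Local Notation C := R[i].
Local Notation qC := (q%:C%C).
Local Notation A := (O_S7 q).
Local Notation H := (O_SUq2 q).
Local Notation alpha := (presented_gen (@SUq2_rel R q) Alpha : H).
Local Notation gamma := (presented_gen (@SUq2_rel R q) Gamma : H).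
Local Notation t d := (@corep_mx _ H qC alpha (- qC *: gamma^*s) gamma alpha^*s d).
Variables (deltaR : A -> tensor A H) (deltaRP : is_S7_coaction deltaR).
Variables (eps : A -> R[i]) (epsP : is_S7_character eps).
Variables (pi : A -> ell2 R (nat * nat)%type -> ell2 R (nat * nat)%type).
Hypothesis piP : is_S7_rep pi.
Local Notation ch := (chern_number eps pi).
Local Notation frame := (frame deltaR).

(** Minus the binomial coefficient of [d + 1] over 3, the solution of
    [c(d+1) - 2 c(d) + c(d-1) = - d] with [c(0) = c(1) = 0]. *)
Definition ch_value (d : nat) : C := - ((d%:R - 1) * d%:R * (d%:R + 1) / 6%:R).

Definition has_frame (d : nat) : Prop :=
  exists (N : finType) (w v : N -> 'I_d -> A),
    frame (t d) w v /\ ch (frame_trace w v) = ch_value d.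

(** The recurrence reaches back two dimensions, hence starts from the empty frame of the zero
    corepresentation. *)
Lemma has_frame0 : has_frame 0.
Proof.
exists 'I_0, (fun _ _ => 0), (fun _ _ => 0); split.
  split=> [j [] //|j e _|[] //]; rewrite big_ord0; exact: coinvariant0.
rewrite /frame_trace big_ord0 -(scale0r (1 : A)) (ch_scalar q01 epsP piP).
by rewrite /ch_value mulr0 !mul0r oppr0.
Qed.

Lemma has_frame1 : has_frame 1.
Proof.
exists 'I_1, (fun _ _ => 1), (fun _ _ => 1); split.
  split.
  - move=> j k; rewrite big_ord1 !ord1 /corep_mx /=; exact: coinvariant1.
  - move=> j e te; rewrite big_ord1 mul1r /coinvariants /=.
    by rewrite te big_ord1.
  - by move=> k m; rewrite !ord1 eqxx scale1r big_ord1 mulr1.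
rewrite /frame_trace !big_ord1 mulr1 -(scale1r (1 : A)).
by rewrite (ch_scalar q01 epsP piP) /ch_value subrr !mul0r oppr0.
Qed.

Lemma has_frame_step n : has_frame n -> has_frame n.+1 -> has_frame n.+2.
Proof.
move=> [N' [w' [v' [F' ch']]]] [N [w [v [F chF]]]].
have PF := prod_frame q01 deltaRP F.
have fam := SUq2_family q01; have qN0 := qC_neq0 q01; have D0 := cB_neq0 q01 n.
have XY := cg_splitting qN0 D0.
have tensE : prod_t (t n.+1) = @tensor_mx _ H qC alpha (- qC *: gamma^*s) gamma alpha^*s n.+1.
  by apply/funext => p; apply/funext => p'; rewrite /prod_t SUq2_T_mat.
rewrite tensE in PF.
have Y1 := @cg_rows1 _ _ _ _ _ _ _ fam qN0 n; have Y2 := @cg_rows2 _ _ _ _ _ _ _ fam qN0 n.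
have F1 := frame_transfer deltaRP PF (splitting_cols1 XY Y1 Y2) Y1 (splitting11 XY).
have F2 := frame_transfer deltaRP PF (splitting_cols2 XY Y1 Y2) Y2 (splitting22 XY).
have := ch_prod_frame q01 deltaRP epsP piP F.
rewrite (frame_trace_splitting _ _ XY) (chD q01 deltaRP epsP piP); last 2 first.
- exact: (frame_trace_coinvariant deltaRP F1).
- exact: (frame_trace_coinvariant deltaRP F2).
(* The frame cut out on the smaller summand is not the given one, but has the same Chern number. *)
rewrite (frame_trace_unique q01 deltaRP epsP piP F2 F') ch' chF card_ord => E.
eexists; eexists; eexists; split; first exact: F1.
apply: (addIr (ch_value n)); rewrite E /ch_value -!natr1.
by field.
Qed.

Lemma has_frameP n : has_frame n.
Proof.
suff [] : has_frame n /\ has_frame n.+1 by [].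
elim: n => [|n [IHn IHn1]]; first by split; [exact: has_frame0|exact: has_frame1].
by split=> //; exact: has_frame_step.
Qed.

End FrameInduction.

(** * Presenting idempotents *)

Section TensorCoordinates.
Variables (K : fieldType) (U : lmodType K) (V : vectType K) (n : nat) (y : n.-tuple V).
Hypothesis y_basis : basis_of fullv y.
Implicit Types (m : tensor U V) (e : 'I_n -> U).

Definition tensor_coord (k : 'I_n) : tensor U V -> U :=
  tlift (fun a v => coord y k v *: a).

Lemma balanced_coord k : balanced (fun (a : U) v => coord y k v *: a).
Proof.
split=> [v a a'|a v v'|c a v].
- by rewrite scalerDr.
- by rewrite linearD scalerDl.
- have -> : coord y k (c *: v) = c * coord y k v by exact: linearZ.
  by rewrite scalerA mulrC.
Qed.

Lemma tensor_coord_tens k a v : tensor_coord k (tens a v) = coord y k v *: a.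
Proof. exact: (tlift_tens (balanced_coord k)). Qed.

Lemma tensor_coordD k : {morph tensor_coord k : m m' / m + m'}.
Proof. exact: (tliftD (balanced_coord k)). Qed.

Lemma tensor_coord_basis e k : tensor_coord k (\sum_j tens (e j) y`_j) = e k.
Proof.
rewrite /tensor_coord (tlift_sum (balanced_coord k)).
under eq_bigr do rewrite (tlift_tens (balanced_coord k)) coord_free ?(basis_free y_basis) //.
rewrite (bigD1 k) //= eqxx scale1r big1 ?addr0 // => j jk.
by rewrite (negPf jk) scale0r.
Qed.

Lemma tensor_decomposition m : m = \sum_j tens (tensor_coord j m) y`_j.
Proof.
elim/tensor_ind: m => [|a v|m m' IHm IHm'].
- rewrite big1 // => j _; rewrite [tensor_coord j 0](tlift0 (balanced_coord j)).
  exact: tens0l.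
- rewrite {1}(coord_basis y_basis (memvf v)) tens_sumr; apply: eq_bigr => j _.
  by rewrite tensor_coord_tens tensZl tensZr.
- rewrite {1}IHm {1}IHm' -big_split; apply: eq_bigr => j _ /=.
  by rewrite tensor_coordD tensDl.
Qed.

End TensorCoordinates.

Section CotensorCoordinates.
Variables (C : numClosedFieldType) (H A : starAlgType C) (deltaR : A -> tensor A H).
Hypothesis delta_lin : linear deltaR.
Variables (V : vectType C) (deltaL : V -> tensor H V) (n : nat) (y : n.-tuple V).
Hypothesis y_basis : basis_of fullv y.
Hypothesis deltaL_lin : linear deltaL.
Variable t : 'I_n -> 'I_n -> H.
Hypothesis deltaL_y : forall j : 'I_n, deltaL y`_j = \sum_l tens (t j l) y`_l.

(** Comparing components along a basis of V turns the cotensor condition into equivariance of the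
    coordinates. *)
Lemma cotensor_coord (m : tensor A V) : cotensor deltaR deltaL m <->
  forall k, deltaR (tensor_coord y k m) = \sum_l tens (tensor_coord y l m) (t l k).
Proof.
have idA : linear (@id A) by [].
have idV : linear (@id V) by [].
set e := fun k => tensor_coord y k m; rewrite -[forall k, _]/(forall k, deltaR (e k) = _).
have mE : m = \sum_j tens (e j) y`_j by exact: tensor_decomposition.
have L : tmap deltaR id m = \sum_j tens (deltaR (e j)) y`_j.
  rewrite mE (tmap_sum _ _ _ delta_lin idV); apply: eq_bigr => j _.
  exact: tmap_tens.
have Rr : tassoc (tmap id deltaL m) =
    \sum_j tens (\sum_l tens (e l) (t l j) : tensor A H) y`_j.
  rewrite mE (tmap_sum _ _ _ idA deltaL_lin).
  transitivity (\sum_j \sum_l tens (tens (e j) (t j l) : tensor A H) y`_l).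
    rewrite /tassoc (tlift_sum (balanced_tassoc A H V)); apply: eq_bigr => j _.
    rewrite (tmap_tens _ _ idA deltaL_lin) deltaL_y tens_sumr.
    rewrite (tlift_sum (balanced_tassoc A H V)); apply: eq_bigr => l _.
    exact: tassoc_tens.
  by rewrite exchange_big; apply: eq_bigr => j _; rewrite tens_suml.
rewrite /cotensor /= L Rr; split=> [E k|E].
  by have := congr1 (tensor_coord y k) E; rewrite !tensor_coord_basis.
by apply: eq_bigr => j _; rewrite E.
Qed.

Lemma tensor_coord_mulr k (m : tensor A V) (b : A) :
  tensor_coord y k (tensor_mulr m b) = tensor_coord y k m * b.
Proof.
have mulL : linear (fun a : A => a * b) by move=> c a a'; rewrite mulrDl scale_mulrl.
have idV : linear (@id V) by [].
rewrite /tensor_mulr.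
rewrite {1}(tensor_decomposition y_basis m) (tmap_sum _ _ _ mulL idV).
under eq_bigr do rewrite (tmap_tens _ _ mulL idV).
exact: tensor_coord_basis.
Qed.

End CotensorCoordinates.

(** * Presenting idempotents and their Chern number *)

Section Presentation.
Variables (R : realType) (q : R) (q01 : 0 < q < 1).
Local Notation A := (O_S7 q).
Local Notation H := (O_SUq2 q).
Variables (deltaR : A -> tensor A H) (deltaRP : is_S7_coaction deltaR).
Variables (eps : A -> R[i]) (epsP : is_S7_character eps).
Variables (pi : A -> ell2 R (nat * nat)%type -> ell2 R (nat * nat)%type).
Hypothesis piP : is_S7_rep pi.
Local Notation ch := (chern_number eps pi).
Local Notation frame := (frame deltaR).
Local Notation equivariant := (equivariant deltaR).
Local Notation B := (coinvariants deltaR).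
Let delta_hom := proj1 deltaRP.

Lemma equivariantD (I : finType) (t : I -> I -> H) e e' :
  equivariant t e -> equivariant t e' -> equivariant t (fun k => e k + e' k).
Proof.
move=> te te' k; rewrite (star_homD delta_hom) te te' -big_split; apply: eq_bigr => l _ /=.
by rewrite tensDl.
Qed.

Lemma equivariantM (I : finType) (t : I -> I -> H) e b :
  equivariant t e -> B b -> equivariant t (fun k => e k * b).
Proof.
move=> te Bb k; rewrite (star_homM delta_hom) te Bb.
rewrite [LHS]mulr_suml; apply: eq_bigr => l _.
by rewrite [LHS]tens_mul mulr1.
Qed.

Lemma equivariant0 (I : finType) (t : I -> I -> H) : equivariant t (fun=> 0).
Proof.
by move=> k; rewrite (star_hom0 delta_hom) big1 // => l _; exact: tens0l.
Qed.

Lemma equivariant_sum (I : finType) (t : I -> I -> H) K (r : seq K) (e : K -> I -> A) :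
  (forall j, equivariant t (e j)) -> equivariant t (fun k => \sum_(j <- r) e j k).
Proof.
move=> te; elim: r => [|j r IHr] k.
  by rewrite big_nil (equivariant0 t k); apply: eq_bigr => l _; rewrite big_nil.
rewrite big_cons (equivariantD (te j) IHr k); apply: eq_bigr => l _.
by rewrite big_cons.
Qed.

Variables (M : zmodType) (act : M -> A -> M) (F : set M).
(** [c] stands for the coordinates on the tensor product with V in a weight basis; [F] corresponds
    to the equivariant families. *)
Variables (I : finType) (t : I -> I -> H) (c : I -> M -> A).
Hypothesis cD : forall k m m', c k (m + m') = c k m + c k m'.
Hypothesis c_act : forall k m b, c k (act m b) = c k m * b.
Hypothesis c_inj : forall m m', (forall k, c k m = c k m') -> m = m'.
Hypothesis c_surj : forall e : I -> A, exists m, forall k, c k m = e k.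
Hypothesis c_equivariant : forall m, F m <-> equivariant t (fun k => c k m).

Variables (N : finType) (w v : N -> I -> A).
Hypothesis WV : frame t w v.

Lemma frame_expand e k : \sum_j w j k * (\sum_m v j m * e m) = e k.
Proof.
transitivity (\sum_m (\sum_j w j k * v j m) * e m).
  under eq_bigr do rewrite mulr_sumr.
  rewrite exchange_big /=; apply: eq_bigr => m _; rewrite mulr_suml.
  by apply: eq_bigr => j _; rewrite mulrA.
rewrite (bigD1 k) //= (frame_unit WV) eqxx scale1r mul1r big1 ?addr0 // => m mk.
by rewrite (frame_unit WV) eq_sym (negPf mk) scale0r mul0r.
Qed.

Definition frame_mx : 'M[A]_#|N| :=
  \matrix_(i, j) \sum_k v (enum_val i) k * w (enum_val j) k.

Lemma frame_mxM i (e : I -> A) :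
  \sum_j frame_mx i j * (\sum_k v (enum_val j) k * e k) = \sum_k v (enum_val i) k * e k.
Proof.
under eq_bigr do rewrite mxE mulr_suml.
rewrite exchange_big /=; apply: eq_bigr => k _.
under eq_bigr do rewrite -mulrA.
rewrite -[in RHS](frame_expand e k) [RHS]mulr_sumr [RHS](reindex (@enum_val N N)) //=.
by apply: onW_bij; exact: enum_val_bij.
Qed.

(** The isomorphism sends [m] to its pairings with the [v], from which [frame_expand] recovers
    [m]. *)
Lemma frame_presents : presents B frame_mx act F.
Proof.
pose f m : 'cV[A]_#|N| := \col_i \sum_k v (enum_val i) k * c k m.
have Pf m : frame_mx *m f m = f m.
  apply/colP => i; rewrite !mxE; under eq_bigr do rewrite [f m _ _]mxE.
  exact: frame_mxM.
split.
  split=> [i j|].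
    by rewrite mxE; apply: (frame_pairing WV); exact: (frame_equivariant WV).
  apply/matrixP => i j; rewrite mxE.
  under eq_bigr do rewrite [frame_mx _ j]mxE.
  by rewrite frame_mxM mxE.
exists f; split.
- split.
  + move=> m Fm; exists (f m); last exact: Pf.
    by move=> i; rewrite mxE; apply: (frame_pairing WV); apply/c_equivariant.
  + move=> m m' _ _ E; apply: c_inj => k.
    rewrite -(frame_expand (fun k => c k m) k) -(frame_expand (fun k => c k m') k).
    apply: eq_bigr => j _; congr (_ * _).
    by have := congr1 (fun x : 'cV_#|N| => x (enum_rank j) 0) E; rewrite !mxE enum_rankK.
  + move=> _ [x Bx <-]; have [m cm] := c_surj (fun k => \sum_i w (enum_val i) k * x i 0).
    exists m.
      apply/c_equivariant => k; rewrite cm.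
      under [RHS]eq_bigr do rewrite cm.
      apply: equivariant_sum => i; apply: equivariantM; last exact: Bx.
      exact: (frame_equivariant WV).
    apply/colP => i; rewrite !mxE.
    under eq_bigr do rewrite cm mulr_sumr.
    rewrite exchange_big; apply: eq_bigr => j _ /=; rewrite mxE mulr_suml.
    by apply: eq_bigr => k _; rewrite mulrA.
- move=> m m' _ _; apply/colP => i; rewrite !mxE -big_split; apply: eq_bigr => k _ /=.
  by rewrite cD [LHS](@mulrDr A).
- move=> m b _ _; apply/colP => i; rewrite !mxE mulr_suml; apply: eq_bigr => k _.
  by rewrite c_act mulrA.
Qed.

(** Equivalence of idempotents: the elements [W J] over the columns of [P] and the frame elements
    [m_ i] express each other with coinvariant coefficients [b] and [a]. Then [P] is [a b], while
    [b a] has the diagonal of the frame idempotent, and [ch_exchange] compares the traces. *)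
Lemma presents_ch K (P : 'M[A]_K) : presents B P act F -> ch (\tr P) = ch (frame_trace w v).
Proof.
move=> [[BP PP] [f [[f_range f_inj f_surj] fD f_act]]].
have c0 k : c k 0 = 0 by apply: (addrI (c k 0)); rewrite -cD !addr0.
have c_sum J (r : seq J) (m : J -> M) k : c k (\sum_(j <- r) m j) = \sum_(j <- r) c k (m j).
  by apply: (big_morph _ (cD k)).
have F0 : F 0.
  apply/c_equivariant => k; rewrite c0 (equivariant0 t k).
  by apply: eq_bigr => l _; rewrite c0.
have f0 : f 0 = 0 by apply: (addrI (f 0)); rewrite -fD // !addr0.
have F_act m b : F m -> B b -> F (act m b).
  move=> /c_equivariant Fm Bb; apply/c_equivariant => k.
  by rewrite c_act (equivariantM Fm Bb k); apply: eq_bigr => l _; rewrite c_act.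
have F_sum J (r : seq J) (m : J -> M) : (forall j, F (m j)) -> F (\sum_(j <- r) m j).
  move=> Fm; apply: big_ind => // m1 m2 /c_equivariant F1 /c_equivariant F2.
  apply/c_equivariant => k; rewrite cD (equivariantD F1 F2 k).
  by apply: eq_bigr => l _; rewrite cD.
have f_sum J (r : seq J) (m : J -> M) : (forall j, F (m j)) ->
    f (\sum_(j <- r) m j) = \sum_(j <- r) f (m j).
  move=> Fm; elim: r => [|j r IHr]; first by rewrite !big_nil.
  by rewrite !big_cons fD ?IHr //; exact: F_sum.
have f_col m : F m -> P *m f m = f m /\ forall i, B (f m i 0).
  move=> Fm; have [x Bx <-] := f_range m Fm; split; first by rewrite mulmxA PP.
  by move=> i; rewrite mxE; apply: coinvariant_sum => // j; exact: coinvariantM.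
(* Column [J] of [P] is the image of a standard basis vector, hence lies in the range. *)
have ex_W J : exists m, F m /\ f m = col J P.
  have [|m Fm fm] := f_surj (col J P); last by exists m.
  rewrite colE; exists (delta_mx J 0) => // i; rewrite mxE.
  by case: (_ && _); [exact: coinvariant1|exact: coinvariant0].
have [W FW] := boolp.choice ex_W.
have ex_m i : exists m, forall k, c k m = w i k by exact: c_surj.
have [m_ cm] := boolp.choice ex_m.
have Fm i : F (m_ i).
  apply/c_equivariant => k; rewrite cm (frame_equivariant WV).
  by apply: eq_bigr => l _; rewrite cm.
pose a J i := f (m_ i) J 0; pose b i J := \sum_k v i k * c k (W J).
have Ba J i : B (a J i) by exact: (proj2 (f_col _ (Fm i))) J.
have Bb i J : B (b i J).
  by apply: (frame_pairing WV); apply/c_equivariant; case: (FW J).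
have W_sum J : W J = \sum_i act (m_ i) (b i J).
  apply: c_inj => k; rewrite c_sum; under eq_bigr do rewrite c_act cm.
  by rewrite frame_expand.
have PE J' J : P J' J = \sum_i a J' i * b i J.
  have -> : P J' J = f (W J) J' 0 by rewrite (proj2 (FW J)) mxE.
  rewrite W_sum f_sum => [|i]; last exact: F_act.
  by rewrite summxE; apply: eq_bigr => i _; rewrite f_act // mxE.
have m_sum i : m_ i = \sum_J act (W J) (a J i).
  have FWa J : F (act (W J) (a J i)) by apply: F_act => //; case: (FW J).
  apply: f_inj; rewrite ?inE //; first exact: F_sum.
  rewrite f_sum // -(proj1 (f_col _ (Fm i))); apply/colP => J'; rewrite mxE summxE.
  by apply: eq_bigr => J _; have [FJ fJ] := FW J; rewrite f_act // fJ !mxE.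
transitivity (ch (\sum_J \sum_i a J i * b i J)).
  by congr (ch _); rewrite /mxtrace; apply: eq_bigr => J _; exact: PE.
rewrite (ch_exchange q01 deltaRP epsP piP) //; congr (ch _); apply: eq_bigr => i _.
have -> : \sum_k v i k * w i k = \sum_k v i k * c k (m_ i).
  by apply: eq_bigr => k _; rewrite cm.
rewrite /b; under eq_bigr do rewrite mulr_suml; rewrite exchange_big; apply: eq_bigr => k _ /=.
rewrite m_sum c_sum mulr_sumr; apply: eq_bigr => J _.
by rewrite c_act mulrA.
Qed.

End Presentation.

Theorem proposition5p4 (R : realType) (q : R) (q01 : 0 < q < 1)
  (Delta : O_SUq2 q -> tensor (O_SUq2 q) (O_SUq2 q))
  (DeltaP : is_SUq2_coproduct Delta)
  (counit : O_SUq2 q -> R[i]) (counitP : is_SUq2_counit counit)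
  (deltaR : O_S7 q -> tensor (O_S7 q) (O_SUq2 q))
  (deltaRP : is_S7_coaction deltaR)
  (eps : O_S7 q -> R[i]) (epsP : is_S7_character eps)
  (pi : O_S7 q -> ell2 R (nat * nat)%type -> ell2 R (nat * nat)%type)
  (piP : is_S7_rep pi)
  (n : nat) (n_ge1 : (1 <= n)%N)
  (V : vectType R[i]) (deltaL : V -> tensor (O_SUq2 q) V)
  (V_irr : irreducible_left_comodule Delta counit deltaL)
  (V_dim : \dim (fullv : {vspace V}) = n.+1) :
  ch1_is (coinvariants deltaR) pi eps
    (@tensor_mulr _ (O_S7 q) V) (cotensor deltaR deltaL)
    (- (1 / 6%:R * n%:R * (n%:R + 1) * (n%:R + 2%:R))).

Proof.
have [y [y_basis dy]] := irreducible_basis q01 DeltaP counitP V_irr V_dim.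
pose gen g : O_SUq2 q := presented_gen (@SUq2_rel R q) g.
pose t := @corep_mx _ _ q%:C%C (gen Alpha) (- q%:C%C *: (gen Gamma)^*s) (gen Gamma)
  (gen Alpha)^*s n.+1.
have deltaL_lin : linear deltaL by case: V_irr => [[]].
have delta_lin := star_hom_linear (proj1 deltaRP).
have [N [w [v [WV chW]]]] := has_frameP q01 deltaRP epsP piP n.+1.
have cD k := tensor_coordD (U := O_S7 q) y k.
have c_act k (m : tensor (O_S7 q) V) b := tensor_coord_mulr y_basis k m b.
have c_inj (m m' : tensor (O_S7 q) V) :
    (forall k, tensor_coord y k m = tensor_coord y k m') -> m = m'.
  move=> E; rewrite (tensor_decomposition y_basis m) (tensor_decomposition y_basis m').
  by apply: eq_bigr => j _; rewrite E.
have c_surj (e : 'I_n.+1 -> O_S7 q) : exists m, forall k, tensor_coord y k m = e k.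
  by eexists; exact: tensor_coord_basis.
have cE m : cotensor deltaR deltaL m <-> equivariant deltaR t (fun k => tensor_coord y k m).
  exact: (cotensor_coord delta_lin y_basis deltaL_lin dy).
split.
  by eexists; eexists; exact: (frame_presents deltaRP cD c_act c_inj c_surj cE WV).
move=> K P PF T.
have BP : coinvariants deltaR (\tr P) by case: PF => [[BP _] _]; exact: coinvariant_sum.
have JP := ch_ideal q01 deltaRP epsP piP BP.
(* The operator of [ch1_is] is thus the image under [pi] of an element of the trace ideal. *)
have TE : T = pi (\tr P - eps (\tr P) *: (1 : O_S7 q)).
  apply/funext => x; rewrite /T.
  by rewrite -[in RHS]scaleNr (rep_D (proj1 piP)) (rep_Z (proj1 piP)) (rep1 (proj1 piP)) scaleNr.
have [tP trP] := trace_ideal_trace_class (proj1 piP) (pi_x2 piP) (weight01 q01)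
  (weight_summable q01) JP.
rewrite TE; split=> //; rewrite trP.
rewrite -[LHS]/(chern_number eps pi (\tr P)).
rewrite (presents_ch q01 deltaRP epsP piP cD c_act c_inj c_surj cE WV PF) chW.
by rewrite /ch_value -!natr1; field.
Qed.
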